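(* Let $a>0$, $0<L<\infty$, $f\in L^2(0,L)$, and $l,k\in\mathbb{N}$ with $1\le k\le 4l$. Consider the boundary value problem $$au+\sum_{j=1}^{l}(-1)^{j+1}D^{2j+1}u+u^kDu=f\quad\text{in }(0,L),$$ $$D^{i}u(0)=D^{i}u(L)=D^{l}u(L)=0,\qquad i=0,\ldots,l-1.$$ Let $((1+x),f^2)$ be sufficiently small. Then the regular solution $u\in H^{2l+1}(0,L)$ of this problem, whose existence is provided by the existence theorem recalled in the context, is unique and continuously depends on perturbations of $f$.
   Context: Functions are real-valued on $(0,L)$; $D^i=d^i/dx^i$, $D=D^1$. $(\cdot,\cdot)$ is the inner product and $\|\cdot\|$ the norm of $L^2(0,L)$, so $((1+x),f^2)=\int_0^L(1+x)f(x)^2\,dx$; $\|\cdot\|_{H^{2l+1}}$ is the norm of $H^{2l+1}(0,L)$. A regular solution is a solution $u\in H^{2l+1}(0,L)$ of the equation and boundary conditions. The existence theorem referred to states the following, for $f\in L^2(0,L)$. If $1\le k<4l$ (regular case), the problem admits at least one regular solution $u\in H^{2l+1}(0,L)$, with $\|u\|_{H^{2l+1}}\le \mathcal{C}\,((1+x),f^2)^{1/2}$, where $\mathcal{C}$ depends only on $L,l,k,a$ and $((1+x),f^2)$. If $k=4l$ (critical case) and $\|f\|<\frac{[(2l+1)(4l+2)]^{1/(4l)}\,a}{2^{1/(4l)}C_*}$, the problem admits at least one regular solution $u\in H^{2l+1}(0,L)$, with $\|u\|_{H^{2l+1}}\le \mathcal{C}'\,((1+x),f^2)^{1/2}$, where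 $\mathcal{C}'$ depends only on $L,l,a$ and $((1+x),f^2)$. Here $C_*$ is the absolute constant in the Gagliardo–Nirenberg inequality $\|u\|_{L^\infty(0,L)}\le C_*\|D^lu\|^{1/(2l)}\|u\|^{1-1/(2l)}$ for $u\in H_0^l(0,L)$. *)

(* Defs.v *)
From HB Require Import structures.
From mathcomp Require Import all_boot all_order all_algebra.
From mathcomp Require Import all_classical all_reals all_analysis.

Set Implicit Arguments.
Unset Strict Implicit.
Unset Printing Implicit Defensive.

Import Order.TTheory GRing.Theory Num.Theory.
Import numFieldNormedType.Exports.

Local Open Scope classical_set_scope.
Local Open Scope ring_scope.

(* Functions on (0, L) are represented by total functions R -> R of which only
   the restriction to `]0, L[ matters; all notions below are invariant under
   modification outside `]0, L[ or on a Lebesgue-null set. *)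

Definition inL2 (R : realType) (L : R) (f : R -> R) : Prop :=
  measurable_fun `]0, L[ f /\
  (@lebesgue_measure R).-integrable `]0, L[ (fun x => (f x ^+ 2)%:E).

Definition L2norm (R : realType) (L : R) (f : R -> R) : R :=
  Num.sqrt (\int[@lebesgue_measure R]_(x in `]0, L[) (f x ^+ 2)).

(* ((1 + x), f ^ 2) *)
Definition weighted_sq (R : realType) (L : R) (f : R -> R) : R :=
  \int[@lebesgue_measure R]_(x in `]0, L[) ((1 + x) * f x ^+ 2).

Definition ae_eq_on (R : realType) (L : R) (f g : R -> R) : Prop :=
  ae_eq (V := fun=> R) (@lebesgue_measure R) [set` `]0, L[] f g.

(* The class C^1_c(0, L). *)
Definition test_function (R : realType) (L : R) (phi : R -> R) : Prop :=
  [/\ forall x, derivable phi x 1,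
      continuous (derive1 phi) &
      exists p q : R, [/\ 0 < p, q < L &
        forall x, ~ (p <= x <= q) -> phi x = 0]].

(* v is the weak derivative of u on (0, L). In one dimension, testing against
   C^1_c(0, L) (as in Brezis, Functional Analysis, Sobolev Spaces and PDE,
   Section 8.2) or against C^oo_c(0, L) gives the same notion. *)
Definition weak_derivative (R : realType) (L : R) (u v : R -> R) : Prop :=
  forall phi, test_function L phi ->
    \int[@lebesgue_measure R]_(x in `]0, L[) (u x * derive1 phi x) =
    - \int[@lebesgue_measure R]_(x in `]0, L[) (v x * phi x).

(* u \in H^m(0, L) *)
Fixpoint inH (R : realType) (L : R) (m : nat) (u : R -> R) : Prop :=
  match m with
  | 0 => inL2 L u
  | m'.+1 => inL2 L u /\ exists v, weak_derivative L u v /\ inH L m' v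
  end.

(* A chosen representative of the weak derivative in L^2, which is unique up
   to a null set (junk if there is none). *)
Definition wD (R : realType) (L : R) (u : R -> R) : R -> R :=
  xget (fun=> 0) [set v | inL2 L v /\ weak_derivative L u v].

Definition wDn (R : realType) (L : R) (i : nat) (u : R -> R) : R -> R :=
  iter i (wD L) u.

Definition Hnorm (R : realType) (L : R) (m : nat) (u : R -> R) : R :=
  Num.sqrt (\sum_(i < m.+1) L2norm L (wDn L i u) ^+ 2).

(* The value of v at the point x of [0, L] (possibly an endpoint) is c: it is
   the value of the representative of v that is continuous on [0, L]. *)
Definition trace_eq (R : realType) (L : R) (v : R -> R) (x c : R) : Prop :=
  exists w : R -> R,
    [/\ {within `[0, L], continuous w}, ae_eq_on L v w & w x = c].

Definition regular_solution (R : realType) (a L : R) (l k : nat)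
    (f u : R -> R) : Prop :=
  [/\ inH L (2 * l + 1) u,
      ae_eq_on L
        (fun x => a * u x
           + \sum_(1 <= j < l.+1) (-1) ^+ (j + 1) * wDn L (2 * j + 1) u x
           + u x ^+ k * wDn L 1 u x)
        f,
      forall i : nat, (i < l)%N ->
        trace_eq L (wDn L i u) 0 0 /\ trace_eq L (wDn L i u) L 0 &
      trace_eq L (wDn L l u) L 0].

(* Main.v *)
(* A function u in H^(2l+1) is handled through the continuous representatives
   w_0, .., w_(2l) of its derivatives and w_(2l+1) in L^2, each being a
   primitive of the next one; this is the du Bois-Reymond lemma.  Multiplying
   the equation by u and by (1 + x) u gives, for the linear problem, bounds on
   the norms of u, Du and D^l u by the norm of the right-hand side, and, by
   interpolation, a bound on the whole H^(2l+1) norm.  Solutions of the linear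
   initial value problem are obtained by Picard iteration, and the boundary
   conditions are then met by solving a square linear system whose matrix is
   invertible, by the energy estimate.  The nonlinear problem with small data
   is solved by a contraction in C^1.  For an arbitrary solution, the
   nonlinear term vanishes against u, so that the mass is small, and
   Gagliardo-Nirenberg makes sup |u| small.  For two solutions u and v with
   small suprema, z = u - v is then estimated by the multiplier (1 + x) z,
   since the difference of the nonlinear terms is the derivative of
   (u^(k+1) - v^(k+1)) / (k + 1), which is bounded by a small multiple of |z|. *)
Require Import Defs.
From HB Require Import structures.
From mathcomp Require Import all_boot all_order all_algebra.
From mathcomp Require Import all_classical all_reals all_analysis.
From mathcomp Require Import measurable_realfun ring lra zify.
Import Order.TTheory GRing.Theory Num.Theory.
Import numFieldNormedType.Exports.
Local Open Scope classical_set_scope.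
Local Open Scope ring_scope.

Set Implicit Arguments.
Unset Strict Implicit.
Unset Printing Implicit Defensive.

(** * Integration on a segment *)

(** The contraction only yields uniqueness in a small ball of C^1, whereas uniqueness and continuous
    dependence concern every regular solution. A bound valid for all solutions is therefore needed,
    and it is there that k <= 4 l enters: tested with (1 + x) u, the nonlinear term can be absorbed
    by the norm of D^l u when the mass is small. The weight 1 + x makes the odd-order operator
    coercive: multiplied by u, an odd derivative leaves only boundary terms, while the derivative of
    the weight leaves (2 j + 1) / 2 times the squared norm of D^j u, with the same sign for all j
    thanks to the alternating coefficients. The thresholds on the data depend on a, L, l and k only,
    never on f, as the order of the quantifiers demands. For continuous dependence, the difference
    of two solutions solves a linear problem, so an L^2 bound on its right-hand side controls the
    full norm. *)

Section IntervalIntegral.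
Context {R : realType}.
Notation mu := (@lebesgue_measure R).
Implicit Types (a b c d k x y z M : R) (f g h u v w : R -> R).

Definition L1 a b f := mu.-integrable `[a, b] (EFin \o f).
Definition J a b f : R := \int[mu]_(t in `[a, b]) f t.
Definition C0 a b f := {within `[a, b], continuous f}.
Definition aeq a b f g := ae_eq (V := fun=> R) mu [set` `[a, b]] f g.
(** Measurability of [f] does not follow from that of its square, hence the separate condition. *)
Definition sqint a b f :=
  measurable_fun `[a, b] f /\ L1 a b (fun x => f x ^+ 2).

Lemma muitv_fin a b : (mu `[a, b] < +oo)%E.
Proof.
rewrite lebesgue_measure_itv /=; case: ifP => // _.
by rewrite -EFinB ltry.
Qed.

Lemma L1_meas a b f : L1 a b f -> measurable_fun `[a, b] f.
Proof. by move=> /integrableP[/measurable_EFinP]. Qed.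

Lemma L1_eq a b f g : (forall x, a <= x <= b -> f x = g x) ->
  L1 a b f -> L1 a b g.
Proof.
move=> fg; apply: eq_integrable => // x; rewrite inE /= in_itv /= => xab.
by rewrite fg.
Qed.

Lemma L1_le a b f g : measurable_fun `[a, b] f -> L1 a b g ->
  (forall x, a <= x <= b -> `|f x| <= g x) -> L1 a b f.
Proof.
move=> mf Lg fg; apply: le_integrable Lg => //; first exact/measurable_EFinP.
move=> x /=; rewrite in_itv /= => /fg H; rewrite lee_fin.
by rewrite (le_trans H)// ler_norm.
Qed.

Lemma L1D a b f g : L1 a b f -> L1 a b g -> L1 a b (fun x => f x + g x).
Proof. by move=> Lf Lg; apply: integrableD Lf Lg. Qed.

Lemma L1B a b f g : L1 a b f -> L1 a b g -> L1 a b (fun x => f x - g x).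
Proof. by move=> Lf Lg; apply: integrableB Lf Lg. Qed.

Lemma L1Z a b k f : L1 a b f -> L1 a b (fun x => k * f x).
Proof. by move=> Lf; apply: integrableZl Lf. Qed.

Lemma L1_abs a b f : L1 a b f -> L1 a b (fun x => `|f x|).
Proof. by move=> Lf; apply: integrable_norm Lf. Qed.

Lemma L1_sub a b c d f : a <= c -> d <= b -> L1 a b f -> L1 c d f.
Proof.
move=> ac db; apply: integrableS => //; apply: subset_itv; rewrite bnd_simp//.
Qed.

Lemma C0_meas a b f : C0 a b f -> measurable_fun `[a, b] f.
Proof. by move=> cf; apply: subspace_continuous_measurable_fun. Qed.

Lemma C0_abs a b f : C0 a b f -> C0 a b (fun x => `|f x|).
Proof.
by move=> cf x; apply: continuous_comp; [exact: cf|exact: norm_continuous].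
Qed.

Lemma C0_bnd a b f : C0 a b f ->
  exists2 M : R, 0 <= M & forall x, a <= x <= b -> `|f x| <= M.
Proof.
move=> cf; case: (leP a b) => [ab|ba]; last first.
  by exists 0 => // x /andP[ax xb]; move: (le_trans ax xb); rewrite leNgt ba.
have [c _ cM] := EVT_max ab (C0_abs cf).
by exists `|f c| => // x xab; apply: cM; rewrite in_itv.
Qed.

Lemma C0_cst a b k : C0 a b (fun _ => k).
Proof. by apply: continuous_subspaceT => x; exact: cst_continuous. Qed.

Lemma C0_id a b : C0 a b (fun x => x).
Proof. by apply: continuous_subspaceT => x; exact: cvg_id. Qed.

Lemma C0D a b f g : C0 a b f -> C0 a b g -> C0 a b (fun x => f x + g x).
Proof. by move=> cf cg x; apply: (@continuousD _ _ (subspace `[a, b])); [exact: cf|exact: cg]. Qed.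

Lemma C0M a b f g : C0 a b f -> C0 a b g -> C0 a b (fun x => f x * g x).
Proof. by move=> cf cg x; apply: (@continuousM _ (subspace `[a, b])); [exact: cf|exact: cg]. Qed.

Lemma C0Z a b k f : C0 a b f -> C0 a b (fun x => k * f x).
Proof. by move=> cf; apply: C0M => //; exact: C0_cst. Qed.

Lemma C0B a b f g : C0 a b f -> C0 a b g -> C0 a b (fun x => f x - g x).
Proof. by move=> cf cg x; apply: (@continuousB _ _ (subspace `[a, b])); [exact: cf|exact: cg]. Qed.

Lemma C0X a b n f : C0 a b f -> C0 a b (fun x => f x ^+ n).
Proof.
move=> cf; elim: n => [|n IH]; first exact: C0_cst.
have -> : (fun x => f x ^+ n.+1) = (fun x => f x * f x ^+ n).
  by apply/funext => x; rewrite exprS.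
exact: C0M.
Qed.

Lemma C0_eq a b f g : (forall x, a <= x <= b -> f x = g x) ->
  C0 a b f -> C0 a b g.
Proof.
move=> fg; apply: subspace_eq_continuous => x.
by rewrite inE /= in_itv /= => /fg.
Qed.

Lemma C0_sub a b c d f : a <= c -> d <= b -> C0 a b f -> C0 c d f.
Proof.
move=> ac db; apply: continuous_subspaceW; apply: subset_itv; rewrite bnd_simp//.
Qed.

Lemma bounded_on a b f M : (forall x, a <= x <= b -> `|f x| <= M) ->
  [bounded f x | x in `[a, b]].
Proof.
move=> fM; exists M; split; first exact: num_real.
move=> K MK x /=; rewrite in_itv /= => /fM H; exact: le_trans (ltW MK).
Qed.

Lemma L1_bnd a b f M : measurable_fun `[a, b] f ->
  (forall x, a <= x <= b -> `|f x| <= M) -> L1 a b f.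
Proof.
move=> mf fM; apply: measurable_bounded_integrable => //.
- exact: muitv_fin.
- exact: bounded_on fM.
Qed.

Lemma C0_L1 a b f : C0 a b f -> L1 a b f.
Proof.
move=> cf; have [M _ fM] := C0_bnd cf.
exact: L1_bnd (C0_meas cf) fM.
Qed.

Lemma L1M_C0 a b f g : C0 a b f -> L1 a b g -> L1 a b (fun x => f x * g x).
Proof.
move=> cf Lg; have [M _ fM] := C0_bnd cf.
have H := integrableMr (mu := mu) (measurable_itv _) (C0_meas cf)
  (bounded_on fM) Lg.
by apply: eq_integrable H.
Qed.

Lemma JD a b f g : L1 a b f -> L1 a b g ->
  J a b (fun x => f x + g x) = J a b f + J a b g.
Proof. by move=> Lf Lg; apply: RintegralD. Qed.

Lemma JB a b f g : L1 a b f -> L1 a b g ->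
  J a b (fun x => f x - g x) = J a b f - J a b g.
Proof. by move=> Lf Lg; apply: RintegralB. Qed.

Lemma JZ a b k f : L1 a b f -> J a b (fun x => k * f x) = k * J a b f.
Proof. by move=> Lf; apply: RintegralZl. Qed.

Lemma Jeq a b f g : (forall x, a <= x <= b -> f x = g x) -> J a b f = J a b g.
Proof.
by move=> fg; apply: eq_Rintegral => x; rewrite inE /= in_itv /= => /fg.
Qed.

Lemma Jle a b f g : L1 a b f -> L1 a b g ->
  (forall x, a <= x <= b -> f x <= g x) -> J a b f <= J a b g.
Proof.
by move=> Lf Lg fg; apply: le_Rintegral => // x /=; rewrite in_itv; exact: fg.
Qed.

Lemma Jge0 a b f : (forall x, a <= x <= b -> 0 <= f x) -> 0 <= J a b f.
Proof.
by move=> f0; apply: Rintegral_ge0 => x /=; rewrite in_itv; exact: f0.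
Qed.

Lemma Jabs a b f : L1 a b f -> `|J a b f| <= J a b (fun x => `|f x|).
Proof. by move=> Lf; apply: le_normr_Rintegral. Qed.

Lemma Jcst a b k : a <= b -> J a b (fun _ => k) = k * (b - a).
Proof.
move=> ab; rewrite /J Rintegral_cst//; congr (_ * _).
have := @lebesgue_measure_itv R `[a, b]; rewrite /= lte_fin.
by case: ltgtP ab => //= [_|->] _ ->//=; rewrite subrr.
Qed.

Lemma Jsup a b f M : a <= b -> L1 a b f ->
  (forall x, a <= x <= b -> `|f x| <= M) -> `|J a b f| <= M * (b - a).
Proof.
move=> ab Lf fM; rewrite (le_trans (Jabs Lf))// -Jcst//.
by apply: Jle => //; [exact: L1_abs|exact/C0_L1/C0_cst].
Qed.

Lemma Jaa a f : J a a f = 0.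
Proof. by rewrite /J set_itv1 Rintegral_set1. Qed.

Lemma Jsplit a b c f : a <= c -> c <= b -> L1 a b f ->
  J a b f = J a c f + J c b f.
Proof.
move=> ac cb Lf; have := @Rintegral_itvB _ f (BLeft a) (BRight b) c Lf.
rewrite !bnd_simp => /(_ ac cb) H.
have := @Rintegral_itv_obnd_cbnd _ c (BRight b) f.
rewrite /J -H => <-; first by rewrite addrC subrK.
by apply: integrableS Lf => //; apply: subset_itvr; rewrite bnd_simp.
Qed.

Lemma aeq_refl a b f : aeq a b f f.
Proof. exact: ae_eq_refl. Qed.

Lemma aeq_sym a b f g : aeq a b f g -> aeq a b g f.
Proof. exact: ae_eq_sym. Qed.

Lemma aeq_trans a b f g h : aeq a b f g -> aeq a b g h -> aeq a b f h.
Proof. exact: ae_eq_trans. Qed.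

Lemma aeq_eq a b f g : (forall x, a <= x <= b -> f x = g x) -> aeq a b f g.
Proof. by move=> fg; apply: aeW => x /=; rewrite in_itv; exact: fg. Qed.

Lemma aeq_map a b (F : R -> R -> R) f g : aeq a b f g ->
  aeq a b (fun x => F x (f x)) (fun x => F x (g x)).
Proof. by apply: filterS => x h /h ->. Qed.

Lemma aeq_sum a b (r : seq nat) (F G : nat -> R -> R) :
  (forall i, i \in r -> aeq a b (F i) (G i)) ->
  aeq a b (fun x => \sum_(i <- r) F i x) (fun x => \sum_(i <- r) G i x).
Proof.
elim: r => [|i r IH] H.
  by apply: aeq_eq => x _; rewrite !big_nil.
have h1 := H i (mem_head _ _).
have h2 : aeq a b (fun x => \sum_(i <- r) F i x) (fun x => \sum_(i <- r) G i x).
  by apply: IH => j jr; apply: H; rewrite inE jr orbT.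
move: h1 h2; apply: filterS2 => x h1 h2 xi.
by rewrite !big_cons h1// h2.
Qed.

Lemma aeq_sub a b c d f g : a <= c -> d <= b -> aeq a b f g -> aeq c d f g.
Proof.
move=> ac db; apply: ae_eq_subset; apply: subset_itv; rewrite bnd_simp//.
Qed.

Lemma Jae a b f g : measurable_fun `[a, b] f -> measurable_fun `[a, b] g ->
  aeq a b f g -> J a b f = J a b g.
Proof.
move=> mf mg fg; congr fine; apply: ae_eq_integral => //.
- exact/measurable_EFinP.
- exact/measurable_EFinP.
- by move: fg; apply: filterS => x /= h /h ->.
Qed.

Lemma L1ae a b f g : measurable_fun `[a, b] f -> aeq a b f g -> L1 a b g ->
  L1 a b f.
Proof.
move=> mf fg Lg; apply/integrableP; split; first exact/measurable_EFinP.
have /integrableP[mg] := Lg; congr (_ < _)%E; apply: ae_eq_integral => //.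
- exact: measurableT_comp.
- by apply: measurableT_comp => //; exact/measurable_EFinP.
- by move: fg; apply: filterS => x /= h /h ->.
Qed.

Lemma C0_sq a b f : C0 a b f -> sqint a b f.
Proof. by move=> cf; split; [exact: C0_meas|exact/C0_L1/C0X]. Qed.

Lemma sq_meas a b f : sqint a b f -> measurable_fun `[a, b] f.
Proof. by case. Qed.

Lemma sqM_L1 a b f g : sqint a b f -> sqint a b g ->
  L1 a b (fun x => f x * g x).
Proof.
move=> [mf Lf] [mg Lg]; apply: (L1_le _ (L1D Lf Lg)); first exact: measurable_funM.
move=> x _; rewrite ler_norml; apply/andP; split.
  by have := sqr_ge0 (f x + g x); have := sqr_ge0 (f x); have := sqr_ge0 (g x); nra.
by have := sqr_ge0 (f x - g x); have := sqr_ge0 (f x); have := sqr_ge0 (g x); nra.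
Qed.

Lemma sq_L1 a b f : sqint a b f -> L1 a b f.
Proof.
move=> sf; have H := sqM_L1 (C0_sq (@C0_cst a b 1)) sf; apply: L1_eq H => x _.
by rewrite mul1r.
Qed.

Lemma sqZ a b k f : sqint a b f -> sqint a b (fun x => k * f x).
Proof.
move=> [mf Lf]; split; first exact: measurable_funM.
by apply: L1_eq (L1Z (k ^+ 2) Lf) => x _; rewrite exprMn.
Qed.

Lemma sqD a b f g : sqint a b f -> sqint a b g ->
  sqint a b (fun x => f x + g x).
Proof.
move=> sf sg; have L := sqM_L1 sf sg; case: sf => mf Lf; case: sg => mg Lg.
split; first exact: measurable_funD.
apply: L1_eq (L1D (L1D Lf (L1Z 2 L)) Lg) => x _; ring.
Qed.

Lemma sqB a b f g : sqint a b f -> sqint a b g ->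
  sqint a b (fun x => f x - g x).
Proof.
move=> sf sg; have [m L] := sqD sf (sqZ (-1) sg).
have E : (fun x => f x + -1 * g x) = (fun x => f x - g x).
  by apply/funext => x; rewrite mulN1r.
by rewrite -E; split=> //; apply: L1_eq L => x _; rewrite mulN1r.
Qed.

Lemma sq_sum a b (r : seq nat) (F : nat -> R -> R) :
  (forall i, i \in r -> sqint a b (F i)) ->
  sqint a b (fun x => \sum_(i <- r) F i x).
Proof.
elim: r => [|i r IH] H.
  have -> : (fun x => \sum_(i <- [::]) F i x) = (fun=> 0).
    by apply/funext => x; rewrite big_nil.
  exact/C0_sq/C0_cst.
have -> : (fun x => \sum_(i <- i :: r) F i x)
    = (fun x => F i x + \sum_(i <- r) F i x).
  by apply/funext => x; rewrite big_cons.
apply: sqD; first exact: H (mem_head _ _).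
by apply: IH => j jr; apply: H; rewrite inE jr orbT.
Qed.

End IntervalIntegral.

(** * Absolutely continuous functions *)

Section AbsolutelyContinuous.
Context {R : realType}.
Notation mu := (@lebesgue_measure R).
Implicit Types (a b c d k x y z M : R) (f g h u v w : R -> R).

Lemma Jmono a b c d f : a <= c -> c <= d -> d <= b -> L1 a b f ->
  (forall x, a <= x <= b -> 0 <= f x) -> J c d f <= J a b f.
Proof.
move=> ac cd db Lf f0.
rewrite (@Jsplit _ a b c)//; last exact: le_trans db.
rewrite (@Jsplit _ c b d)//; last exact: L1_sub Lf.
have h1 : 0 <= J a c f.
  apply: Jge0 => x /andP[ax xc]; apply: f0; rewrite ax.
  exact: le_trans xc (le_trans cd db).
have h2 : 0 <= J d b f.
  by apply: Jge0 => x /andP[dx xb]; apply: f0; rewrite xb (le_trans (le_trans ac cd)).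
by rewrite addrCA lerDl addr_ge0.
Qed.

(* The increments of [e] are quadratically small in those of the continuous
   function [M]; cutting the range of [M] into [N] equal parts gives
   |e b - e a| <= (M b - M a)^2 / N. *)
Lemma quadratic_increments_cst a b (e M : R -> R) : a <= b -> C0 a b M ->
  (forall x y, a <= x -> x <= y -> y <= b ->
     M x <= M y /\ `|e y - e x| <= (M y - M x) ^+ 2) ->
  e b = e a.
Proof.
move=> ab cM H; set D := M b - M a.
have D0 : 0 <= D by rewrite subr_ge0; have [] := H a b (lexx _) ab (lexx _).
have K (N : nat) : (0 < N)%N -> `|e b - e a| <= D ^+ 2 / N%:R.
  move=> N0; set h := D / N%:R.
  have Np : 0 < N%:R :> R by rewrite ltr0n.
  have h0 : 0 <= h by rewrite divr_ge0// ltW.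
  have hN : N%:R * h = D by rewrite mulrC divfK// gt_eqF.
  have step i : (i <= N)%N -> exists x, [/\ a <= x <= b, M x = M a + i%:R * h
      & `|e x - e a| <= i%:R * h ^+ 2].
    elim: i => [_|i IH iN].
      by exists a; rewrite lexx ab !mul0r addr0 subrr normr0.
    have [x [/andP[ax xb] Mx ex]] := IH (ltnW iN).
    have Mb : M a + i.+1%:R * h <= M b.
      by rewrite -lerBrDl -/D -hN ler_wpM2r// ler_nat.
    have cM' : C0 x b M by apply: C0_sub cM.
    have [|y] := IVT xb cM' (v := M a + i.+1%:R * h).
      have [Mxb _] := H x b ax xb (lexx _).
      rewrite (min_l Mxb) (max_r Mxb) Mb andbT Mx lerD2l ler_wpM2r//.
      by rewrite ler_nat.
    rewrite in_itv /= => /andP[xy yb] My; exists y.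
    rewrite (le_trans ax xy) yb My; split=> //.
    have [_ exy] := H x y ax xy yb.
    have -> : e y - e a = (e y - e x) + (e x - e a) by ring.
    rewrite (le_trans (ler_normD _ _))//.
    have -> : i.+1%:R * h ^+ 2 = h ^+ 2 + i%:R * h ^+ 2.
      by rewrite -natr1 mulrDl mul1r addrC.
    apply: lerD => //; rewrite (le_trans exy)// My Mx -natr1.
    by rewrite (_ : _ - _ = h)//; ring.
  have [x [/andP[ax xb] Mx ex]] := step N (leqnn _).
  (* The last point reached need not be [b], but [M] takes the same value at both, so [e] does
     too. *)
  have exb : e b = e x.
    have [_] := H x b ax xb (lexx _).
    rewrite Mx hN /D addrCA subrr addr0 subrr expr0n /= => h1.
    by apply/eqP; rewrite -subr_eq0 -normr_le0.
  rewrite exb (le_trans ex)// /h expr_div_n expr2 [N%:R ^+ 2]expr2.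
  by rewrite invfM !mulrA mulrC !mulrA mulVf ?mul1r ?gt_eqF.
apply/eqP; rewrite -subr_eq0 -normr_le0 leNgt; apply/negP => e0.
have q0 : 0 <= D ^+ 2 / `|e b - e a| by rewrite divr_ge0// sqr_ge0.
have := K (Num.bound (D ^+ 2 / `|e b - e a|)).+1 isT.
apply/negP; rewrite -ltNge ltr_pdivrMr ?ltr0n//.
rewrite mulrC -ltr_pdivrMr//.
have := archi_boundP q0 => /lt_le_trans; apply.
by rewrite ler_nat.
Qed.

(** Absolute continuity with a chosen density [v]; working with such pairs avoids pointwise
    derivatives. *)
Definition AC a b u v :=
  L1 a b v /\ forall x, a <= x <= b -> u x = u a + J a x v.

Lemma AC_incr a b u v x y : AC a b u v -> a <= x -> x <= y -> y <= b ->
  u y - u x = J x y v.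
Proof.
move=> [Lv uv] ax xy yb.
rewrite (uv y) ?(le_trans ax xy)// (uv x) ?ax ?(le_trans xy yb)//.
rewrite (@Jsplit _ a y x)//; first by ring.
by apply: L1_sub Lv.
Qed.

Lemma AC_le a b u v x y : AC a b u v -> a <= x -> x <= y -> y <= b ->
  `|u y - u x| <= J x y (fun t => `|v t|).
Proof.
move=> uv ax xy yb; rewrite (AC_incr uv)//; apply: Jabs.
by apply: L1_sub (proj1 uv).
Qed.

Lemma J_C0 a b f : a <= b -> L1 a b f -> C0 a b (fun x => J a x f).
Proof. by move=> ab Lf; exact: parameterized_integral_continuous. Qed.

Lemma AC_C0 a b u v : a <= b -> AC a b u v -> C0 a b u.
Proof.
move=> ab [Lv uv]; apply: (@C0_eq _ _ _ (fun x => u a + J a x v)).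
  by move=> x /uv ->.
by apply: C0D; [exact: C0_cst|exact: J_C0].
Qed.

Lemma AC_J a b f k : L1 a b f -> AC a b (fun x => k + J a x f) f.
Proof. by move=> Lf; split=> // x _; rewrite Jaa addr0. Qed.

Lemma AC_eq a b u u' v v' : a <= b -> (forall x, a <= x <= b -> u x = u' x) ->
  measurable_fun `[a, b] v' -> aeq a b v v' -> AC a b u v -> AC a b u' v'.
Proof.
move=> ab uu mv' vv' [Lv uv]; split.
  by apply: L1ae (aeq_sym vv') Lv.
move=> x /andP[ax xb]; rewrite -!uu ?ax ?xb ?lexx ?ab// uv ?ax//; congr (_ + _).
have mS h : measurable_fun `[a, b] h -> measurable_fun `[a, x] h.
  apply: measurable_funS => //; apply: subset_itvl; rewrite bnd_simp//.
apply: Jae.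
- by apply: mS; exact: L1_meas Lv.
- exact: mS.
- exact: aeq_sub vv'.
Qed.

Lemma ACD a b u v u' v' : AC a b u u' -> AC a b v v' ->
  AC a b (fun x => u x + v x) (fun x => u' x + v' x).
Proof.
move=> [Lu uu] [Lv vv]; split; first exact: L1D.
move=> x /andP[ax xb]; rewrite uu ?ax// vv ?ax// JD; first by ring.
- exact: L1_sub Lu.
- exact: L1_sub Lv.
Qed.

Lemma ACZ a b k u u' : AC a b u u' ->
  AC a b (fun x => k * u x) (fun x => k * u' x).
Proof.
move=> [Lu uu]; split; first exact: L1Z.
move=> x /andP[ax xb]; rewrite uu ?ax// JZ; first by ring.
exact: L1_sub Lu.
Qed.

Lemma ACB a b u v u' v' : AC a b u u' -> AC a b v v' ->
  AC a b (fun x => u x - v x) (fun x => u' x - v' x).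
Proof.
move=> [Lu uu] [Lv vv]; split; first exact: L1B.
move=> x /andP[ax xb]; rewrite uu ?ax// vv ?ax// JB; first by ring.
- exact: L1_sub Lu.
- exact: L1_sub Lv.
Qed.

Lemma AC_cst a b k : AC a b (fun=> k) (fun=> 0).
Proof.
split; first exact/C0_L1/C0_cst.
by move=> x /andP[ax _]; rewrite Jcst// mul0r addr0.
Qed.

Lemma AC_id a b : AC a b (fun x => x) (fun=> 1).
Proof.
split; first exact/C0_L1/C0_cst.
by move=> x /andP[ax _]; rewrite Jcst//; ring.
Qed.

(** Leibniz rule without differentiation at points: on [x, y], the increment of the product minus
    the integral of the expected density is the integral of u'(t) (v(y) - v(t)) + v'(t) (u(x) -
    u(t)). It is at most the square of the integral of |u'| + |v'|, so [quadratic_increments_cst]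
    applies. *)
Lemma ACM a b u v u' v' : a <= b -> AC a b u u' -> AC a b v v' ->
  AC a b (fun x => u x * v x) (fun x => u' x * v x + u x * v' x).
Proof.
move=> ab uu vv.
have cu := AC_C0 ab uu; have cv := AC_C0 ab vv.
have [Lu _] := uu; have [Lv _] := vv.
pose G x := u' x * v x + u x * v' x.
have LG : L1 a b G.
  apply: L1D; last exact: L1M_C0.
  by apply: L1_eq (L1M_C0 cv Lu) => x _; rewrite mulrC.
split=> // z /andP[az zb].
pose W x := `|u' x| + `|v' x|.
have LW : L1 a b W by apply: L1D; exact: L1_abs.
have W0 x : 0 <= W x by rewrite addr_ge0.
suff : u z * v z - J a z G = u a * v a - J a a G.
  by rewrite Jaa subr0 => /eqP; rewrite subr_eq => /eqP.
apply: (@quadratic_increments_cst a z (fun x => u x * v x - J a x G)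
  (fun x => J a x W)) => //.
  by apply: (C0_sub (lexx _) zb); exact: J_C0.
move=> x y ax xy yz; have yb := le_trans yz zb.
have Mxy : J a y W - J a x W = J x y W.
  rewrite (@Jsplit _ a y x)//; first by ring.
  exact: L1_sub LW.
have m0 : 0 <= J x y W by apply: Jge0.
split; first by rewrite -subr_ge0 Mxy.
rewrite Mxy; set m := J x y W in m0 *.
have GLs f : L1 a b f -> L1 x y f by apply: L1_sub.
have -> : u y * v y - J a y G - (u x * v x - J a x G)
    = J x y (fun t => u' t * (v y - v t) + v' t * (u x - u t)).
  rewrite (@Jsplit _ a y x)//; last exact: L1_sub LG.
  have E1 : u y * v y - u x * v x = J x y (fun t => v y * u' t + u x * v' t).
    rewrite JD; [|exact/L1Z/GLs|exact/L1Z/GLs].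
    rewrite !JZ; [|exact/GLs|exact/GLs].
    rewrite -(AC_incr uu ax xy yb) -(AC_incr vv ax xy yb); ring.
  transitivity (J x y (fun t => v y * u' t + u x * v' t) - J x y G).
    by rewrite -E1; ring.
  rewrite -JB; [|by apply: L1D; exact/L1Z/GLs|exact: GLs].
  by apply: Jeq => t _; rewrite /G; ring.
have LH : L1 x y (fun t => u' t * (v y - v t) + v' t * (u x - u t)).
  apply: L1D.
    apply: (@L1_eq _ _ _ (fun t => (v y - v t) * u' t)).
      by move=> t _; rewrite mulrC.
    apply: L1M_C0; last exact: GLs.
    by apply: C0B; [exact: C0_cst|exact: C0_sub cv].
  apply: (@L1_eq _ _ _ (fun t => (u x - u t) * v' t)).
    by move=> t _; rewrite mulrC.
  apply: L1M_C0; last exact: GLs.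
  by apply: C0B; [exact: C0_cst|exact: C0_sub cu].
rewrite (le_trans (Jabs LH))// expr2 {1}/m -JZ; last exact: GLs.
apply: Jle; [exact: L1_abs|exact/L1Z/GLs|].
move=> t /andP[xt ty].
rewrite (le_trans (ler_normD _ _))// !normrM /W mulrDr ![m * _]mulrC.
apply: lerD; apply: ler_wpM2l => //.
  apply: (le_trans (AC_le vv (le_trans ax xt) ty yb)).
  apply: (@le_trans _ _ (J t y W)).
    apply: Jle; [|apply: L1_sub LW|by move=> s _; rewrite lerDr] => //.
      by apply/L1_abs; apply: L1_sub Lv => //; exact: le_trans xt.
    exact: le_trans xt.
  by apply: Jmono => //; exact: GLs.
rewrite distrC; apply: (le_trans (AC_le uu ax xt (le_trans ty yb))).
apply: (@le_trans _ _ (J x t W)).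
  apply: Jle; [|apply: L1_sub LW|by move=> s _; rewrite lerDl] => //.
    by apply/L1_abs; apply: L1_sub Lu => //; exact: le_trans yb.
  exact: le_trans yb.
by apply: Jmono => //; exact: GLs.
Qed.

Lemma AC_total a b u v : a <= b -> AC a b u v -> J a b v = u b - u a.
Proof. by move=> ab uv; rewrite (AC_incr uv). Qed.

End AbsolutelyContinuous.

(** * Weak derivatives *)

Section DuBoisReymond.
Context {R : realType}.
Notation mu := (@lebesgue_measure R).
Implicit Types (a b c d k p q x y z M L : R) (f g h u v w phi psi : R -> R).

Lemma ae_neq c : {ae mu, forall x, x <> c}.
Proof.
exists [set c]; split; first exact: measurable_set1.
  exact: lebesgue_measure_set1.
by move=> x /= /contrapT.
Qed.

Lemma aeq_interior a b f g :
  {ae mu, forall x, a < x < b -> f x = g x} -> aeq a b f g.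
Proof.
move=> fg; have ha := ae_neq a; have hb := ae_neq b.
have FF := ae_filter_ringOfSetsType mu.
move: fg ha hb; apply: filterS3 => x fg xa xb /=.
rewrite in_itv /= => /andP[ax bx]; apply: fg.
rewrite !lt_neqAle ax bx !andbT; apply/andP; split; apply/eqP => //.
by move=> E; apply: xa.
Qed.

Lemma aeqP L f g : ae_eq_on L f g <-> aeq 0 L f g.
Proof.
split; last first.
  by apply: ae_eq_subset; apply: subset_itv; rewrite bnd_simp.
move=> fg; apply: aeq_interior; move: fg; apply: filterS => x fg x0.
by apply: fg; rewrite /= in_itv.
Qed.

Lemma derive1_near_cst f k x : (\forall y \near x, f y = k) ->
  f^`()%classic x = 0.
Proof.
move=> fk; rewrite derive1E (@near_eq_derive _ _ _ f (cst k))//.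
exact: derive_cst.
Qed.

Lemma near_J0 a b f x : (forall y, a <= y <= b -> J a y f = 0) -> a < x < b ->
  \forall y \near x, J a y f = 0.
Proof.
move=> H xab; have : x \in `]a, b[ by rewrite in_itv.
move=> /near_in_itvoo; apply: filterS => y; rewrite in_itv /= => /andP[ay yb].
by apply: H; rewrite !ltW.
Qed.

(** By Lebesgue differentiation, [w] is almost everywhere the derivative of its primitive, which
    vanishes. It is first extended by zero, since it is only known to be integrable on [a, b]. *)
Lemma J0_ae a b w : L1 a b w -> (forall x, a <= x <= b -> J a x w = 0) ->
  aeq a b w (fun=> 0).
Proof.
move=> Lw H; pose f := w \_ `[a, b].
have If : mu.-integrable setT (EFin \o f).
  rewrite /f -restrict_EFin.
  by have [+ _] := integrable_mkcond (mu := mu) (EFin \o w) (measurable_itv `[a, b]);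
     apply.
have := @FTC1 R f (BLeft a) _ (@integrable_locally R w _ (measurable_itv _) Lw).
move=> /(_ _)/wrap[y|].
  exact: integrableS If.
have FF := ae_filter_ringOfSetsType mu.
move=> F; apply: aeq_interior; move: F; apply: filterS => x F /andP[ax xb].
have [_] := F ltac:(by rewrite lte_fin).
have fE z : a <= z <= b -> f z = w z.
  by move=> zab; rewrite /f patchE mem_set//= in_itv.
rewrite fE ?ltW// => <-.
apply: (@derive1_near_cst _ 0).
have H' y : a <= y <= b -> J a y f = 0.
  move=> /andP[ay yb]; rewrite -(H y) ?ay//; apply: Jeq => z /andP[az zy].
  by apply: fE; rewrite az (le_trans zy).
by have := near_J0 H' (introT andP (conj ax xb)).
Qed.

Lemma C0_ends a b f k : a < b -> C0 a b f ->
  (forall x, a < x < b -> f x = k) -> forall x, a <= x <= b -> f x = k.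
Proof.
move=> ab cf fk.
pose m := (a + b) / 2.
have am : a < m by rewrite /m; lra.
have mb : m < b by rewrite /m; lra.
have fm : f m = k by apply: fk; rewrite am.
have mid (u v : R) : Num.min u v <= (u + v) / 2 <= Num.max u v.
  by case: (leP u v) => uv; lra.
(* In place of a limit at the endpoint: the value halfway between [f a] and [k] is taken somewhere
   in [a, m], either at [a] or at an interior point, and both cases force [f a = k]. *)
have fa : f a = k.
  have [|c] := IVT (ltW am) (C0_sub (lexx _) (ltW mb) cf) (v := (f a + f m) / 2).
    exact: mid.
  rewrite in_itv /= le_eqVlt => /andP[/orP[/eqP<-|ac] cm]; rewrite fm.
    by move=> E; lra.
  by rewrite fk ?ac ?(le_lt_trans cm)// => E; lra.
have fb : f b = k.
  have [|c] := IVT (ltW mb) (C0_sub (ltW am) (lexx _) cf) (v := (f m + f b) / 2).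
    exact: mid.
  rewrite in_itv /= => /andP[mc]; rewrite le_eqVlt => /orP[/eqP->|cb]; rewrite fm.
    by move=> E; lra.
  by rewrite fk ?cb ?(lt_le_trans am)// => E; lra.
move=> x /andP[]; rewrite le_eqVlt => /orP[/eqP<-//|ax].
by rewrite le_eqVlt => /orP[/eqP->//|xb]; apply: fk; rewrite ax.
Qed.

Lemma C0_ae_eq a b f g : a < b -> C0 a b f -> C0 a b g -> aeq a b f g ->
  forall x, a <= x <= b -> f x = g x.
Proof.
move=> ab cf cg fg x xab.
apply/eqP; rewrite -subr_eq0; apply/eqP; move: x xab.
have cd := C0B cf cg; have Ld := C0_L1 cd.
apply: (C0_ends ab cd) => x /andP[ax xb].
have H y : a <= y <= b -> J a y (fun x => f x - g x) = 0.
  move=> /andP[ay yb]; rewrite -[RHS](mul0r (y - a)) -(Jcst 0)//.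
  apply: Jae.
  - by apply: (@L1_meas _ a y); apply: L1_sub Ld.
  - exact: measurable_cst.
  - have := aeq_sub (lexx a) yb fg; apply: filterS => z h zi.
    by rewrite h// subrr.
have [] := @continuous_FTC1_closed R (fun x => f x - g x) a x b xb Ld ax.
  apply: (@within_continuous_continuous _ _ _ a b) => //.
  by rewrite in_itv /= ax.
move=> _ <-; apply: (@derive1_near_cst _ 0).
by have := near_J0 H (introT andP (conj ax xb)).
Qed.

Lemma Joo L f : L1 0 L f -> \int[mu]_(x in `]0, L[) f x = J 0 L f.
Proof.
move=> Lf; rewrite /J Rintegral_itv_bndo_bndc.
  rewrite Rintegral_itv_obnd_cbnd//.
  by apply: integrableS Lf => //; apply: subset_itvr; rewrite bnd_simp.
by apply: integrableS Lf => //; apply: subset_itv; rewrite bnd_simp.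
Qed.

Lemma test_C1 L phi : test_function L phi ->
  continuous phi /\ forall x, ~ (0 < x < L) -> phi x = 0.
Proof.
move=> [dphi _ [p [q [p0 qL H]]]].
have Z x : ~ (0 < x < L) -> phi x = 0.
  move=> xL; apply: H => /andP[px xq]; apply: xL.
  by rewrite (lt_le_trans p0 px) (le_lt_trans xq qL).
split=> //.
by move=> x; apply: differentiable_continuous; apply/derivable1_diffP.
Qed.

Lemma AC_C1 L f : (forall x, derivable f x 1) -> continuous f^`()%classic ->
  AC 0 L f f^`()%classic.
Proof.
move=> df cf'.
have cf : continuous f.
  by move=> x; apply: differentiable_continuous; exact/derivable1_diffP.
have C' x : C0 0 x f^`()%classic by exact: continuous_subspaceT.
split; first exact/C0_L1/C'.
move=> x /andP[]; rewrite le_eqVlt => /orP[/eqP<- _|x0 xL].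
  by rewrite Jaa addr0.
have := @continuous_FTC2 R f^`()%classic f 0 x x0 (C' x).
rewrite /J /Rintegral => ->//=.
  by rewrite addrCA subrr addr0.
split; first by move=> z _; exact: df.
  exact/cvg_at_right_filter/cf.
exact/cvg_at_left_filter/cf.
Qed.

Lemma AC_test L phi : test_function L phi -> AC 0 L phi phi^`()%classic.
Proof. by move=> [dphi cphi' _]; exact: AC_C1. Qed.

Lemma AC_weak L u v : 0 < L -> AC 0 L u v -> weak_derivative L u v.
Proof.
move=> L0 uv phi tphi.
have [cphi Z] := test_C1 tphi.
have aphi := AC_test tphi.
have [Lv _] := uv.
have L1a : L1 0 L (fun x => u x * phi^`()%classic x).
  by apply: L1M_C0 (AC_C0 (ltW L0) uv) (proj1 aphi).
have L1b : L1 0 L (fun x => v x * phi x).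
  apply: L1_eq (L1M_C0 (AC_C0 (ltW L0) aphi) Lv) => x _; exact: mulrC.
rewrite Joo// Joo//.
have := AC_total (ltW L0) (ACM (ltW L0) uv aphi).
rewrite (Z 0) ?(Z L); [|by rewrite ltxx andbF|by rewrite ltxx].
rewrite !mulr0 subr0 JD// => /eqP.
by rewrite addrC addr_eq0 => /eqP.
Qed.

Lemma supported_patch psi p q (D : set R) : `[p, q] `<=` D ->
  (forall x, ~ (p <= x <= q) -> psi x = 0) -> psi \_ D = psi.
Proof.
move=> pqD H; apply/funext => x; rewrite patchE; case: ifPn => //.
move=> xD; rewrite H// => xpq; move/negP: xD; apply; apply: mem_set.
by apply: pqD; rewrite /= in_itv.
Qed.

(** The zero mean makes the primitive vanish to the right of the support as well. Integrating from
    minus infinity makes the fundamental theorem available at every real point. *)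
Lemma test_of_cont L p q psi : 0 < p -> q < L -> continuous psi ->
  (forall x, ~ (p <= x <= q) -> psi x = 0) -> J 0 L psi = 0 ->
  exists2 phi, test_function L phi & phi^`()%classic = psi.
Proof.
move=> p0 qL cpsi Z J0.
have Ipsi : mu.-integrable setT (EFin \o psi).
  have [+ _] := integrable_mkcond (mu := mu) (EFin \o psi) (measurable_itv `[p, q]).
  rewrite restrict_EFin (@supported_patch psi p q)//; apply.
  by apply: (@C0_L1 _ p q psi); exact: continuous_subspaceT.
pose phi x := \int[mu]_(t in `]-oo, x]) psi t.
have D x : derivable phi x 1 /\ phi^`()%classic x = psi x.
  apply: (@continuous_FTC1 R psi (BInfty _ true) x (x + 1)).
  - by rewrite ltrDl.
  - exact: integrableS Ipsi.
  - exact: ltNyr.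
  - exact: cpsi.
have E : phi^`()%classic = psi by apply/funext => x; have [] := D x.
exists phi => //; split; [by move=> x; have [] := D x|by rewrite E|].
exists p, q; split=> // x xpq.
case: (ltP x p) => xp.
  rewrite /phi -[RHS](@Rintegral_set0 _ _ R mu psi).
  rewrite Rintegral_mkcond [RHS]Rintegral_mkcond; congr (Rintegral _ _ _).
  apply/funext => t; rewrite !patchE in_set0; case: ifPn => //.
  rewrite inE /= in_itv /= => tx; apply: Z => /andP[pt _].
  by move: (le_lt_trans (le_trans pt tx) xp); rewrite ltxx.
have qx : q < x.
  by rewrite ltNge; apply/negP => xq; apply: xpq; rewrite xp.
rewrite -J0 /phi /J Rintegral_mkcond [RHS]Rintegral_mkcond.
rewrite !(@supported_patch psi p q)//.
  by move=> t /=; rewrite !in_itv /= => /andP[pt tq]; rewrite (le_trans (ltW p0) pt) (le_trans tq (ltW qL)).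
by move=> t /=; rewrite !in_itv /= => /andP[pt tq]; rewrite (le_trans tq (ltW qx)).
Qed.

(* Increases to the indicator function of ]p, q[ as [n] grows. *)
Definition plateau p q (n : nat) x : R :=
  Num.max 0 (Num.min 1 (n%:R * ((x - p) * (q - x)))).

Lemma plateau_cont p q n : continuous (plateau p q n).
Proof.
move=> x; rewrite /plateau.
apply: (@continuous_max _ _ (cst 0)
  (fun x => Num.min 1 (n%:R * ((x - p) * (q - x))))).
  exact: cst_continuous.
apply: (@continuous_min _ _ (cst 1) (fun x => n%:R * ((x - p) * (q - x)))).
  exact: cst_continuous.
apply: (@continuousM _ R); first exact: cst_continuous.
apply: (@continuousM _ R).
  apply: (@continuousB _ R^o R id (cst p)); first exact: cvg_id.
  exact: cst_continuous.
apply: (@continuousB _ R^o R (cst q) id); first exact: cst_continuous.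
exact: cvg_id.
Qed.

Lemma plateau01 p q n x : 0 <= plateau p q n x <= 1.
Proof.
rewrite /plateau; set t := n%:R * _; rewrite le_max lexx /= ge_max ler01 /=.
by rewrite ge_min lexx.
Qed.

Lemma plateau0 p q n x : p <= q -> ~ (p <= x <= q) -> plateau p q n x = 0.
Proof.
move=> pq xpq; apply/max_idPl; rewrite ge_min; apply/orP; right.
apply: mulr_ge0_le0 => //.
case: (leP p x) => px.
  case: (leP x q) => xq; first by exfalso; apply: xpq; rewrite px.
  by apply: mulr_ge0_le0; lra.
by apply: mulr_le0_ge0; lra.
Qed.

Lemma plateau_cvg p q x : p < x < q -> plateau p q n x @[n --> \oo] --> (1 : R).
Proof.
move=> /andP[px xq]; apply: cvg_near_cst.
have t0 : 0 < (x - p) * (q - x) by apply: mulr_gt0; lra.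
have := nbhs_infty_ger ((x - p) * (q - x))^-1.
apply: filterS => n /= h; rewrite /plateau.
have -> : Num.min 1 (n%:R * ((x - p) * (q - x))) = 1.
  apply/min_idPl; rewrite -{1}(mulVf (lt0r_neq0 t0)).
  by rewrite ler_wpM2r// ltW.
by apply/max_idPr.
Qed.

Lemma plateau_lim L p q w : 0 <= p -> p < q -> q <= L -> L1 0 L w ->
  J 0 L (fun x => w x * plateau p q n x) @[n --> \oo] --> J p q w.
Proof.
move=> p0 pq qL Lw.
have Lpq : L1 p q w by apply: L1_sub Lw.
have LW n c d : 0 <= c -> d <= L -> L1 c d (fun x => w x * plateau p q n x).
  move=> c0 dL.
  apply: (@L1_eq _ _ _ (fun x => plateau p q n x * w x)).
    by move=> x _; exact: mulrC.
  apply: L1M_C0; last by apply: L1_sub Lw.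
  by apply: continuous_subspaceT; exact: plateau_cont.
have J0 c d f : c <= d -> (forall x, c <= x <= d -> f x = 0) -> J c d f = 0.
  by move=> cd f0; rewrite (Jeq f0) Jcst// mul0r.
have pl0 c d n x : (d <= p) || (q <= c) -> c <= x <= d -> plateau p q n x = 0.
  move=> H /andP[cx xd].
  have [E|E] : x <= p \/ q <= x.
    by case/orP: H => h; [left; exact: le_trans h|right; exact: le_trans cx].
    apply/max_idPl; rewrite ge_min; apply/orP; right; apply: mulr_ge0_le0 => //.
    by apply: mulr_le0_ge0; lra.
  apply/max_idPl; rewrite ge_min; apply/orP; right; apply: mulr_ge0_le0 => //.
  by apply: mulr_ge0_le0; lra.
have E n : J 0 L (fun x => w x * plateau p q n x) =
    J p q (fun x => w x * plateau p q n x).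
  rewrite (@Jsplit _ 0 L p)//; [|lra|exact: LW].
  rewrite (J0 0 p)//; last first.
    by move=> x xp; rewrite (pl0 0 p) ?lexx ?mulr0.
  rewrite (@Jsplit _ p L q)//; [|lra|exact: LW].
  rewrite [X in _ + (_ + X)](J0 q L)// ?add0r ?addr0//.
  by move=> x xp; rewrite (pl0 q L) ?lexx ?orbT ?mulr0.
under eq_fun do rewrite E.
have pn0 := ae_neq p; have qn0 := ae_neq q.
have [|||_ _ H] := @dominated_convergence _ _ R mu `[p, q] (measurable_itv _)
  (fun n x => (w x * plateau p q n x)%:E) (EFin \o w) (fun x => (`|w x|)%:E)
  (fun n => measurable_int _ (LW n p q p0 qL)) (measurable_int _ Lpq).
- have FF := ae_filter_ringOfSetsType mu.
  move: pn0 qn0; apply: filterS2 => x xp xq /=; rewrite in_itv /= => /andP[px qx].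
  apply: cvg_EFin; first by near=> n.
  rewrite -[X in _ --> X](mulr1 (w x)).
  apply: cvgM; first exact: cvg_cst.
  apply: plateau_cvg; rewrite !lt_neqAle px qx !andbT.
  by apply/andP; split; apply/eqP => // h; apply: xp.
- exact: L1_abs.
- apply: aeW => x n _ /=; rewrite lee_fin normrM.
  have /andP[h0 h1] := plateau01 p q n x.
  by rewrite (ger0_norm h0) ler_piMr.
apply: fine_cvg.
have /integrable_fin_num : mu.-integrable `[p, q] (EFin \o w) by [].
by move=> /(_ (measurable_itv _)) h; rewrite /J /Rintegral fineK.
Unshelve. all: by end_near. Qed.

(** Testing with primitives of zero-mean combinations of two plateaux and passing to the limit shows
    that [w] has the same mean [c] on all intervals inside ]0, L[. Hence the primitive of [w - c]
    vanishes, and so does [w - c] almost everywhere. *)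
Lemma du_Bois_Reymond L w : 0 < L -> L1 0 L w ->
  (forall phi, test_function L phi ->
     J 0 L (fun x => w x * phi^`()%classic x) = 0) ->
  exists c, aeq 0 L w (fun=> c).
Proof.
move=> L0 Lw H.
have Lc k : L1 0 L (fun=> k) by exact/C0_L1/C0_cst.
have key p q p' q' : 0 < p -> p < q -> q < L -> 0 < p' -> p' < q' -> q' < L ->
    (q' - p') * J p q w = (q - p) * J p' q' w.
  move=> p0 pq qL p0' pq' qL'.
  have LW n r s : L1 0 L (fun x => w x * plateau r s n x).
    apply: (@L1_eq _ _ _ (fun x => plateau r s n x * w x)).
      by move=> x _; exact: mulrC.
    apply: L1M_C0 => //; apply: continuous_subspaceT; exact: plateau_cont.
  have LP n r s : L1 0 L (plateau r s n).
    by apply: C0_L1; apply: continuous_subspaceT; exact: plateau_cont.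
  have En n : J 0 L (fun x => 1 * plateau p' q' n x) *
        J 0 L (fun x => w x * plateau p q n x)
      = J 0 L (fun x => 1 * plateau p q n x) *
        J 0 L (fun x => w x * plateau p' q' n x).
    rewrite !JZ// !mul1r.
    set I2 := J 0 L (plateau p' q' n); set I1 := J 0 L (plateau p q n).
    (* Each plateau is weighted by the integral of the other one, so that the mean is zero. *)
    pose psi x := I2 * plateau p q n x - I1 * plateau p' q' n x.
    have [|||||phi tphi E] := @test_of_cont L (Num.min p p') (Num.max q q') psi.
    - by rewrite lt_min p0.
    - by rewrite gt_max qL.
    - move=> x; rewrite /psi.
      apply: (@continuousB _ R^o R (fun x => I2 * plateau p q n x)
        (fun x => I1 * plateau p' q' n x)).
        apply: (@continuousM _ R (cst I2)); first exact: cst_continuous.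
        exact: plateau_cont.
      apply: (@continuousM _ R (cst I1)); first exact: cst_continuous.
      exact: plateau_cont.
    - move=> x xm; rewrite /psi (plateau0 n (ltW pq)).
        rewrite (plateau0 n (ltW pq')) ?mulr0 ?subrr// => /andP[h1 h2].
        by apply: xm; rewrite ge_min le_max h1 h2 !orbT.
      by move=> /andP[h1 h2]; apply: xm; rewrite ge_min le_max h1 h2.
    - rewrite /psi JB ?JZ//; [|exact: L1Z|exact: L1Z].
      by rewrite -/I1 -/I2; ring.
    have := H _ tphi; rewrite E.
    rewrite (_ : J 0 L _ = I2 * J 0 L (fun x => w x * plateau p q n x)
       - I1 * J 0 L (fun x => w x * plateau p' q' n x)).
      by move=> /eqP; rewrite subr_eq0 => /eqP.
    rewrite -!JZ// -JB; [|exact: L1Z|exact: L1Z].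
    by apply: Jeq => x _; rewrite /psi; ring.
  have c1 := cvgM (plateau_lim (ltW p0') pq' (ltW qL') (Lc 1))
                  (plateau_lim (ltW p0) pq (ltW qL) Lw).
  have c2 := cvgM (plateau_lim (ltW p0) pq (ltW qL) (Lc 1))
                  (plateau_lim (ltW p0') pq' (ltW qL') Lw).
  rewrite !Jcst ?ltW// !mul1r in c1 c2.
  have {}c1 := c1 ltac:(typeclasses eauto).
  have {}c2 := c2 ltac:(typeclasses eauto).
  apply: (@cvg_unique _ (@Rhausdorff R) _ _ _ _ c1 _).
  suff -> : (fun n : nat => J 0 L (fun x => 1 * plateau p' q' n x)) \*
     (fun n : nat => J 0 L (fun x => w x * plateau p q n x)) =
     (fun n : nat => J 0 L (fun x => 1 * plateau p q n x)) \*
     (fun n : nat => J 0 L (fun x => w x * plateau p' q' n x)) by [].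
  by apply/funext => n; exact: En.
pose c := J (L / 3) (2 * L / 3) w / (L / 3).
have lin p q : 0 < p -> p < q -> q < L -> J p q w = c * (q - p).
  move=> p0 pq qL; have := key p q (L / 3) (2 * L / 3) p0 pq qL.
  move=> /(_ _ _ _)/wrap[]; [lra|lra|lra|] => E.
  have L3 : L / 3 != 0 by rewrite gt_eqF//; lra.
  apply: (mulfI L3); rewrite /c.
  rewrite [RHS](_ : _ = (q - p) * J (L / 3) (2 * L / 3) w); last by field; lra.
  by rewrite -E; congr (_ * _); field.
exists c.
pose d x := J 0 x w - c * x.
have cd : C0 0 L d.
  by apply: C0B; [exact/J_C0/Lw/ltW|apply: C0Z; exact: C0_id].
have dk : forall x, 0 < x < L -> d x = d (L / 2).
  suff W p q : 0 < p -> p < q -> q < L -> d p = d q.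
    move=> x /andP[x0 xL]; case: (ltgtP x (L / 2)) => [h|h|->//].
      by apply: W => //; lra.
    by apply/esym; apply: W => //; lra.
  move=> p0 pq qL; apply/eqP; rewrite -subr_eq0 /d.
  have Lq : L1 0 q w by apply: L1_sub Lw => //; exact: ltW.
  by rewrite (Jsplit (ltW p0) (ltW pq) Lq) (lin _ _ p0 pq qL); apply/eqP; ring.
have dc := C0_ends L0 cd dk.
have d0 x : 0 <= x <= L -> d x = 0.
  move=> xL; rewrite dc// -(dc 0) ?lexx ?ltW//.
  by rewrite /d Jaa mulr0 subr0.
have : aeq 0 L (fun x => w x - c) (fun=> 0).
  apply: J0_ae; first exact: L1B.
  move=> x xL; rewrite -[RHS](d0 _ xL) JB; last 2 first.
  - by apply: L1_sub Lw => //; case/andP: xL.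
  - exact/C0_L1/C0_cst.
  by rewrite /d Jcst ?subr0//; case/andP: xL.
by apply: filterS => x h xi; apply/eqP; rewrite -subr_eq0 h.
Qed.

End DuBoisReymond.

(** * Sobolev functions as chains of primitives *)

Section SobolevChains.
Context {R : realType}.
Notation mu := (@lebesgue_measure R).
Implicit Types (L a c x y z : R) (l k n : nat) (f g h u v phi : R -> R)
  (w : nat -> R -> R).

Lemma ae_and (P Q : R -> Prop) : {ae mu, forall x, P x} ->
  {ae mu, forall x, Q x} -> {ae mu, forall x, P x /\ Q x}.
Proof.
by have FF := ae_filter_ringOfSetsType mu; apply: filterS2 => x.
Qed.

Lemma inL2P L f : inL2 L f <-> sqint 0 L f.
Proof.
split=> -[mf If].
  have mf' : measurable_fun `[0, L] f by exact: measurable_fun_itv_cc mf.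
  split=> //; apply/integrableP; split.
    by apply/measurable_EFinP; exact: measurable_funX.
  have /integrableP[_] := If.
  rewrite integral_itv_bndo_bndc; last first.
    apply: measurableT_comp => //; apply/measurable_EFinP.
    apply: measurable_funX; apply: measurable_funS mf' => //.
    by apply: subset_itv; rewrite bnd_simp.
  rewrite integral_itv_obnd_cbnd//.
  apply: measurableT_comp => //; apply/measurable_EFinP.
  apply: measurable_funX; apply: measurable_funS mf' => //.
  by apply: subset_itv; rewrite bnd_simp.
split.
  by apply: measurable_funS mf => //; apply: subset_itv; rewrite bnd_simp.
by apply: integrableS If => //; apply: subset_itv; rewrite bnd_simp.
Qed.

Lemma L2norm_sq L f : sqint 0 L f ->
  L2norm L f ^+ 2 = J 0 L (fun x => f x ^+ 2).
Proof.
move=> [mf If]; rewrite /L2norm Joo// sqr_sqrtr//.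
by apply: Jge0 => x _; exact: sqr_ge0.
Qed.

Lemma weighted_L1 L f : sqint 0 L f -> L1 0 L (fun x => (1 + x) * f x ^+ 2).
Proof.
move=> [_ If]; apply: L1M_C0 If; apply: C0D; [exact: C0_cst|exact: C0_id].
Qed.

Lemma weighted_sqE L f : sqint 0 L f ->
  weighted_sq L f = J 0 L (fun x => (1 + x) * f x ^+ 2).
Proof. by move=> sf; rewrite /weighted_sq Joo//; exact: weighted_L1. Qed.

Lemma test_C0 L phi : test_function L phi ->
  C0 0 L phi /\ C0 0 L phi^`()%classic.
Proof.
move=> tphi; have [cphi _] := test_C1 tphi; have [_ cphi' _] := tphi.
by split; exact: continuous_subspaceT.
Qed.

Lemma weakP L u v : sqint 0 L u -> sqint 0 L v ->
  weak_derivative L u v <->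
  (forall phi, test_function L phi ->
   J 0 L (fun x => u x * phi^`()%classic x) = - J 0 L (fun x => v x * phi x)).
Proof.
move=> su sv; split=> H phi tphi; have [c0 c1] := test_C0 tphi.
  have := H phi tphi; rewrite !Joo//; exact: sqM_L1 (C0_sq _).
rewrite !Joo//; [exact: H|exact: sqM_L1 (C0_sq _)|exact: sqM_L1 (C0_sq _)].
Qed.

Lemma weak_aeq L u v u' v' : sqint 0 L u -> sqint 0 L v -> sqint 0 L u' ->
  sqint 0 L v' -> aeq 0 L u u' -> aeq 0 L v v' ->
  weak_derivative L u v -> weak_derivative L u' v'.
Proof.
move=> su sv su' sv' uu vv /(weakP su sv) H; apply/(weakP su' sv') => phi tphi.
have [c0 c1] := test_C0 tphi.
have m0 := C0_meas c0; have m1 := C0_meas c1.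
rewrite (@Jae _ 0 L _ (fun x => u x * phi^`()%classic x)).
- rewrite H// (@Jae _ 0 L _ (fun x => v' x * phi x))//.
  + by apply: measurable_funM => //; exact: sq_meas.
  + by apply: measurable_funM => //; exact: sq_meas.
  + exact: (aeq_map (fun x y => y * phi x) vv).
- by apply: measurable_funM => //; exact: sq_meas.
- by apply: measurable_funM => //; exact: sq_meas.
- exact: (aeq_map (fun x y => y * phi^`()%classic x) (aeq_sym uu)).
Qed.

Lemma AC_primitive L f : L1 0 L f -> AC 0 L (fun x => J 0 x f) f.
Proof. by move=> Lf; split=> // x _; rewrite Jaa add0r. Qed.

(** [u] and the primitive [V] of [v] have the same weak derivative, so they differ by a constant. *)
Lemma weak_AC L u v : 0 < L -> sqint 0 L u -> sqint 0 L v ->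
  weak_derivative L u v -> exists2 w0, AC 0 L w0 v & aeq 0 L u w0.
Proof.
move=> L0 su sv /(weakP su sv) H.
pose V x := J 0 x v.
have aV : AC 0 L V v by exact/AC_primitive/sq_L1.
have cV := AC_C0 (ltW L0) aV.
have sV := C0_sq cV.
have HV := (weakP sV sv).1 (AC_weak L0 aV).
have [|phi tphi|c E] := @du_Bois_Reymond _ L (fun x => u x - V x) L0.
- exact/sq_L1/sqB.
- have [c0 c1] := test_C0 tphi.
  transitivity (J 0 L (fun x => u x * phi^`()%classic x) -
                J 0 L (fun x => V x * phi^`()%classic x)).
    rewrite -JB; [|exact: sqM_L1 (C0_sq _)|exact: sqM_L1 (C0_sq _)].
    by apply: Jeq => x _; ring.
  by rewrite H// HV// subrr.
exists (fun x => c + V x); first exact/AC_J/sq_L1.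
by move: E; apply: filterS => x h xi; rewrite -(h xi) subrK.
Qed.

(** The primitive [Z] of [v - v'] has zero weak derivative, so it is constant; it vanishes at 0,
    hence everywhere, and its density vanishes almost everywhere. *)
Lemma weak_unique L u v v' : 0 < L -> sqint 0 L u -> sqint 0 L v ->
  sqint 0 L v' -> weak_derivative L u v -> weak_derivative L u v' ->
  aeq 0 L v v'.
Proof.
move=> L0 su sv sv' /(weakP su sv) H /(weakP su sv') H'.
pose z x := v x - v' x.
have sz : sqint 0 L z by exact: sqB.
pose Z x := J 0 x z.
have aZ : AC 0 L Z z by exact/AC_primitive/sq_L1.
have cZ := AC_C0 (ltW L0) aZ.
have HZ := (weakP (C0_sq cZ) sz).1 (AC_weak L0 aZ).
have [|phi tphi|c E] := @du_Bois_Reymond _ L Z L0.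
- exact: C0_L1.
- have [c0 c1] := test_C0 tphi.
  rewrite HZ// (_ : J 0 L _ = J 0 L (fun x => v x * phi x) -
                J 0 L (fun x => v' x * phi x)).
    by rewrite opprB -[X in X - _]opprK -H'// H// opprK subrr.
  rewrite -JB; [|exact: sqM_L1 (C0_sq _)|exact: sqM_L1 (C0_sq _)].
  by apply: Jeq => x _; rewrite /z; ring.
have Zc := C0_ae_eq L0 cZ (@C0_cst _ 0 L c) E.
have : aeq 0 L z (fun=> 0).
  apply: J0_ae; first exact: sq_L1.
  move=> x xL; rewrite -/(Z x) Zc// -(Zc 0) ?lexx ?ltW//.
  by rewrite /Z Jaa.
by apply: filterS => x h xi; apply/eqP; rewrite -subr_eq0 -/(z x) h.
Qed.

Lemma inH_L2 L n u : inH L n u -> sqint 0 L u.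
Proof. by case: n => [|n] /=; [move=> /inL2P|move=> [/inL2P]]. Qed.

Lemma inH_aeq L n u u' : sqint 0 L u' -> aeq 0 L u u' -> inH L n u ->
  inH L n u'.
Proof.
move=> su' uu; case: n => [|n] /=; first by move=> _; exact/inL2P.
move=> [/inL2P su [v [uv vn]]]; split; first exact/inL2P.
exists v; split=> //.
have sv := inH_L2 vn.
by apply: weak_aeq uv => //; exact: aeq_refl.
Qed.

Lemma wD_weak L u v : sqint 0 L v -> weak_derivative L u v ->
  sqint 0 L (wD L u) /\ weak_derivative L u (wD L u).
Proof.
move=> sv uv.
have := @xgetPex _ (fun=> 0) [set v | inL2 L v /\ weak_derivative L u v].
move=> /(_ _)/wrap[|[/inL2P s1 w1]]; last by split.
by exists v; split=> //; exact/inL2P.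
Qed.

Lemma wD_aeq L u v : 0 < L -> sqint 0 L u -> sqint 0 L v ->
  weak_derivative L u v -> aeq 0 L (wD L u) v.
Proof.
move=> L0 su sv uv; have [s1 w1] := wD_weak sv uv.
exact: weak_unique w1 uv.
Qed.

Lemma inH_wD L n u : 0 < L -> inH L n.+1 u ->
  weak_derivative L u (wD L u) /\ inH L n (wD L u).
Proof.
move=> L0 /= [/inL2P su [v [uv vn]]].
have sv := inH_L2 vn; have [s1 w1] := wD_weak sv uv.
by split=> //; apply: inH_aeq vn => //; exact/aeq_sym/wD_aeq.
Qed.

Lemma inH_wDn L n i u : 0 < L -> (i <= n)%N -> inH L n u ->
  inH L (n - i) (wDn L i u).
Proof.
move=> L0 + un; elim: i => [|i IH] iN; first by rewrite subn0.
have := IH (ltnW iN).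
by rewrite -subSS subSn// => /(inH_wD L0)[].
Qed.

(* For i < n, [w i] is the continuous representative of the i-th derivative of
   [w 0]; the last one is only square integrable. *)
Definition chain L n w :=
  (forall i, (i < n)%N -> AC 0 L (w i) (w i.+1)) /\ sqint 0 L (w n).

Lemma chain_C0 L n w i : 0 < L -> chain L n w -> (i < n)%N -> C0 0 L (w i).
Proof. by move=> L0 [cw _] /cw; apply: AC_C0; exact: ltW. Qed.

Lemma chain_sq L n w i : 0 < L -> chain L n w -> (i <= n)%N ->
  sqint 0 L (w i).
Proof.
move=> L0 cw; rewrite leq_eqVlt => /orP[/eqP->|]; first exact: (proj2 cw).
by move=> /(chain_C0 L0 cw) /C0_sq.
Qed.

Lemma inH_chain L n u : 0 < L -> inH L n u ->
  exists2 w, chain L n w & forall i, (i <= n)%N -> aeq 0 L (wDn L i u) (w i).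
Proof.
move=> L0 un.
have sD i : (i <= n)%N -> sqint 0 L (wDn L i u).
  by move=> iN; exact: inH_L2 (inH_wDn L0 iN un).
(* The conditional covers all indices at once, as [choice] requires; from order [n] on, the weak
   derivative itself is taken instead of a continuous representative. *)
have H i : exists w0 : R -> R, if (i < n)%N then
    AC 0 L w0 (wDn L i.+1 u) /\ aeq 0 L (wDn L i u) w0 else w0 = wDn L i u.
  case: (boolP (i < n)%N) => iN; last by exists (wDn L i u).
  have := inH_wDn L0 (ltnW iN) un.
  rewrite -subSS subSn// => /(inH_wD L0)[wi _].
  have [w0 h1 h2] := weak_AC L0 (sD _ (ltnW iN)) (sD _ iN) wi.
  by exists w0.
have [w Hw] := choice H.
have wE i : (i <= n)%N -> aeq 0 L (wDn L i u) (w i).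
  move=> iN; have := Hw i; case: ifPn => // [_ []//|_ ->]; exact: aeq_refl.
have wn : w n = wDn L n u by have := Hw n; rewrite ltnn.
have ws i : (i <= n)%N -> measurable_fun `[0, L] (w i).
  rewrite leq_eqVlt => /orP[/eqP->|iN]; first by rewrite wn; apply: sq_meas; exact: sD.
  have := Hw i; rewrite iN => -[h _]; apply: C0_meas.
  exact: AC_C0 (ltW L0) h.
exists w => //; split; last by rewrite wn; exact: sD.
move=> i iN; have := Hw i; rewrite iN => -[h _].
apply: AC_eq h => //; [exact: ltW|exact: ws|exact: wE].
Qed.

Lemma chain_inH L n w u : 0 < L -> chain L n w -> sqint 0 L u ->
  aeq 0 L u (w 0) ->
  inH L n u /\
  forall i, (i <= n)%N -> sqint 0 L (wDn L i u) /\ aeq 0 L (wDn L i u) (w i).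
Proof.
move=> L0 cw su uw; split.
  have K m w' : chain L m w' -> inH L m (w' 0).
    elim: m w' => [|m IH] w' cw' /=; first exact/inL2P/(proj2 cw').
    split; first by apply/inL2P; exact: (chain_sq L0 cw').
    exists (w' 1); split; first by apply: AC_weak => //; exact: (proj1 cw').
    apply: (IH (fun i => w' i.+1)); split; last exact: (proj2 cw').
    by move=> i im; apply: (proj1 cw').
  apply: (inH_aeq su _ (K _ _ cw)); exact: aeq_sym.
elim=> [|i IH] iN; first by [].
have [si wi] := IH (ltnW iN).
have s1 := chain_sq L0 cw (ltnW iN); have s2 := chain_sq L0 cw iN.
have W : weak_derivative L (wDn L i u) (w i.+1).
  apply: (weak_aeq s1 s2 si s2 (aeq_sym wi) (aeq_refl _ _ _)).
  exact: AC_weak (proj1 cw _ iN).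
split; first exact: (proj1 (wD_weak s2 W)).
exact: wD_aeq.
Qed.

(** Two continuous representatives agree on the whole closed segment, so the trace can be read off
    any of them. *)
Lemma trace_C0 L v v0 x c : 0 < L -> aeq 0 L v v0 -> C0 0 L v0 ->
  0 <= x <= L -> trace_eq L v x c -> v0 x = c.
Proof.
move=> L0 vv cv xL [z [cz /aeqP vz <-]].
exact: (C0_ae_eq L0 cv cz (aeq_trans (aeq_sym vv) vz)).
Qed.

Lemma C0_trace L v v0 x c : aeq 0 L v v0 -> C0 0 L v0 -> v0 x = c ->
  trace_eq L v x c.
Proof. by move=> vv cv vc; exists v0; split=> //; exact/aeqP. Qed.

Definition boundary L l w :=
  (forall i, (i < l)%N -> w i 0 = 0 /\ w i L = 0) /\ w l L = 0.

Definition lin_op a l w x :=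
  a * w 0 x + \sum_(1 <= j < l.+1) (-1) ^+ (j + 1) * w (2 * j + 1)%N x.

(** The nonlinear term will be part of [h], so that the same predicate serves for the linear
    problem, for the nonlinear one and for differences of solutions. *)
Definition lin_bvp a L l w h :=
  [/\ chain L (2 * l + 1) w, boundary L l w & aeq 0 L (lin_op a l w) h].

Lemma regular_lin_bvp a L l k f u : 0 < L -> (0 < l)%N ->
  regular_solution a L l k f u ->
  exists2 w, lin_bvp a L l w (fun x => f x - w 0 x ^+ k * w 1 x) &
    aeq 0 L u (w 0).
Proof.
move=> L0 l0 [uH /aeqP ueq ubc uL].
have [w cw wE] := inH_chain L0 uH.
exists w; last exact: (wE 0).
have cC i : (i <= l)%N -> C0 0 L (w i).
  by move=> il; apply: (chain_C0 L0 cw); lia.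
split=> //.
  split; last first.
    by apply: (trace_C0 L0 _ _ _ uL); rewrite ?lexx ?ltW//; [apply: wE; lia|exact: cC].
  move=> i il; have [h0 hL] := ubc i il.
  by split; [apply: (trace_C0 L0 _ _ _ h0)|apply: (trace_C0 L0 _ _ _ hL)];
    rewrite ?lexx ?ltW//; try (by apply: wE; lia); apply: cC; exact: ltnW.
have e1 : aeq 0 L (fun x => \sum_(1 <= j < l.+1) (-1) ^+ (j + 1) * wDn L (2 * j + 1) u x)
   (fun x => \sum_(1 <= j < l.+1) (-1) ^+ (j + 1) * w (2 * j + 1)%N x).
  apply: (aeq_sum (F := fun j x => (-1) ^+ (j + 1) * wDn L (2 * j + 1) u x)
           (G := fun j x => (-1) ^+ (j + 1) * w (2 * j + 1)%N x)) => j.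
  rewrite mem_index_iota => jl.
  apply: (aeq_map (fun _ y => (-1) ^+ (j + 1) * y)); apply: wE; lia.
have e0 : aeq 0 L u (w 0) by exact: (wE 0).
have e2 : aeq 0 L (wDn L 1 u) (w 1%N) by apply: (wE 1); lia.
have FF := ae_filter_ringOfSetsType mu.
have := ae_and e1 (ae_and e0 (ae_and e2 ueq)).
apply: filterS => x [h1 [h0 [h2 h3]]] xi.
by rewrite /lin_op -(h1 xi) -(h0 xi) -(h2 xi) -(h3 xi); ring.
Qed.

Lemma lin_bvp_regular a L l k f w : 0 < L -> (0 < l)%N ->
  lin_bvp a L l w (fun x => f x - w 0 x ^+ k * w 1 x) ->
  regular_solution a L l k f (w 0).
Proof.
move=> L0 l0 [cw [bw wL] we].
have s0 : sqint 0 L (w 0) by apply: (chain_sq L0 cw).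
have [uH wE] := chain_inH L0 cw s0 (aeq_refl _ _ _).
have cC i : (i <= l)%N -> C0 0 L (w i).
  by move=> il; apply: (chain_C0 L0 cw); lia.
split=> //.
- apply/aeqP.
  have e1 : aeq 0 L (fun x => \sum_(1 <= j < l.+1) (-1) ^+ (j + 1) * wDn L (2 * j + 1) (w 0) x)
     (fun x => \sum_(1 <= j < l.+1) (-1) ^+ (j + 1) * w (2 * j + 1)%N x).
    apply: (aeq_sum (F := fun j x => (-1) ^+ (j + 1) * wDn L (2 * j + 1) (w 0) x)
             (G := fun j x => (-1) ^+ (j + 1) * w (2 * j + 1)%N x)) => j.
    rewrite mem_index_iota => jl.
    apply: (aeq_map (fun _ y => (-1) ^+ (j + 1) * y)).
    by apply: (proj2 (wE _ _)); lia.
  have e2 : aeq 0 L (wDn L 1 (w 0)) (w 1%N) by apply: (proj2 (wE 1 _)); lia.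
  have FF := ae_filter_ringOfSetsType mu.
  have := ae_and e1 (ae_and e2 we).
  apply: filterS => x [h1 [h2 h3]] xi.
  have := h3 xi; rewrite (h1 xi) (h2 xi) /lin_op => ->; ring.
- move=> i il; have [h0 hL] := bw i il.
  have ii : (i <= 2 * l + 1)%N by lia.
  split; (apply: C0_trace; [exact: (proj2 (wE i ii))|exact/cC/ltnW|by []]).
have ii : (l <= 2 * l + 1)%N by lia.
by apply: C0_trace; [exact: (proj2 (wE l ii))|exact: cC|].
Qed.

Lemma Hnorm_sq L n w u : 0 < L -> chain L n w -> sqint 0 L u ->
  aeq 0 L u (w 0) ->
  Hnorm L n u ^+ 2 = \sum_(i < n.+1) J 0 L (fun x => w i x ^+ 2).
Proof.
move=> L0 cw su uw; have [_ wE] := chain_inH L0 cw su uw.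
rewrite /Hnorm sqr_sqrtr; last by apply: sumr_ge0 => i _; exact: sqr_ge0.
apply: eq_bigr => i _.
have [si wi] := wE i (ltn_ord i).
rewrite L2norm_sq//; apply: Jae.
- exact: measurable_funX (sq_meas si).
- exact: measurable_funX (sq_meas (chain_sq L0 cw (ltn_ord i))).
- exact: (aeq_map (fun _ y => y ^+ 2) wi).
Qed.

End SobolevChains.

(** * Energy estimates *)

Section Energy.
Context {R : realType}.
Notation mu := (@lebesgue_measure R).
Implicit Types (L a b c x y z al be : R) (l k n i j p q : nat)
  (f g h u v r : R -> R) (w : nat -> R -> R).

Definition nrm a b f := Num.sqrt (J a b (fun x => f x ^+ 2)).

Lemma nrm_ge0 a b f : 0 <= nrm a b f.
Proof. exact: sqrtr_ge0. Qed.

Lemma nrm_sq a b f : nrm a b f ^+ 2 = J a b (fun x => f x ^+ 2).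
Proof. by rewrite sqr_sqrtr//; apply: Jge0 => x _; exact: sqr_ge0. Qed.

Lemma quadratic_ge0 (A B C : R) : 0 <= A ->
  (forall t, 0 <= A * t ^+ 2 - 2 * B * t + C) -> B ^+ 2 <= A * C.
Proof.
move=> A0 H; case: (ltgtP A 0) A0 => // [A0 _|A0 _].
  have := H (B / A).
  have -> : A * (B / A) ^+ 2 - 2 * B * (B / A) + C = C - B ^+ 2 / A.
    by field; rewrite gt_eqF.
  by rewrite subr_ge0 ler_pdivrMr// mulrC.
have -> : B = 0.
  apply/eqP; apply/negPn/negP => B0.
  (* With [A = 0] the polynomial is affine in [t]; if [B] were nonzero, it would take the value -1
     here. *)
  have := H ((C + 1) / (2 * B)); rewrite A0 mul0r add0r.
  have -> : - (2 * B * ((C + 1) / (2 * B))) + C = -1 by field.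
  by rewrite ler0N1.
by rewrite A0 expr2 !mul0r.
Qed.

Lemma Cauchy_Schwarz a b f g : sqint a b f -> sqint a b g ->
  `|J a b (fun x => f x * g x)| <= nrm a b f * nrm a b g.
Proof.
move=> sf sg.
rewrite -(@ler_pXn2r _ 2)// ?nnegrE//; last by rewrite mulr_ge0// nrm_ge0.
rewrite real_normK ?num_real// exprMn !nrm_sq.
have Lfg := sqM_L1 sf sg; have [_ Lf] := sf; have [_ Lg] := sg.
apply: quadratic_ge0; first by apply: Jge0 => x _; exact: sqr_ge0.
move=> t.
have -> : J a b (fun x => f x ^+ 2) * t ^+ 2 - 2 * J a b (fun x => f x * g x) * t
   + J a b (fun x => g x ^+ 2) = J a b (fun x => (t * f x - g x) ^+ 2).
  rewrite [RHS](_ : _ = J a b (fun x => (t ^+ 2 * f x ^+ 2 + (- 2 * t) * (f x * g x)) + g x ^+ 2)).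
    rewrite JD//; last by apply: L1D; exact: L1Z.
    rewrite JD; [|exact: L1Z|exact: L1Z].
    by rewrite !JZ//; ring.
  by apply: Jeq => x _; ring.
by apply: Jge0 => x _; exact: sqr_ge0.
Qed.

Lemma nrmD a b f g : sqint a b f -> sqint a b g ->
  nrm a b (fun x => f x + g x) <= nrm a b f + nrm a b g.
Proof.
move=> sf sg.
rewrite -(@ler_pXn2r _ 2)// ?nnegrE ?addr_ge0 ?nrm_ge0//.
have Lfg := sqM_L1 sf sg; have [_ Lf] := sf; have [_ Lg] := sg.
rewrite nrm_sq.
have -> : J a b (fun x => (f x + g x) ^+ 2) = J a b (fun x => f x ^+ 2) +
   2 * J a b (fun x => f x * g x) + J a b (fun x => g x ^+ 2).
  rewrite -JZ// -JD//; last exact: L1Z.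
  rewrite -JD//; last by apply: L1D => //; exact: L1Z.
  by apply: Jeq => x _; ring.
rewrite -!nrm_sq.
have := Cauchy_Schwarz sf sg; rewrite ler_norml => /andP[_ H].
have -> : (nrm a b f + nrm a b g) ^+ 2 = nrm a b f ^+ 2 +
  2 * (nrm a b f * nrm a b g) + nrm a b g ^+ 2 by ring.
by rewrite lerD2r lerD2l ler_pM2l.
Qed.

Lemma nrm_eq a b f g : (forall x, a <= x <= b -> f x ^+ 2 = g x ^+ 2) ->
  nrm a b f = nrm a b g.
Proof. by move=> fg; congr Num.sqrt; exact: Jeq. Qed.

Lemma nrm_ae a b f g : measurable_fun `[a, b] f -> measurable_fun `[a, b] g ->
  aeq a b f g -> nrm a b f = nrm a b g.
Proof.
move=> mf mg fg; congr Num.sqrt; apply: Jae.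
- exact: measurable_funX.
- exact: measurable_funX.
- exact: (aeq_map (fun _ y => y ^+ 2) fg).
Qed.

Lemma nrm_bnd a b f K : a <= b -> 0 <= K -> sqint a b f ->
  (forall x, a <= x <= b -> `|f x| <= K) -> nrm a b f <= Num.sqrt (b - a) * K.
Proof.
move=> ab K0 [mf Lf] fK.
rewrite -[K in leRHS]ger0_norm// -sqrtr_sqr -sqrtrM ?subr_ge0//.
apply: ler_wsqrtr; rewrite mulrC -Jcst//; apply: Jle => //.
  exact/C0_L1/C0_cst.
move=> x /fK H; rewrite -(real_normK (num_real (f x))).
by rewrite ler_pXn2r// nnegrE.
Qed.

Lemma nrm_mul_bnd a b f g K : 0 <= K -> measurable_fun `[a, b] g ->
  sqint a b f ->
  (forall x, a <= x <= b -> `|g x| <= K) ->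
  sqint a b (fun x => g x * f x) /\ nrm a b (fun x => g x * f x) <= K * nrm a b f.
Proof.
move=> K0 mg [mf Lf] gK.
have E x : a <= x <= b -> (g x * f x) ^+ 2 <= K ^+ 2 * f x ^+ 2.
  move=> /gK H; rewrite exprMn ler_wpM2r ?sqr_ge0//.
  by rewrite -(real_normK (num_real (g x))) ler_pXn2r// nnegrE.
have mgf : measurable_fun `[a, b] (fun x => g x * f x) by exact: measurable_funM.
have L' : L1 a b (fun x => (g x * f x) ^+ 2).
  apply: (L1_le _ (L1Z (K ^+ 2) Lf)); first exact: measurable_funX.
  by move=> x xab; rewrite ger0_norm ?sqr_ge0// E.
split; first by split.
rewrite -[K in leRHS]ger0_norm// -sqrtr_sqr -sqrtrM ?sqr_ge0//.
apply: ler_wsqrtr; rewrite -JZ//; apply: Jle => //.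
exact: L1Z.
Qed.

Lemma J_le_nrm a b x y f : a <= x -> x <= y -> y <= b -> sqint a b f ->
  J x y (fun t => `|f t|) <= Num.sqrt (y - x) * nrm a b f.
Proof.
move=> ax xy yb sf.
have sf' : sqint x y (fun t => `|f t|).
  have [mf Lf] := sf; split.
    apply: measurableT_comp => //; apply: measurable_funS mf => //.
    by apply: subset_itv; rewrite bnd_simp.
  apply: (@L1_eq _ _ _ (fun t => f t ^+ 2)); last exact: L1_sub Lf.
  by move=> t _; rewrite real_normK ?num_real.
have := Cauchy_Schwarz (C0_sq (@C0_cst _ x y 1)) sf'.
rewrite (_ : J x y _ = J x y (fun t => `|f t|)); last first.
  by apply: Jeq => t _; rewrite mul1r.
rewrite ger0_norm; last by apply: Jge0.
move=> /le_trans; apply; rewrite ler_pM ?nrm_ge0//.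
  by rewrite /nrm (@Jeq _ _ _ _ (fun=> 1)) ?Jcst ?mul1r// => t _; rewrite expr1n.
apply: ler_wsqrtr.
apply: (@le_trans _ _ (J x y (fun t => f t ^+ 2))).
  by rewrite le_eqVlt (Jeq (g := fun t => f t ^+ 2)) ?eqxx// => t _;
     rewrite real_normK ?num_real.
by apply: Jmono => //; [case: sf|move=> t _; exact: sqr_ge0].
Qed.

Lemma AC_weight L al be : AC 0 L (fun x => al + be * x) (fun=> be).
Proof.
have := ACD (AC_cst 0 L al) (ACZ be (AC_id 0 L)).
by rewrite add0r mulr1.
Qed.

(* The multiplier (al + be x) w_0 is used with (al, be) = (1, 0) to control
   the mass and with (1, 1) to gain derivatives. *)
Section Identity.
Context (L : R) (l : nat) (w : nat -> R -> R) (al be : R).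
Hypotheses (L0 : 0 < L) (cw : chain L (2 * l + 1) w) (bw : boundary L l w).
Let rho x := al + be * x.
Let I p q := J 0 L (fun x => rho x * (w p x * w q x)).
Let N p q := J 0 L (fun x => w p x * w q x).

Let wsq i : (i <= 2 * l + 1)%N -> sqint 0 L (w i).
Proof. exact: chain_sq. Qed.

Let N_L1 p q : (p <= 2 * l + 1)%N -> (q <= 2 * l + 1)%N ->
  L1 0 L (fun x => w p x * w q x).
Proof. by move=> pn qn; apply: sqM_L1; exact: wsq. Qed.

Let I_L1 p q : (p <= 2 * l + 1)%N -> (q <= 2 * l + 1)%N ->
  L1 0 L (fun x => rho x * (w p x * w q x)).
Proof.
move=> pn qn; apply: L1M_C0; last exact: N_L1.
exact: AC_C0 (ltW L0) (AC_weight L al be).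
Qed.

Let parts p q : (p < 2 * l + 1)%N -> (q < 2 * l + 1)%N ->
  be * N p q + (I p.+1 q + I p q.+1) =
  rho L * (w p L * w q L) - rho 0 * (w p 0 * w q 0).
Proof.
move=> pn qn; have [aw _] := cw.
have H := ACM (ltW L0) (AC_weight L al be) (ACM (ltW L0) (aw p pn) (aw q qn)).
rewrite -(AC_total (ltW L0) H) /N /I.
rewrite -JZ ?N_L1// 1?ltnW//.
rewrite -JD ?I_L1// 1?ltnW//.
rewrite -JD.
- by apply: Jeq => x _; rewrite /rho; ring.
- by apply/L1Z/N_L1; exact: ltnW.
- by apply: L1D; apply: I_L1 => //; exact: ltnW.
Qed.

Let partsN p q : (p < 2 * l + 1)%N -> (q < 2 * l + 1)%N ->
  N p.+1 q + N p q.+1 = w p L * w q L - w p 0 * w q 0.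
Proof.
move=> pn qn; have [aw _] := cw.
have H := ACM (ltW L0) (aw p pn) (aw q qn).
rewrite -(AC_total (ltW L0) H) /N JD//; by apply: N_L1 => //; exact: ltnW.
Qed.

(** Move [j] derivatives from the second factor to [w 0]; the boundary terms vanish because [w p] is
    zero at both ends for p < j. Each transfer across the weight costs [be] times the same integral
    [N 0 (2 * j)], which equals [N j j] up to sign, and the last integral of w_j w_(j+1) contributes
    one half: hence the factor j + 1 / 2. At L the last boundary term vanishes since [w j L = 0],
    also for j = l. *)
Lemma energy_term j : (j <= l)%N ->
  (-1) ^+ (j + 1) * I 0 (2 * j + 1) =
  be * ((2 * j + 1)%:R / 2) * N j j + al / 2 * w j 0 ^+ 2.
Proof.
move=> jl; have [bw1 bw2] := bw.
have HN p : (p <= j)%N -> N 0 (2 * j) = (-1) ^+ p * N p (2 * j - p).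
  elim: p => [|p IH] pj; first by rewrite mul1r subn0.
  rewrite IH 1?ltnW//.
  have [z0 zL] := bw1 p (leq_trans pj jl).
  have -> : (2 * j - p)%N = (2 * j - p.+1).+1 by lia.
  have := @partsN p (2 * j - p.+1) ltac:(lia) ltac:(lia).
  rewrite z0 zL !mul0r subr0 => /eqP; rewrite addrC addr_eq0 => /eqP->.
  by rewrite exprS; ring.
have HI p : (p <= j)%N -> I 0 (2 * j + 1) =
    (-1) ^+ p * I p (2 * j + 1 - p) - be * p%:R * N 0 (2 * j).
  elim: p => [|p IH] pj; first by rewrite mul1r subn0 mulr0 mul0r subr0.
  rewrite IH 1?ltnW// [X in _ = _ - be * _ * X](HN p) 1?ltnW//.
  rewrite {1}(HN p) 1?ltnW//.
  have [z0 zL] := bw1 p (leq_trans pj jl).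
  have -> : (2 * j + 1 - p)%N = (2 * j - p).+1 by lia.
  have -> : (2 * j + 1 - p.+1)%N = (2 * j - p)%N by lia.
  have := @parts p (2 * j - p) ltac:(lia) ltac:(lia).
  rewrite z0 zL !mul0r !mulr0 subr0 => /eqP.
  rewrite addrA addrC addr_eq0 => /eqP->.
  have S : (-1) ^+ p * (-1) ^+ p = 1 :> R by rewrite -exprMn mulrNN mulr1 expr1n.
  rewrite exprS -natr1; ring: S.
have S : (-1) ^+ j * (-1) ^+ j = 1 :> R by rewrite -exprMn mulrNN mulr1 expr1n.
rewrite (HI j)// (HN j)//.
have -> : (2 * j + 1 - j)%N = j.+1 by lia.
have -> : (2 * j - j)%N = j by lia.
have := @parts j j ltac:(lia) ltac:(lia).
have -> : w j L = 0.
  by move: jl; rewrite leq_eqVlt => /orP[/eqP->//|/bw1[]].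
have -> : I j.+1 j = I j j.+1 by apply: Jeq => x _; ring.
rewrite /rho !mulr0 addr0 sub0r => H.
have -> : I j j.+1 = - (be * N j j + al * (w j 0 * w j 0)) / 2 by lra.
rewrite addn1 exprS natrD natrM.
by field: S.
Qed.

Lemma energy_identity a h : measurable_fun `[0, L] h ->
  aeq 0 L (lin_op a l w) h ->
  J 0 L (fun x => rho x * (w 0 x * h x)) =
  a * I 0 0 + \sum_(1 <= j < l.+1)
    (be * ((2 * j + 1)%:R / 2) * N j j + al / 2 * w j 0 ^+ 2).
Proof.
move=> mh eh.
pose F j x := (-1) ^+ (j + 1) * (rho x * (w 0 x * w (2 * j + 1)%N x)).
have LF j : (j <= l)%N -> L1 0 L (F j).
  by move=> jl; apply/L1Z/I_L1; lia.
have Jsum m : (m <= l)%N ->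
    L1 0 L (fun x => \sum_(1 <= j < m.+1) F j x) /\
    J 0 L (fun x => \sum_(1 <= j < m.+1) F j x) =
    \sum_(1 <= j < m.+1) (-1) ^+ (j + 1) * I 0 (2 * j + 1).
  elim: m => [|m IH] ml.
    rewrite [RHS]big_geq//.
    have -> : (fun x => \sum_(1 <= j < 1) F j x) = (fun=> 0).
      by apply/funext => x; rewrite big_geq.
    by rewrite Jcst ?ltW// mul0r; split=> //; exact/C0_L1/C0_cst.
  have [Lm Jm] := IH (ltnW ml).
  have E : (fun x => \sum_(1 <= j < m.+2) F j x) =
      (fun x => \sum_(1 <= j < m.+1) F j x + F m.+1 x).
    by apply/funext => x; rewrite big_nat_recr.
  rewrite E; split; first by apply: L1D => //; exact: LF.
  rewrite JD ?Jm//; last exact: LF.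
  rewrite [RHS]big_nat_recr//=; congr (_ + _).
  rewrite /F JZ//; apply: I_L1; lia.
have [LS JS] := Jsum l (leqnn _).
rewrite -(eq_big_nat _ _ (F1 := fun j => (-1) ^+ (j + 1) * I 0 (2 * j + 1))); last first.
  by move=> j jl; apply: energy_term; lia.
rewrite -JS -JZ; last exact: I_L1.
rewrite -JD//; last by apply/L1Z/I_L1.
have E x : rho x * (w 0 x * lin_op a l w x) =
   a * (rho x * (w 0 x * w 0 x)) + \sum_(1 <= j < l.+1) F j x.
  rewrite /lin_op !mulrDr !mulr_sumr; congr (_ + _); first by ring.
  by apply: eq_bigr => j _; rewrite /F; ring.
have c0 : C0 0 L (w 0) by apply: (chain_C0 L0 cw); lia.
have cr : C0 0 L rho := AC_C0 (ltW L0) (AC_weight L al be).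
apply: Jae.
- apply: measurable_funM; first exact: C0_meas.
  by apply: measurable_funM => //; exact: C0_meas.
- by apply: L1_meas; apply: L1D => //; exact/L1Z/I_L1.
- have := aeq_map (fun x y => rho x * (w 0 x * y)) (aeq_sym eh).
  by apply: filterS => x h1 xi; rewrite -E -h1.
Qed.

End Identity.

Lemma energy_mass a L l w h : 0 < L -> lin_bvp a L l w h ->
  measurable_fun `[0, L] h ->
  a * nrm 0 L (w 0) ^+ 2 <= J 0 L (fun x => w 0 x * h x).
Proof.
move=> L0 [cw bw ew] mh.
have := @energy_identity L l w 1 0 L0 cw bw a h mh ew.
rewrite (@Jeq _ _ _ _ (fun x => w 0 x * h x)); last first.
  by move=> x _; ring.
move=> ->; rewrite nrm_sq.
rewrite (@Jeq _ _ _ _ (fun x => w 0 x ^+ 2)); last by move=> x _; ring.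
rewrite lerDl; apply: sumr_ge0 => j _.
by rewrite !mul0r add0r mulr_ge0// sqr_ge0.
Qed.

Lemma energy_weighted a L l w h j : 0 < L -> 0 < a -> lin_bvp a L l w h ->
  measurable_fun `[0, L] h -> (1 <= j <= l)%N ->
  a * nrm 0 L (w 0) ^+ 2 + 3 / 2 * nrm 0 L (w j) ^+ 2 <=
  J 0 L (fun x => (1 + x) * (w 0 x * h x)).
Proof.
move=> L0 a0 [cw bw ew] mh /andP[j1 jl].
have := @energy_identity L l w 1 1 L0 cw bw a h mh ew.
rewrite (@Jeq _ _ _ _ (fun x => (1 + x) * (w 0 x * h x))); last first.
  by move=> x _; ring.
move=> ->.
have s0 : sqint 0 L (w 0) by apply: (chain_sq L0 cw).
have [_ L0'] := s0.
apply: lerD.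
  rewrite ler_pM2l// nrm_sq; apply: Jle => //.
    apply: (@L1_eq _ _ _ (fun x => (1 + x) * (w 0 x ^+ 2))).
      by move=> x _; ring.
    exact: weighted_L1.
  move=> x /andP[x0 _]; have := sqr_ge0 (w 0 x); nra.
have Nge i : 0 <= J 0 L (fun x => w i x * w i x).
  by apply: Jge0 => x _; rewrite -expr2 sqr_ge0.
have T0 i : 0 <= 1 * ((2 * i + 1)%:R / 2) * J 0 L (fun x => w i x * w i x) +
    1 / 2 * w i 0 ^+ 2.
  by rewrite addr_ge0// mulr_ge0// ?sqr_ge0// mul1r divr_ge0.
(* All summands are nonnegative; only the one of index [j] is kept, and (2 j + 1) / 2 is at least 3
   / 2. *)
rewrite (@big_cat_nat _ _ _ j)//=; last by lia.
rewrite [X in _ <= _ + X]big_ltn//.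
apply: ler_wpDl; first by apply: sumr_ge0 => i _.
apply: ler_wpDr; first by apply: sumr_ge0 => i _.
apply: ler_wpDr; first by rewrite mulr_ge0// sqr_ge0.
rewrite nrm_sq (Jeq (g := fun x => w j x * w j x)); last by move=> x _; ring.
rewrite mul1r ler_wpM2r// ler_pM2r ?invr_gt0//.
by rewrite ler_nat; lia.
Qed.

End Energy.

(* Without the real-valued hypotheses, the preprocessing of [lia] stays fast. *)
Ltac nlia := repeat match goal with H : ?T |- _ =>
  lazymatch T with
  | nat => fail
  | is_true (leq _ _) => fail
  | is_true (leq _ _ && leq _ _) => fail
  | _ => clear H
  end end; lia.

(** * Interpolation and the a priori estimate for the linear problem *)

Section LinearEstimate.
Context {R : realType}.
Notation mu := (@lebesgue_measure R).
Implicit Types (L a x y z s A B K M eps : R) (l k n i j : nat)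
  (f g h u v : R -> R) (w : nat -> R -> R).

(** Used with x = 1 / a, so that 1 + 1 / a replaces the square root of 1 / a in the constants. *)
Lemma le_sqr1D x : 0 <= x -> x <= (1 + x) ^+ 2.
Proof. by move=> x0; nra. Qed.

Definition bounded_by L f K := forall x, 0 <= x <= L -> `|f x| <= K.

Lemma C0_sup L f : 0 <= L -> C0 0 L f ->
  exists2 x0, 0 <= x0 <= L & bounded_by L f `|f x0|.
Proof.
move=> L0 cf.
have [c cL cM] := EVT_max L0 (C0_abs cf).
exists c; first by move: cL; rewrite in_itv.
by move=> x xL; apply: cM; rewrite in_itv.
Qed.

(** The mean of [v] over an interval of length [s] is a difference quotient of [u], at most 2 A / s,
    and [v] differs from its mean by at most [B]. The interval is taken to the right of the point in
    the left half of [0, L], to its left otherwise; hence s <= L / 2. *)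
Lemma interpolation L s u v A B : 0 < s -> s <= L / 2 -> AC 0 L u v ->
  C0 0 L v -> bounded_by L u A ->
  (forall x y, 0 <= x -> x <= y -> y <= L -> y - x <= s ->
     `|v y - v x| <= B) ->
  bounded_by L v (2 * A / s + B).
Proof.
move=> s0 sL uv cv uA vB.
have core x z : 0 <= x -> x + s <= L -> z = x \/ z = x + s ->
    `|v z| <= 2 * A / s + B.
  move=> x0 xs zx.
  have xxs : x <= x + s by lra.
  have Lv : L1 x (x + s) v by apply: L1_sub (proj1 uv).
  have Lc : L1 x (x + s) (fun=> v z) by exact/C0_L1/C0_cst.
  have E : v z * s = (u (x + s) - u x) - J x (x + s) (fun t => v t - v z).
    by rewrite JB// Jcst// (AC_incr uv)//; ring.
  have E2 : `|J x (x + s) (fun t => v t - v z)| <= B * s.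
    rewrite (_ : B * s = B * (x + s - x)); last by ring.
    apply: Jsup => //; first exact: L1B.
    move=> t /andP[xt txs]; case: zx => ->.
      by apply: vB => //; lra.
    by rewrite distrC; apply: vB => //; lra.
  have u1 : `|u (x + s)| <= A by apply: uA; lra.
  have u2 : `|u x| <= A by apply: uA; lra.
  rewrite -(ler_pM2r s0).
  have -> : `|v z| * s = `|v z * s| by rewrite normrM (gtr0_norm s0).
  rewrite E (le_trans (ler_normB _ _))//.
  have -> : (2 * A / s + B) * s = (A + A) + B * s by field; rewrite gt_eqF.
  by apply: lerD => //; rewrite (le_trans (ler_normB _ _))// lerD.
move=> x /andP[x0 xL]; case: (leP x (L / 2)) => h.
  by apply: (core x); [|lra|left].
by apply: (core (x - s)); [lra|lra|right; ring].
Qed.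

(** The derivative of order 2 l + 1 is only square integrable, so at the last step its L^2 norm
    replaces the supremum. *)
Definition next_bound L l w i B :=
  if (i < 2 * l)%N then bounded_by L (w i.+1) B else nrm 0 L (w i.+1) <= B.

Lemma next_incr L l w i B x y : 0 < L -> 0 <= B -> chain L (2 * l + 1) w ->
  (i <= 2 * l)%N -> next_bound L l w i B ->
  0 <= x -> x <= y -> y <= L ->
  `|w i y - w i x| <= Num.max (y - x) (Num.sqrt (y - x)) * B.
Proof.
move=> L0 B0 cw il + x0 xy yL.
have [aw _] := cw; have ai := aw i ltac:(nlia).
have H := AC_le ai x0 xy yL.
have yx : 0 <= y - x by rewrite subr_ge0.
rewrite /next_bound; case: ifP => i2 HB; apply: (le_trans H).
  apply: (@le_trans _ _ ((y - x) * B)); last first.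
    by rewrite ler_wpM2r// le_max lexx.
  rewrite mulrC -Jcst//; apply: Jle.
  - by apply/L1_abs; apply: L1_sub (proj1 ai).
  - exact/C0_L1/C0_cst.
  - by move=> t /andP[xt ty]; apply: HB; rewrite (le_trans x0)// (le_trans ty).
apply: (@le_trans _ _ (Num.sqrt (y - x) * B)); last first.
  by rewrite ler_wpM2r// le_max lexx orbT.
apply: (le_trans (J_le_nrm x0 xy yL (chain_sq L0 cw _))); first by nlia.
by rewrite ler_wpM2l// sqrtr_ge0.
Qed.

(* The supremum K of |w_(i+1)| is attained, so the bound at order i, which
   involves a small multiple of K, can be absorbed. *)
Lemma interpolation_step L l i : 0 < L -> (i <= 2 * l)%N ->
  forall eps, 0 < eps -> exists2 C : R, 0 <= C & forall w A B,
    chain L (2 * l + 1) w -> 0 <= A -> 0 <= B ->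
    bounded_by L (w 0) A -> next_bound L l w i B ->
    bounded_by L (w i) (eps * B + C * A).
Proof.
move=> L0; elim: i => [|i IH] il eps e0.
  exists 1 => // w A B _ A0 B0 wA _ x /wA h; rewrite mul1r (le_trans h)//.
  by rewrite lerDr mulr_ge0// ltW.
(* Both [s] and its square root must be at most eps / 2: the former serves when the next derivative
   is bounded, the latter when it is only in L^2. *)
pose s := Num.min (L / 2) (Num.min (eps / 2) ((eps / 2) ^+ 2)).
have s0 : 0 < s by rewrite /s !lt_min !divr_gt0// exprn_gt0// divr_gt0.
have sL : s <= L / 2 by rewrite /s ge_min lexx.
have se : s <= eps / 2 by rewrite /s !ge_min lexx !orbT.
have sse : Num.sqrt s <= eps / 2.
  rewrite -[leRHS]ger0_norm; last by rewrite divr_ge0// ltW.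
  by rewrite -sqrtr_sqr ler_wsqrtr// /s !ge_min lexx !orbT.
have s4 : 0 < s / 4 by rewrite divr_gt0.
(* With s / 4, the division by [s] in [interpolation] leaves K / 2, which is absorbed by [K]. *)
have [C C0' HC] := IH (ltnW il) (s / 4) s4.
exists (4 * C / s); first by rewrite divr_ge0 ?mulr_ge0// ltW.
move=> w A B cw A0 B0 wA wB.
have ci1 : C0 0 L (w i.+1) by apply: (chain_C0 L0 cw); nlia.
have [x0 x0L HK] := C0_sup (ltW L0) ci1.
set K := `|w i.+1 x0| in HK.
have wi : bounded_by L (w i) (s / 4 * K + C * A).
  apply: HC => //; first exact: normr_ge0.
  by rewrite /next_bound ifT//.
have := interpolation (B := eps / 2 * B) s0 sL (proj1 cw i ltac:(nlia)) ci1 wi.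
move=> /(_ _)/wrap[|H].
  move=> x y x0' xy yL yxs.
  apply: (le_trans (next_incr L0 B0 cw il wB x0' xy yL)).
  rewrite ler_wpM2r// ge_max (le_trans yxs)//=.
  by rewrite (le_trans _ sse)// ler_wsqrtr.
have := H x0 x0L; rewrite -/K => KK.
have E : 2 * (s / 4 * K + C * A) / s = K / 2 + 2 * C * A / s.
  by field; rewrite gt_eqF.
rewrite E in KK.
move=> x /HK h; apply: (le_trans h).
have -> : 4 * C / s * A = 2 * (2 * C * A / s) by ring.
lra.
Qed.

(** Downward induction from order 2 l. Only the first step uses [eps]; each later one uses factor 1,
    so the coefficient of [M] does not grow. *)
Lemma interpolation_all L l d : 0 < L -> (d <= 2 * l)%N ->
  forall eps, 0 < eps -> exists2 C : R, 0 <= C & forall w A M,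
    chain L (2 * l + 1) w -> 0 <= A -> 0 <= M ->
    bounded_by L (w 0) A -> nrm 0 L (w (2 * l + 1)%N) <= M ->
    forall i, (2 * l - d <= i <= 2 * l)%N ->
    bounded_by L (w i) (eps * M + C * A).
Proof.
move=> L0 dl eps e0; elim: d dl => [|d IH] dl.
  have [C C0' H] := interpolation_step L0 (leqnn (2 * l)) e0.
  exists C => // w A M cw A0 M0 wA wM i il.
  have -> : i = (2 * l)%N by nlia.
  by apply: H => //; rewrite /next_bound ltnn -addn1.
have [C1 C10 H1] := IH (ltnW dl).
have [C2 C20 H2] := @interpolation_step L l (2 * l - d.+1) L0 (leq_subr _ _) 1 ltr01.
exists (C1 + C2); first exact: addr_ge0.
move=> w A M cw A0 M0 wA wM i il.
case: (leqP (2 * l - d) i) => h.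
  have := H1 w A M cw A0 M0 wA wM i ltac:(nlia).
  move=> h1 x /h1/le_trans; apply.
  by rewrite mulrDl addrA lerDl mulr_ge0.
have -> : i = (2 * l - d.+1)%N by nlia.
have := H2 w A (eps * M + C1 * A) cw A0.
have p0 : 0 <= eps * M + C1 * A by rewrite addr_ge0// mulr_ge0// ltW.
move=> /(_ p0 wA).
rewrite /next_bound ifT; last by nlia.
move=> /(_ _)/wrap[|H3].
  by apply: H1 => //; nlia.
by move=> x /H3 h3; rewrite (le_trans h3)// mul1r mulrDl addrA.
Qed.

Lemma sup_by_derivative L u v : 0 < L -> AC 0 L u v -> sqint 0 L v ->
  u 0 = 0 -> bounded_by L u (Num.sqrt L * nrm 0 L v).
Proof.
move=> L0 aw sw w00 x /andP[x0 xL].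
have := AC_le aw (lexx 0) x0 xL; rewrite w00 subr0 => /le_trans; apply.
apply: (le_trans (J_le_nrm (lexx 0) x0 xL sw)).
by rewrite ler_wpM2r ?nrm_ge0// ler_wsqrtr// subr0.
Qed.

Lemma bounded_sum L (F : nat -> R -> R) K m :
  (forall j, (1 <= j < m)%N -> bounded_by L (F j) K) -> 0 <= K ->
  bounded_by L (fun x => \sum_(1 <= j < m) F j x) (m%:R * K).
Proof.
move=> FK K0 x xL.
apply: (le_trans (ler_norm_sum _ _ _)).
apply: (@le_trans _ _ (\sum_(1 <= j < m) K)).
  by apply: ler_sum_nat => j jm; exact: FK.
rewrite big_const_nat iter_addr addr0 -[K *+ _]mulr_natl ler_wpM2r// ler_nat.
nlia.
Qed.

Lemma lin_top a L l w h : (0 < l)%N -> aeq 0 L (lin_op a l w) h ->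
  aeq 0 L (w (2 * l + 1)%N)
   (fun x => (-1) ^+ (l + 1) * (h x - (a * w 0 x +
     \sum_(1 <= j < l) (-1) ^+ (j + 1) * w (2 * j + 1)%N x))).
Proof.
move=> l0; apply: filterS => x H xi; rewrite -(H xi) /lin_op big_nat_recr//=.
have S : (-1) ^+ (l + 1) * (-1) ^+ (l + 1) = 1 :> R.
  by rewrite -exprMn mulrNN mulr1 expr1n.
ring: S.
Qed.

(** The energy bounds Du, hence sup |u|. Solving the equation for the top derivative bounds its norm
    [M] by that of [h] and lower orders, which interpolation bounds by a small multiple of [M] plus
    a multiple of sup |u|. *)
Lemma lin_estimate a L l : 0 < a -> 0 < L -> (0 < l)%N ->
  exists2 C : R, 0 < C & forall w h, sqint 0 L h -> lin_bvp a L l w h ->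
    (forall i, (i <= 2 * l)%N -> bounded_by L (w i) (C * nrm 0 L h)) /\
    nrm 0 L (w (2 * l + 1)%N) <= C * nrm 0 L h.
Proof.
move=> a0 L0 l0.
pose q := Num.sqrt L.
have q0 : 0 <= q by exact: sqrtr_ge0.
pose K1 := (1 + L) * (1 + a^-1).
have ai0 : 0 < a^-1 by rewrite invr_gt0.
have K10 : 0 < K1 by rewrite mulr_gt0// addr_gt0.
(* With this [eps], the lower-order terms contribute at most M / 2, as [qle] records. *)
pose eps := (2 * (q + 1) * (l.+1)%:R)^-1.
have d0 : 0 < 2 * (q + 1) * (l.+1)%:R by rewrite !mulr_gt0// ?ltr0n//; lra.
have e0 : 0 < eps by rewrite invr_gt0.
have qle : q * (l%:R * eps) <= 1 / 2.
  rewrite mulrA ler_pdivrMr// -[l.+1%:R]natr1.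
  have lR : 0 <= l%:R :> R by [].
  have := mulr_ge0 q0 lR; lra.
have [C C0' HC] := interpolation_all L0 (leqnn (2 * l)) e0.
(* Twice the coefficient of [H] that remains once M / 2 has been absorbed. *)
pose K2 := 2 + 2 * q * (a + l%:R * C) * (q * K1).
have lC : 0 <= a + l%:R * C by rewrite addr_ge0 ?mulr_ge0// ltW.
have K1p := ltW K10; have ep := ltW e0.
have qK1 : 0 <= q * K1 by rewrite mulr_ge0.
have K20 : 0 <= K2.
  by rewrite addr_ge0// mulr_ge0// mulr_ge0// mulr_ge0.
have K30 : 0 <= eps * K2 + C * (q * K1).
  by apply: addr_ge0; apply: mulr_ge0.
exists (1 + K2 + (eps * K2 + C * (q * K1))); first by lra.
move=> w h sh bw; have [cw [bw1 bw2] ew] := bw.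
set H := nrm 0 L h.
have H0 : 0 <= H by exact: nrm_ge0.
set n0 := nrm 0 L (w 0); set n1 := nrm 0 L (w 1%N).
have n00 : 0 <= n0 by exact: nrm_ge0.
have n10 : 0 <= n1 by exact: nrm_ge0.
have c0 : C0 0 L (w 0) by apply: (chain_C0 L0 cw); nlia.
have s1 : sqint 0 L (w 1%N) by apply: (chain_sq L0 cw); nlia.
have En := @energy_weighted _ a L l w h 1 L0 a0 bw (sq_meas sh) ltac:(nlia).
have c1x : C0 0 L (fun x => 1 + x) by apply: C0D; [exact: C0_cst|exact: C0_id].
have [sg ng] := @nrm_mul_bnd _ 0 L (w 0) (fun x => 1 + x) (1 + L)
  ltac:(lra) (C0_meas c1x) (C0_sq c0)
  ltac:(by move=> x xL; rewrite ger0_norm; lra).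
have CS := Cauchy_Schwarz sg sh.
have E1 : J 0 L (fun x => (1 + x) * (w 0 x * h x)) <= (1 + L) * n0 * H.
  rewrite (Jeq (g := fun x => (1 + x) * w 0 x * h x)); last by move=> x _; ring.
  apply: (le_trans (ler_norm _)); apply: (le_trans CS).
  by rewrite ler_wpM2r.
have E2 : a * n0 ^+ 2 + 3 / 2 * n1 ^+ 2 <= (1 + L) * n0 * H := le_trans En E1.
have n1K : n1 <= K1 * H.
  rewrite -(@ler_pXn2r _ 2)// ?nnegrE//; last by rewrite mulr_ge0// ltW.
  have S1 : (1 + L) * n0 * H <= a * n0 ^+ 2 + ((1 + L) * H) ^+ 2 * a^-1.
    rewrite -subr_ge0.
    have -> : a * n0 ^+ 2 + ((1 + L) * H) ^+ 2 * a^-1 - (1 + L) * n0 * H =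
       a^-1 * ((a * n0 - (1 + L) * H / 2) ^+ 2 + 3 / 4 * ((1 + L) * H) ^+ 2).
      by field; rewrite gt_eqF.
    apply: mulr_ge0; first exact: ltW.
    by apply: addr_ge0; [exact: sqr_ge0|apply: mulr_ge0 => //; exact: sqr_ge0].
  have S2 : ((1 + L) * H) ^+ 2 * a^-1 <= (K1 * H) ^+ 2.
    have -> : (K1 * H) ^+ 2 = ((1 + L) * H) ^+ 2 * (1 + a^-1) ^+ 2.
      by rewrite /K1; ring.
    by rewrite ler_wpM2l ?sqr_ge0//; exact/le_sqr1D/ltW.
  have := sqr_ge0 n1; lra.
have wA : bounded_by L (w 0) (q * K1 * H).
  have b0 := sup_by_derivative L0 (proj1 cw 0 ltac:(nlia)) s1 (bw1 0 l0).1.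
  by move=> x /b0 hx; rewrite (le_trans hx)// -mulrA ler_wpM2l.
set M := nrm 0 L (w (2 * l + 1)%N).
have M0 : 0 <= M by exact: nrm_ge0.
have A0 : 0 <= q * K1 * H by apply: mulr_ge0.
have HI := HC w _ M cw A0 M0 wA (lexx _).
set K := eps * M + C * (q * K1 * H) in HI.
have K0 : 0 <= K by apply: addr_ge0; apply: mulr_ge0.
have MK : M <= K2 * H.
  pose E x := a * w 0 x + \sum_(1 <= j < l) (-1) ^+ (j + 1) * w (2 * j + 1)%N x.
  have sE : sqint 0 L E.
    apply: sqD; first exact/sqZ/C0_sq.
    apply: (@sq_sum _ 0 L (index_iota 1 l)
      (fun j x => (-1) ^+ (j + 1) * w (2 * j + 1)%N x)) => j.
    by rewrite mem_index_iota => jl; apply/sqZ/(chain_sq L0 cw); nlia.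
  have bE : bounded_by L E (a * (q * K1 * H) + l%:R * K).
    move=> x xL; rewrite (le_trans (ler_normD _ _))// lerD//.
      by rewrite normrM (gtr0_norm a0) ler_pM2l//; exact: wA.
    apply: (@bounded_sum L (fun j x => (-1) ^+ (j + 1) * w (2 * j + 1)%N x) K l
      _ K0 x xL).
    move=> j jl t tL; rewrite normrM normrX normrN1 expr1n mul1r.
    by apply: (HI _ _ t tL); nlia.
  have nE : nrm 0 L E <= q * (a * (q * K1 * H) + l%:R * K).
    have := @nrm_bnd _ 0 L E _ (ltW L0) _ sE bE.
    rewrite subr0; apply.
    by apply: addr_ge0; apply: mulr_ge0 => //; exact: ltW.
  have ME : M <= H + nrm 0 L E.
    rewrite /M (nrm_ae _ _ (lin_top l0 ew)).
    + rewrite (nrm_eq (g := fun x => h x + (-1) * E x)); last first.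
        move=> x _; rewrite exprMn -exprM mulnC exprM sqrrN expr1n expr1n mul1r.
        by rewrite -/(E x) mulN1r.
      apply: (le_trans (nrmD sh (sqZ (-1) sE))).
      rewrite lerD2l (nrm_eq (g := E))// => x _; ring.
    + by apply: sq_meas; apply: (chain_sq L0 cw).
    + by apply: measurable_funM => //; apply: sq_meas; exact: sqB.
  have K1H : 0 <= K1 * H by apply: mulr_ge0.
  have l0' : 0 <= l%:R :> R by [].
  have : M <= H + q * (l%:R * eps) * M + q * (a + l%:R * C) * (q * K1) * H.
    apply: (le_trans (le_trans ME (lerD (lexx H) nE))).
    rewrite le_eqVlt; apply/orP; left; apply/eqP; rewrite /K; ring.
  have : q * (l%:R * eps) * M <= 1 / 2 * M by rewrite ler_wpM2r.
  rewrite /K2; lra.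
have KH : K <= (eps * K2 + C * (q * K1)) * H.
  have : eps * M <= eps * (K2 * H) by rewrite ler_pM2l.
  by rewrite /K; lra.
have K2H : 0 <= K2 * H by apply: mulr_ge0.
have K3H : 0 <= (eps * K2 + C * (q * K1)) * H by apply: mulr_ge0.
have -> : (1 + K2 + (eps * K2 + C * (q * K1))) * H =
  H + K2 * H + (eps * K2 + C * (q * K1)) * H by ring.
split.
  move=> i il x xL; apply: (le_trans (HI i _ x xL)); first by nlia.
  by apply: (le_trans KH); rewrite lerDr addr_ge0.
by apply: (le_trans MK); rewrite addrAC lerDr addr_ge0.
Qed.

End LinearEstimate.

(** * Existence for the linear problem *)

Section FixedPoint.
Context {R : realType}.
Implicit Types (a b c k eps : R) (n m : nat).

Lemma geometric_small k eps : 0 < eps -> exists n, k / 2 ^+ n <= eps.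
Proof.
move=> e0; exists (Num.bound (k / eps)).
rewrite ler_pdivrMr ?exprn_gt0// mulrC -ler_pdivrMr//.
have h := archi_boundP (normr_ge0 (k / eps)).
case: (leP 0 (k / eps)) => k0; last first.
  by rewrite (le_trans (ltW k0))// exprn_ge0.
have {}h := archi_boundP k0.
rewrite (le_trans (ltW h))// -natrX ler_nat ltnW// ltn_expl//.
Qed.

Lemma geometric_eq0 k (x : R) : (forall n, `|x| <= k / 2 ^+ n) -> x = 0.
Proof.
move=> H; apply/eqP; rewrite -normr_le0 leNgt; apply/negP => x0.
have [n hn] := @geometric_small k (`|x| / 2) ltac:(by rewrite divr_gt0).
have := le_trans (H n) hn.
by rewrite leNgt => /negP; apply; rewrite ltr_pdivrMr// ltr_pMr// ltr1n.
Qed.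

(* The limit of [u] is the supremum of the nondecreasing sequence
   u n - 2 c / 2^n. *)
Lemma telescoped_limit (u : nat -> R) c :
  (forall n, `|u n.+1 - u n| <= c / 2 ^+ n) ->
  forall n, `|sup (range (fun n => u n - 2 * c / 2 ^+ n)) - u n|
    <= 2 * c / 2 ^+ n.
Proof.
move=> H n.
have p2 i : 2 ^+ i != 0 :> R by rewrite expf_neq0.
have mono i j : (i <= j)%N -> u i - 2 * c / 2 ^+ i <= u j - 2 * c / 2 ^+ j /\
    u j + 2 * c / 2 ^+ j <= u i + 2 * c / 2 ^+ i.
  move=> ij; rewrite -(subnK ij); elim: (j - i)%N => [//|d [IH1 IH2]].
  rewrite addSn; have := H (d + i)%N; rewrite ler_norml => /andP[h1 h2].
  have E : 2 * c / 2 ^+ (d + i).+1 = c / 2 ^+ (d + i).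
    by rewrite exprS; field; rewrite p2.
  have E' : 2 * c / 2 ^+ (d + i) = 2 * (c / 2 ^+ (d + i)) by ring.
  by rewrite E; rewrite E' in IH1 IH2; split; lra.
have c0 : 0 <= c.
  by have := le_trans (normr_ge0 _) (H 0%N); rewrite expr0 divr1.
have q0 i : 0 <= 2 * c / 2 ^+ i.
  by rewrite divr_ge0 ?mulr_ge0// exprn_ge0.
have ub i j : u i - 2 * c / 2 ^+ i <= u j + 2 * c / 2 ^+ j.
  case: (leqP i j) => ij.
    have [h _] := mono i j ij; have := q0 j; lra.
  have [_ h] := mono j i (ltnW ij); have := q0 i; lra.
set S := [set u i - 2 * c / 2 ^+ i | i in [set: nat]].
have S0 : S !=set0 by exists (u 0%N - 2 * c / 2 ^+ 0); exists 0%N.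
have hS : has_sup S.
  split=> //; exists (u 0%N + 2 * c / 2 ^+ 0) => _ [i _ <-]; exact: ub.
have lo : u n - 2 * c / 2 ^+ n <= sup S by apply: sup_upper_bound => //; exists n.
have hi : sup S <= u n + 2 * c / 2 ^+ n.
  by apply: ge_sup => // _ [i _ <-]; exact: ub.
by rewrite ler_norml; lra.
Qed.

(** Completeness is replaced by the pointwise limits of [telescoped_limit], and closedness of [K]
    under weighted uniform limits is a hypothesis. The weight [om] is exponential for the initial
    value problem and 1 for the nonlinear problem. Values outside [D] are arbitrary, so the fixed
    point equation holds on [D] only. *)
Lemma contraction_fixpoint (X : Type) (D : X -> Prop) (om : X -> R)
    (K : (X -> R) -> Prop) (T : (X -> R) -> X -> R) (y0 : X -> R) (c0 : R) :
  (forall x, D x -> 0 <= om x) -> K y0 -> 0 <= c0 ->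
  (forall y, K y -> K (T y)) ->
  (forall x, D x -> `|T y0 x - y0 x| <= c0 * om x) ->
  (forall y z c, K y -> K z -> 0 <= c ->
     (forall x, D x -> `|y x - z x| <= c * om x) ->
     forall x, D x -> `|T y x - T z x| <= c / 2 * om x) ->
  (forall y, (forall eps, 0 < eps -> exists2 z, K z &
     forall x, D x -> `|z x - y x| <= eps * om x) -> K y) ->
  exists2 y, K y & forall x, D x -> T y x = y x.
Proof.
move=> om0 Ky0 c00 KT T0 TC Kcl.
pose s n := iter n T y0.
have Ks n : K (s n) by elim: n => [//|n IH]; exact: KT.
have inc n : forall x, D x -> `|s n.+1 x - s n x| <= c0 / 2 ^+ n * om x.
  elim: n => [|n IH] x Dx; first by rewrite expr0 divr1; exact: T0.
  have := TC (s n.+1) (s n) (c0 / 2 ^+ n) (Ks _) (Ks _) _ IH x Dx.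
  rewrite exprSr invfM mulrA; apply.
  by rewrite divr_ge0// exprn_ge0.
pose y x := sup (range (fun n => s n x - 2 * (c0 * om x) / 2 ^+ n)).
have ys n x : D x -> `|y x - s n x| <= 2 * c0 / 2 ^+ n * om x.
  move=> Dx; apply: (@le_trans _ _ (2 * (c0 * om x) / 2 ^+ n)).
    apply: (@telescoped_limit (fun n => s n x) (c0 * om x)) => i.
    by apply: (le_trans (inc i x Dx)); rewrite mulrAC.
  rewrite le_eqVlt; apply/orP; left; apply/eqP; ring.
have Ky : K y.
  apply: Kcl => eps e0; have [n hn] := geometric_small (2 * c0) e0.
  exists (s n) => // x Dx; rewrite distrC (le_trans (ys n x Dx))//.
  by rewrite ler_wpM2r// om0.
exists y => // x Dx; apply/eqP; rewrite -subr_eq0; apply/eqP.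
apply: (@geometric_eq0 (2 * c0 * om x)) => n.
have p0 : 0 <= 2 * c0 / 2 ^+ n by rewrite divr_ge0 ?mulr_ge0// exprn_ge0.
have h1 := TC y (s n) _ Ky (Ks n) p0 (ys n) x Dx.
have h2 := ys n.+1 x Dx.
have -> : T y x - y x = (T y x - s n.+1 x) - (y x - s n.+1 x) by ring.
rewrite (le_trans (ler_normB _ _))// (le_trans (lerD h1 h2))//.
rewrite le_eqVlt; apply/orP; left; apply/eqP.
by rewrite exprS; field; rewrite expf_neq0.
Qed.

Lemma C0_uniform_limit a b (f : R -> R) :
  (forall eps, 0 < eps -> exists2 g, C0 a b g &
     forall x, a <= x <= b -> `|g x - f x| <= eps) -> C0 a b f.
Proof.
move=> H; apply/subspace_continuousP => x xab.
have xab' : a <= x <= b by move: xab; rewrite /= in_itv.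
apply/cvgrPdist_le => eps e0.
have e3 : 0 < eps / 3 by rewrite divr_gt0.
have [g cg gf] := H _ e3.
have /cvgrPdist_le/(_ _ e3) := (subspace_continuousP _ _).1 cg x xab.
move=> N; near=> y.
have yab : a <= y <= b.
  have : `[a, b]%classic y by near: y; exact: withinT.
  by rewrite /= in_itv.
have h1 := gf x xab'; have h2 := gf y yab.
have h3 : `|g x - g y| <= eps / 3 by near: y.
have -> : f x - f y = - (g x - f x) + (g x - g y) + (g y - f y) by ring.
rewrite (le_trans (ler_normD _ _))//.
have h4 := ler_normD (- (g x - f x)) (g x - g y); rewrite normrN in h4.
lra.
Unshelve. all: by end_near. Qed.

End FixedPoint.

(** * Initial value problems *)

Section InitialValue.
Context {R : realType}.
Notation mu := (@lebesgue_measure R).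
Implicit Types (L a x t k lam B : R) (l n m i j : nat) (f g h u v : R -> R)
  (w : nat -> R -> R) (c : nat -> R).

(** Integration gains a factor 1 / lam on the weight; this offsets the Lipschitz constant whatever
    the length L. *)
Lemma J_expR lam x : 0 < lam -> 0 <= x ->
  J 0 x (fun t => expR (lam * t)) <= expR (lam * x) / lam.
Proof.
move=> l0 x0.
have D t : is_derive t (1 : R) (fun s => expR (lam * s)) (lam * expR (lam * t)).
  by apply: is_derive_eq; rewrite mulrC /GRing.scale /= mulr1.
have E : (fun s => expR (lam * s))^`()%classic = (fun t => lam * expR (lam * t)).
  by apply/funext => t; rewrite derive1E; exact: derive_val.
have ce : continuous (fun t => expR (lam * t)).
  move=> t; apply: differentiable_continuous; apply/derivable1_diffP.
  by have [] := D t.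
have cE : continuous (fun t => lam * expR (lam * t)).
  move=> t; apply: (@continuousM _ R (cst lam) (fun t => expR (lam * t))); last exact: ce.
  exact: cst_continuous.
have Hd : forall t, derivable (fun s => expR (lam * s)) t 1.
  by move=> t; have [] := D t.
have := @AC_C1 R x _ Hd; rewrite E => /(_ cE) A.
have := AC_total x0 A; rewrite JZ; last first.
  by apply: C0_L1; exact: continuous_subspaceT.
rewrite mulr0 expR0 => H.
rewrite ler_pdivlMr// mulrC H; lra.
Qed.

(* Picard iteration for w' = (w_1, .., w_m, h + Phi w), a contraction for the
   sup norm weighted by exp (- 2 (1 + B) x). *)
Lemma initial_value L m B (Phi : (nat -> R) -> R) h c : 0 < L -> 0 <= B ->
  (forall p q k, 0 <= k -> (forall i, (i <= m)%N -> `|p i - q i| <= k) ->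
     `|Phi p - Phi q| <= B * k) ->
  (forall w, (forall i, (i <= m)%N -> C0 0 L (w i)) ->
     C0 0 L (fun x => Phi (w ^~ x))) ->
  L1 0 L h ->
  exists w, [/\ forall i, (i <= m)%N -> w i 0 = c i,
    forall i, (i <= m)%N -> AC 0 L (w i) (w i.+1) &
    forall x, w m.+1 x = h x + Phi (w ^~ x)].
Proof.
move=> L0 B0 Plip Pcont Lh.
(* The vector of unknowns is coded as a single function of index and point, to fit
   [contraction_fixpoint]. *)
pose X := (nat * R)%type.
pose D (p : X) := (p.1 <= m)%N /\ 0 <= p.2 <= L.
pose lam := 2 * (1 + B).
have lam0 : 0 < lam by rewrite /lam; lra.
pose om (p : X) := expR (lam * p.2).
pose K (y : X -> R) := forall i, (i <= m)%N -> C0 0 L (fun x => y (i, x)).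
pose G (y : X -> R) i t :=
  if i == m then h t + Phi (fun j => y (j, t)) else y (i.+1, t).
pose T (y : X -> R) (p : X) := c p.1 + J 0 p.2 (G y p.1).
have GL y i : K y -> (i <= m)%N -> L1 0 L (G y i).
  move=> Ky im; rewrite /G; case: eqP => iE.
    by apply: L1D => //; exact/C0_L1/(Pcont (fun j x => y (j, x)))/Ky.
  by apply/C0_L1/Ky; rewrite ltn_neqAle im andbT; exact/eqP.
have TA y i : K y -> (i <= m)%N -> AC 0 L (fun x => T y (i, x)) (G y i).
  by move=> Ky im; exact: (@AC_J R 0 L (G y i) (c i) (GL y i Ky im)).
have KT y : K y -> K (T y).
  by move=> Ky i im; exact: AC_C0 (ltW L0) (TA y i Ky im).
pose y0 : X -> R := fun=> 0.
have Ky0 : K y0 by move=> i _; exact: C0_cst.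
have om1 p : D p -> 1 <= om p.
  move=> [_ /andP[p0 _]]; rewrite /om (le_trans _ (expR_ge1Dx _))//.
  by rewrite lerDl mulr_ge0// ltW.
have LG0 i : (i <= m)%N -> J 0 L (fun t => `|G y0 i t|) <=
    J 0 L (fun t => `|h t|) + `|Phi (fun=> 0)| * L.
  move=> im; rewrite -[X in _ * X]subr0 -(@Jcst _ 0 L)//; last exact: ltW.
  have c1 : L1 0 L (fun=> `|Phi (fun=> 0)|) by exact/C0_L1/C0_cst.
  rewrite -JD//; last exact: L1_abs.
  apply: Jle; [exact/L1_abs/GL|apply: L1D => //; exact: L1_abs|].
  move=> t _; rewrite /G; case: eqP => _; first exact: ler_normD.
  by rewrite normr0 addr_ge0.
pose c0 := \sum_(i < m.+1) `|c i| + (J 0 L (fun t => `|h t|) + `|Phi (fun=> 0)| * L).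
have c00 : 0 <= c0.
  rewrite addr_ge0 ?sumr_ge0// addr_ge0 ?mulr_ge0 ?(ltW L0)//.
  exact: Jge0.
have [||||y Ky fy] := @contraction_fixpoint R X D om K T y0 c0 _ Ky0 c00 KT.
- by move=> p _; exact: expR_ge0.
- move=> [i x] Dp; have [/= im /andP[x0 xL]] := Dp.
  rewrite /y0 subr0 /T /=.
  apply: (@le_trans _ _ c0); last by rewrite ler_peMr// om1.
  rewrite (le_trans (ler_normD _ _))// lerD//.
    by rewrite (bigD1 (Ordinal (im : (i < m.+1)%N)))//= lerDl sumr_ge0.
  apply: le_trans (LG0 i im).
  apply: (le_trans (Jabs (L1_sub (lexx 0) xL (GL _ _ Ky0 im)))).
  by apply: Jmono => //; exact/L1_abs/GL.
- move=> y z k Ky Kz k0 yz [i x] Dp; have [/= im /andP[x0 xL]] := Dp.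
  rewrite /T /=.
  have Ly := L1_sub (lexx 0) xL (GL _ _ Ky im).
  have Lz := L1_sub (lexx 0) xL (GL _ _ Kz im).
  have -> : c i + J 0 x (G y i) - (c i + J 0 x (G z i)) =
    J 0 x (fun t => G y i t - G z i t) by rewrite JB//; ring.
  have Le q : L1 0 x (fun t => q * expR (lam * t)).
    apply/L1Z/C0_L1; apply: continuous_subspaceT => t.
    apply: continuous_comp; last exact: continuous_expR.
    apply: (@continuousM _ R (cst lam) id); first exact: cst_continuous.
    exact: cvg_id.
  have LL : L1 0 x (fun t => G y i t - G z i t) by exact: L1B.
  apply: (le_trans (Jabs LL)).
  apply: (@le_trans _ _ (J 0 x (fun t => ((1 + B) * k) * expR (lam * t)))).
    apply: Jle; [exact: L1_abs|exact: Le|].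
    move=> t /andP[t0 tx]; have tL := le_trans tx xL.
    have e0 := expR_ge0 (lam * t).
    rewrite /G; case: eqP => [_|ni].
      have -> : h t + Phi (fun j => y (j, t)) - (h t + Phi (fun j => z (j, t))) =
        Phi (fun j => y (j, t)) - Phi (fun j => z (j, t)) by ring.
      apply: (@le_trans _ _ (B * (k * expR (lam * t)))).
        apply: Plip; first exact: mulr_ge0.
        by move=> j jm; apply: (yz (j, t)); split=> //=; rewrite t0.
      by rewrite -mulrA ler_wpM2r ?mulr_ge0// lerDr.
    apply: (@le_trans _ _ (k * expR (lam * t))).
      apply: (yz (i.+1, t)); split=> /=; last by rewrite t0.
      by rewrite ltn_neqAle im andbT; exact/eqP.
    by rewrite -mulrA ler_peMl ?mulr_ge0// lerDl.
  have E := J_expR lam0 x0.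
  have Le1 : L1 0 x (fun t => expR (lam * t)).
    by apply: L1_eq (Le 1) => t _; rewrite mul1r.
  rewrite JZ//.
  have p1 : 0 <= (1 + B) * k by rewrite mulr_ge0// addr_ge0.
  apply: (le_trans (ler_wpM2l p1 E)); rewrite /om /= le_eqVlt; apply/orP; left.
  by apply/eqP; rewrite /lam; field; apply/eqP; lra.
- move=> y H i im; apply: C0_uniform_limit => eps e0.
  have eL : 0 < eps / expR (lam * L) by rewrite divr_gt0// expR_gt0.
  have [z Kz zy] := H _ eL.
  exists (fun x => z (i, x)); first exact: Kz.
  move=> x /andP[x0 xL].
  have := zy (i, x); rewrite /D /= x0 xL => /(_ (conj im isT)) h1.
  apply: (le_trans h1); rewrite mulrAC ler_pdivrMr ?expR_gt0//.
  by rewrite ler_pM2l// ler_expR ler_pM2l.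
(* [T y] is taken rather than [y]: it is an integral, hence absolutely continuous, and [y] is only
   known to agree with it on [D]. *)
pose w i x := if (i <= m)%N then T y (i, x) else h x + Phi (fun j => T y (j, x)).
have wG i x : (i <= m)%N -> 0 <= x <= L -> w i.+1 x = G y i x.
  move=> im xL; rewrite /w /G; case: eqP => [->|ni].
    rewrite ltnn; congr (_ + _); apply/eqP; rewrite -subr_eq0 -normr_le0.
    (* With k = 0 the Lipschitz condition says that [Phi] depends only on the coordinates up to
       [m]. *)
    rewrite -(mulr0 B); apply: Plip => // j jm.
    by rewrite (fy (j, x))// subrr normr0.
  have i1 : (i < m)%N by rewrite ltn_neqAle im andbT; exact/eqP.
  by rewrite i1 (fy (i.+1, x)).
exists w; split.
- by move=> i im; rewrite /w im /T /= Jaa addr0.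
- move=> i im; apply: (AC_eq (ltW L0) (u := fun x => T y (i, x)) (v := G y i)).
  + by move=> x _; rewrite /w im.
  + by apply: L1_meas; apply: L1_eq (GL y i Ky im) => x xL; rewrite wG.
  + by apply: aeq_eq => x xL; rewrite wG.
  + exact: TA.
- move=> x; rewrite {1}/w ltnn; congr (_ + _).
  apply/eqP; rewrite -subr_eq0 -normr_le0.
  rewrite -(mulr0 B); apply: Plip => // j jm.
  by rewrite /w jm subrr normr0.
Qed.

End InitialValue.

(** * Boundary conditions by superposition *)

Section LinearExistence.
Context {R : realType}.
Notation mu := (@lebesgue_measure R).
Implicit Types (L a x t k B : R) (l n m i j r : nat) (f g h u : R -> R)
  (w v : nat -> R -> R) (c : nat -> R).

Lemma chain_lin L n w v k : chain L n w -> chain L n v ->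
  chain L n (fun i x => w i x + k * v i x).
Proof.
move=> [aw sw] [av sv]; split; last by apply: sqD => //; exact: sqZ.
by move=> i iN; apply: ACD; [exact: aw|apply: ACZ; exact: av].
Qed.

Lemma chain0 L n : chain L n (fun _ _ => 0 : R).
Proof. by split=> [i _|]; [exact: AC_cst|exact/C0_sq/C0_cst]. Qed.

Lemma chain_sum L n m (om : nat -> nat -> R -> R) (k : nat -> R) :
  (forall r, (r < m)%N -> chain L n (om r)) ->
  chain L n (fun i x => \sum_(0 <= r < m) k r * om r i x).
Proof.
elim: m => [|m IH] H.
  have -> : (fun i x => \sum_(0 <= r < 0) k r * om r i x) = (fun _ _ => 0).
    by apply/funext => i; apply/funext => x; rewrite big_geq.
  exact: chain0.
have -> : (fun i x => \sum_(0 <= r < m.+1) k r * om r i x) =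
   (fun i x => \sum_(0 <= r < m) k r * om r i x + k m * om m i x).
  by apply/funext => i; apply/funext => x; rewrite big_nat_recr.
apply: chain_lin; last exact: H.
by apply: IH => r rm; apply: H; exact: ltnW.
Qed.

Lemma lin_op_lin a l w v k x :
  lin_op a l (fun i x => w i x + k * v i x) x =
  lin_op a l w x + k * lin_op a l v x.
Proof.
rewrite /lin_op [k * (_ + _)]mulrDr mulr_sumr addrACA -big_split /=; congr (_ + _).
  by ring.
by apply: eq_bigr => j _; ring.
Qed.

Lemma lin_op_sum a l m (om : nat -> nat -> R -> R) (k : nat -> R) x :
  lin_op a l (fun i x => \sum_(0 <= r < m) k r * om r i x) x =
  \sum_(0 <= r < m) k r * lin_op a l (om r) x.
Proof.
elim: m => [|m IH].
  rewrite big_geq// /lin_op big_geq// mulr0 add0r big1// => j _.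
  by rewrite big_geq// mulr0.
have -> : (fun i x => \sum_(0 <= r < m.+1) k r * om r i x) =
   (fun i x => \sum_(0 <= r < m) k r * om r i x + k m * om m i x).
  by apply/funext => i; apply/funext => y; rewrite big_nat_recr.
by rewrite lin_op_lin IH big_nat_recr.
Qed.

Lemma lin_bvp_diff a L l w v h g : lin_bvp a L l w h -> lin_bvp a L l v g ->
  lin_bvp a L l (fun i x => w i x - v i x) (fun x => h x - g x).
Proof.
move=> [cw [bw wL] ew] [cv [bv vL] ev].
have E : (fun i x => w i x - v i x) = (fun i x => w i x + (-1) * v i x).
  by apply/funext => i; apply/funext => x; rewrite mulN1r.
rewrite E; split; first exact: chain_lin.
  split; last by rewrite wL vL; ring.
  by move=> i il; have [-> ->] := bw i il; have [-> ->] := bv i il; split; ring.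
have FF := ae_filter_ringOfSetsType mu.
have := ae_and ew ev; apply: filterS => x [h1 h2] xi.
by rewrite lin_op_lin h1// h2// mulN1r.
Qed.

Lemma lin_initial_value a L l c h : 0 < a -> 0 < L -> (0 < l)%N ->
  sqint 0 L h ->
  exists w, [/\ chain L (2 * l + 1) w,
    forall i, (i <= 2 * l)%N -> w i 0 = c i &
    forall x, lin_op a l w x = h x].
Proof.
move=> a0 L0 l0 sh.
(* The coefficient of the top derivative; being its own inverse, it also solves the equation for
   that derivative. *)
pose s : R := (-1) ^+ (l + 1).
have S : s * s = 1 by rewrite /s -exprMn mulrNN mulr1 expr1n.
pose E (p : nat -> R) := a * p 0%N + \sum_(1 <= j < l) (-1) ^+ (j + 1) * p (2 * j + 1)%N.
pose Phi (p : nat -> R) := - s * E p.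
have n1 j (y : R) : `|(-1) ^+ j * y| = `|y|.
  by rewrite normrM normrX normrN1 expr1n mul1r.
have [||||w [w0 aw we]] := @initial_value R L (2 * l) (a + l%:R) Phi
    (fun x => s * h x) c L0.
- by rewrite addr_ge0// ltW.
- move=> p q k k0 pq; rewrite /Phi -mulrBr normrM normrN.
  have -> : `|s| = 1 by rewrite /s normrX normrN1 expr1n.
  rewrite mul1r /E opprD addrACA -mulrBr -sumrB.
  rewrite (le_trans (ler_normD _ _))// mulrDl; apply: lerD.
    by rewrite normrM (gtr0_norm a0) ler_pM2l//; exact: pq.
  apply: (le_trans (ler_norm_sum _ _ _)).
  apply: (@le_trans _ _ (\sum_(1 <= j < l) k)).
    apply: ler_sum_nat => j jl; rewrite -mulrBr n1; apply: pq; nlia.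
  rewrite big_const_nat iter_addr addr0 -[k *+ _]mulr_natl ler_wpM2r// ler_nat.
  by nlia.
- move=> w cw; apply: C0Z; apply: C0D; first by apply: C0Z; exact: cw.
  have K m : (m <= l)%N ->
      C0 0 L (fun x => \sum_(1 <= j < m) (-1) ^+ (j + 1) * w (2 * j + 1)%N x).
    elim: m => [|m IH] ml.
      apply: C0_eq (@C0_cst _ 0 L 0) => x _; by rewrite big_geq.
    case: m IH ml => [|m] IH ml.
      apply: C0_eq (@C0_cst _ 0 L 0) => x _; by rewrite big_geq.
    have -> : (fun x => \sum_(1 <= j < m.+2) (-1) ^+ (j + 1) * w (2 * j + 1)%N x) =
      (fun x => \sum_(1 <= j < m.+1) (-1) ^+ (j + 1) * w (2 * j + 1)%N x +
        (-1) ^+ (m.+1 + 1) * w (2 * m.+1 + 1)%N x).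
      by apply/funext => x; rewrite big_nat_recr.
    apply: C0D; first by apply: IH; exact: ltnW.
    by apply: C0Z; apply: cw; nlia.
  exact: K.
- exact/L1Z/sq_L1.
exists w.
have wn x : w (2 * l + 1)%N x = s * (h x - E (w ^~ x)).
  by rewrite addn1 we /Phi; ring.
have cw : chain L (2 * l + 1) w.
  split; first by move=> i il; apply: aw; nlia.
  have -> : w (2 * l + 1)%N = (fun x => s * (h x - E (w ^~ x))).
    by apply/funext => x; exact: wn.
  have cC i : (i <= 2 * l)%N -> C0 0 L (w i).
    by move=> il; apply: (AC_C0 (ltW L0)); apply: aw.
  apply: sqZ; apply: sqB => //; apply: sqD; first by apply/sqZ/C0_sq/cC.
  apply: (@sq_sum _ 0 L (index_iota 1 l)
    (fun j x => (-1) ^+ (j + 1) * w (2 * j + 1)%N x)) => j.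
  rewrite mem_index_iota => jl; apply/sqZ/C0_sq/cC; nlia.
split=> // x.
rewrite /lin_op big_nat_recr//= wn /E -/s; ring: S.
Qed.

Lemma lin_existence a L l h : 0 < a -> 0 < L -> (0 < l)%N -> sqint 0 L h ->
  exists w, lin_bvp a L l w h.
Proof.
move=> a0 L0 l0 sh.
have s0 : sqint 0 L (fun=> 0 : R) by exact/C0_sq/C0_cst.
(* Numbers the 2 l + 1 conditions: indices below l give orders 0 to l - 1 at 0, indices l to 2 l
   give orders 0 to l at L. *)
pose bc i w := if (i < l)%N then w i 0 else w (i - l)%N L.
have bcP w : (forall i, (i < (2 * l).+1)%N -> bc i w = 0) -> boundary L l w.
  move=> H; split; last first.
    have := H (2 * l)%N (leqnn _); rewrite /bc.
    have -> : (2 * l < l)%N = false by nlia.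
    by have -> : (2 * l - l = l)%N by nlia.
  move=> i il; split.
    by have := H i ltac:(nlia); rewrite /bc il.
  have := H (i + l)%N ltac:(nlia); rewrite /bc.
  have -> : (i + l < l)%N = false by nlia.
  by rewrite addnK.
have bc_lin i w v k : bc i (fun i x => w i x + k * v i x) = bc i w + k * bc i v.
  by rewrite /bc; case: ifP.
have bc_sum i m (om : nat -> nat -> R -> R) (k : nat -> R) :
    bc i (fun i x => \sum_(0 <= r < m) k r * om r i x) =
    \sum_(0 <= r < m) k r * bc i (om r).
  by rewrite /bc; case: ifP.
(* A fundamental system: homogeneous solutions with unit vectors as initial data. *)
have Hom r : exists w, [/\ chain L (2 * l + 1) w,
    forall i, (i <= 2 * l)%N -> w i 0 = (i == r)%:R &
    forall x, lin_op a l w x = 0].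
  exact: (@lin_initial_value a L l (fun i => (i == r)%:R) (fun=> 0)).
have [om omP] := choice Hom.
have omc (k : nat -> R) : chain L (2 * l + 1)
    (fun i x => \sum_(0 <= r < (2 * l).+1) k r * om r i x).
  by apply: chain_sum => r _; have [] := omP r.
have ome (k : nat -> R) x :
    lin_op a l (fun i x => \sum_(0 <= r < (2 * l).+1) k r * om r i x) x = 0.
  rewrite lin_op_sum big1// => r _; have [_ _ ->] := omP r; exact: mulr0.
have sumE (z : 'rV[R]_((2 * l).+1)) (F : nat -> R) :
    \sum_(0 <= r < (2 * l).+1) z 0 (inord r) * F r = \sum_r z 0 r * F r.
  by rewrite big_mkord; apply: eq_bigr => r _; rewrite inord_val.
pose A : 'M[R]_((2 * l).+1) := \matrix_(r, i) bc i (om r).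
(* A vector in the kernel gives a combination [W] that solves the homogeneous boundary value
   problem, so the estimate makes it zero; the initial values of [W] are the entries of that
   vector. *)
have Au : A \in unitmx.
  rewrite -row_free_unit; apply: inj_row_free => z zA.
  pose W i x := \sum_(0 <= r < (2 * l).+1) z 0 (inord r) * om r i x.
  have WL : lin_bvp a L l W (fun=> 0).
    split; first exact: omc.
      apply: bcP => i il.
      rewrite bc_sum (sumE z (fun r => bc i (om r))).
      have := congr1 (fun B : 'rV_ _ => B 0 (Ordinal il)) zA.
      rewrite [LHS]mxE [RHS]mxE => E; rewrite -[RHS]E.
      by apply: eq_bigr => r _; rewrite [A _ _]mxE.
    by apply: aeq_eq => x _; exact: ome.
  have [C C0' HC] := lin_estimate a0 L0 l0.
  have [WC _] := HC W _ s0 WL.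
  have n0 : nrm 0 L (fun=> 0 : R) = 0.
    rewrite /nrm (Jeq (g := fun=> 0)); last by move=> x _; rewrite expr0n.
    by rewrite Jcst ?ltW// mul0r sqrtr0.
  apply/rowP => i; rewrite mxE.
  have il : (i <= 2 * l)%N by rewrite -ltnS ltn_ord.
  have := WC i il 0; rewrite n0 mulr0 lexx ltW// => /(_ isT).
  rewrite normr_le0 /W (sumE z (fun r => om r i 0)) => /eqP <-.
  rewrite (bigD1 i)//= big1.
    have [_ -> //] := omP i; by rewrite eqxx mulr1 addr0.
  move=> r ri; have [_ -> //] := omP r.
  by rewrite eq_sym (negbTE ri : (r == i :> nat) = false) mulr0.
have [w0 [cw0 _ ew0]] := @lin_initial_value a L l (fun=> 0) h a0 L0 l0 sh.
(* The homogeneous part is chosen to cancel the boundary values of the particular solution [w0]. *)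
pose z : 'rV[R]_((2 * l).+1) := - (\row_i bc i w0) *m invmx A.
pose W i x := \sum_(0 <= r < (2 * l).+1) z 0 (inord r) * om r i x.
exists (fun i x => w0 i x + 1 * W i x); split.
- by apply: chain_lin => //; exact: omc.
- apply: bcP => i il; rewrite bc_lin mul1r bc_sum (sumE z (fun r => bc i (om r))).
  have zA : z *m A = - (\row_i bc i w0) by rewrite /z mulmxKV.
  have := congr1 (fun B : 'rV_ _ => B 0 (Ordinal il)) zA.
  rewrite [LHS]mxE [RHS]mxE mxE /= => E; apply/eqP; rewrite addrC addr_eq0 -E; apply/eqP.
  by apply: eq_bigr => r _; rewrite [A _ _]mxE.
- by apply: aeq_eq => x _; rewrite lin_op_lin ew0 ome mulr0 addr0.
Qed.

End LinearExistence.

(** * The nonlinear problem *)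

Section NonlinearEstimates.
Context {R : realType}.
Notation mu := (@lebesgue_measure R).
Implicit Types (L a x t r d H S : R) (l k n i j : nat) (f g h u : R -> R)
  (w v z : nat -> R -> R).

Lemma AC_pow L u u' n : 0 < L -> AC 0 L u u' ->
  AC 0 L (fun x => u x ^+ n.+1) (fun x => n.+1%:R * (u x ^+ n * u' x)).
Proof.
move=> L0 uu; elim: n => [|n IH].
  have -> : (fun x => 1%:R * (u x ^+ 0 * u' x)) = u'.
    by apply/funext => x; rewrite expr0 !mul1r.
  by have -> : (fun x => u x ^+ 1) = u by apply/funext => x; rewrite expr1.
have := ACM (ltW L0) uu IH.
have -> : (fun x => u x * u x ^+ n.+1) = (fun x => u x ^+ n.+2).
  by apply/funext => x; rewrite -exprS.
have -> // : (fun x => u' x * u x ^+ n.+1 + u x * (n.+1%:R * (u x ^+ n * u' x))) =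
  (fun x => n.+2%:R * (u x ^+ n.+1 * u' x)).
by apply/funext => x; rewrite -[n.+2%:R]natr1 [u x ^+ n.+1]exprS; ring.
Qed.

(** Replacing the k + 1 factors one at a time costs r^k d each. The factor [q] is kept apart so that
    the bound applies to u^k Du, and with [q = p] to powers. *)
Lemma monomial_lipschitz k r d (p q p' q' : R) : 0 <= r ->
  `|p| <= r -> `|q'| <= r -> `|p'| <= r ->
  `|p - p'| <= d -> `|q - q'| <= d ->
  `|p ^+ k * q - p' ^+ k * q'| <= k.+1%:R * r ^+ k * d.
Proof.
move=> r0 pr qr pr' pd qd.
have d0 : 0 <= d := le_trans (normr_ge0 _) pd.
elim: k => [|k IH]; first by rewrite !expr0 !mul1r.
have -> : p ^+ k.+1 * q - p' ^+ k.+1 * q' =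
   p * (p ^+ k * q - p' ^+ k * q') + (p - p') * (p' ^+ k * q').
  by rewrite !exprS; ring.
rewrite (le_trans (ler_normD _ _))// !normrM normrX.
have -> : k.+2%:R * r ^+ k.+1 * d = r * (k.+1%:R * r ^+ k * d) + d * (r ^+ k * r).
  by rewrite -[k.+2%:R]natr1 exprS; ring.
apply: lerD; first exact: ler_pM.
apply: ler_pM => //.
by apply: ler_pM => //; rewrite lerXn2r ?nnegrE.
Qed.

Lemma pow_lipschitz k r (p p' : R) : 0 <= r -> `|p| <= r -> `|p'| <= r ->
  `|p ^+ k.+1 - p' ^+ k.+1| <= k.+1%:R * r ^+ k * `|p - p'|.
Proof.
move=> r0 pr pr'; rewrite !exprSr.
exact: monomial_lipschitz.
Qed.

Lemma bvp_C0 a L l w h i : 0 < L -> lin_bvp a L l w h -> (i <= 2 * l)%N ->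
  C0 0 L (w i).
Proof. by move=> L0 [cw _ _] il; apply: (chain_C0 L0 cw); nlia. Qed.

Lemma bvp_AC a L l w h i : lin_bvp a L l w h -> (i <= 2 * l)%N ->
  AC 0 L (w i) (w i.+1).
Proof. by move=> [[aw _] _ _] il; apply: aw; nlia. Qed.

(** * A priori bounds for an arbitrary solution *)

Section OneSolution.
Context (a L : R) (l k : nat) (f : R -> R) (w : nat -> R -> R).
Hypotheses (a0 : 0 < a) (L0 : 0 < L) (l0 : (0 < l)%N) (k4 : (k <= 4 * l)%N).
Hypotheses (sf : sqint 0 L f)
  (ww : lin_bvp a L l w (fun x => f x - w 0 x ^+ k * w 1 x)).
Let n i := nrm 0 L (w i).
Let F := nrm 0 L f.

Let c0 : C0 0 L (w 0). Proof. by apply: (bvp_C0 L0 ww); nlia. Qed.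
Let c1 : C0 0 L (w 1%N). Proof. by apply: (bvp_C0 L0 ww); nlia. Qed.
Let a01 : AC 0 L (w 0) (w 1%N). Proof. by apply: (bvp_AC ww); nlia. Qed.
Let w00 : w 0 0 = 0. Proof. by have [_ [bw _] _] := ww; case: (bw 0%N l0). Qed.
Let w0L : w 0 L = 0. Proof. by have [_ [bw _] _] := ww; case: (bw 0%N l0). Qed.
Let sN : sqint 0 L (fun x => w 0 x ^+ k * w 1%N x).
Proof. by apply: C0_sq; apply: C0M => //; exact: C0X. Qed.
Let mh : measurable_fun `[0, L] (fun x => f x - w 0 x ^+ k * w 1%N x).
Proof. by apply: sq_meas; exact: sqB. Qed.

Lemma mass_bound : n 0 <= F / a.
Proof.
have := energy_mass L0 ww mh.
have Lp : L1 0 L (fun x => w 0 x * f x) by apply: L1M_C0 => //; exact: sq_L1.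
have cP : C0 0 L (fun x => w 0 x ^+ k.+1 * w 1%N x) by apply: C0M => //; exact: C0X.
have -> : J 0 L (fun x => w 0 x * (f x - w 0 x ^+ k * w 1 x)) = J 0 L (fun x => w 0 x * f x).
  transitivity (J 0 L (fun x => w 0 x * f x) - J 0 L (fun x => w 0 x ^+ k.+1 * w 1%N x)).
    rewrite -JB//; last exact: C0_L1.
    by apply: Jeq => x _; rewrite exprS; ring.
  have := AC_total (ltW L0) (AC_pow k.+1 L0 a01).
  rewrite w00 w0L !expr0n /= subrr JZ; last exact: C0_L1.
  move=> /eqP; rewrite mulf_eq0 pnatr_eq0 /= => /eqP->.
  by rewrite subr0.
move=> h1.
have CS := le_trans (ler_norm _) (Cauchy_Schwarz (C0_sq c0) sf).
have h2 := le_trans h1 CS; rewrite -/(n 0) -/F in h2.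
have n00 : 0 <= n 0 by exact: nrm_ge0.
rewrite ler_pdivlMr// mulrC.
move: n00; rewrite le_eqVlt => /orP[/eqP <-|np].
  by rewrite mulr0; exact: nrm_ge0.
by rewrite -(ler_pM2l np) (le_trans _ h2)// le_eqVlt; apply/orP; left; apply/eqP; ring.
Qed.

(** Against (1 + x) u, the term u^k Du integrates by parts to minus the integral of u^(k+2) / (k +
    2), since u vanishes at both ends; that integral is at most S^k times the squared norm of u. *)
Lemma smoothing_bound S j : (1 <= j <= l)%N -> bounded_by L (w 0) S -> 0 <= S ->
  a * n 0 ^+ 2 + 3 / 2 * n j ^+ 2 <= (1 + L) * n 0 * F + S ^+ k * n 0 ^+ 2.
Proof.
move=> jl wS S0.
apply: (le_trans (energy_weighted L0 a0 ww mh jl)).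
have c1x : C0 0 L (fun x => 1 + x) by apply: C0D; [exact: C0_cst|exact: C0_id].
have [sg ng] := @nrm_mul_bnd _ 0 L (w 0) (fun x => 1 + x) (1 + L)
  (addr_ge0 ler01 (ltW L0)) (C0_meas c1x) (C0_sq c0)
  ltac:(by move=> x xL; rewrite ger0_norm; lra).
have Lp : L1 0 L (fun x => (1 + x) * w 0 x * f x) by exact: sqM_L1.
have cP : C0 0 L (fun x => (1 + x) * (w 0 x ^+ k.+1 * w 1%N x)).
  by apply: C0M => //; apply: C0M => //; exact: C0X.
have cQ : C0 0 L (fun x => w 0 x ^+ k.+2) by exact: C0X.
have -> : J 0 L (fun x => (1 + x) * (w 0 x * (f x - w 0 x ^+ k * w 1 x))) =
   J 0 L (fun x => (1 + x) * w 0 x * f x) -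
   J 0 L (fun x => (1 + x) * (w 0 x ^+ k.+1 * w 1%N x)).
  rewrite -JB//; last exact: C0_L1.
  by apply: Jeq => x _; rewrite exprS; ring.
have CS := le_trans (ler_norm _) (Cauchy_Schwarz sg sf).
have h1 : J 0 L (fun x => (1 + x) * w 0 x * f x) <= (1 + L) * n 0 * F.
  by apply: (le_trans CS); rewrite ler_wpM2r ?nrm_ge0.
have E : k.+2%:R * J 0 L (fun x => (1 + x) * (w 0 x ^+ k.+1 * w 1%N x)) =
   - J 0 L (fun x => w 0 x ^+ k.+2).
  have A1 := ACM (ltW L0) (ACD (AC_cst 0 L 1) (AC_id 0 L)) (AC_pow k.+1 L0 a01).
  have := AC_total (ltW L0) A1; rewrite w00 w0L !expr0n /= !mulr0 subrr.
  rewrite JD.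
  - rewrite (Jeq (g := fun x => w 0 x ^+ k.+2)); last by move=> x _; rewrite add0r mul1r.
    rewrite [X in _ + X](Jeq (g := fun x => k.+2%:R * ((1 + x) * (w 0 x ^+ k.+1 * w 1%N x)))).
      by rewrite JZ ?C0_L1// => /eqP; rewrite addrC addr_eq0 => /eqP.
    by move=> x _; ring.
  - by apply: L1_eq (C0_L1 cQ) => x _; rewrite add0r mul1r.
  - by apply: L1_eq (L1Z k.+2%:R (C0_L1 cP)) => x _; ring.
have B : J 0 L (fun x => w 0 x ^+ k.+2) <= S ^+ k * n 0 ^+ 2.
  rewrite nrm_sq -JZ; last by apply: C0_L1; exact: C0X.
  apply: Jle; [exact: C0_L1|by apply/L1Z/C0_L1; exact: C0X|].
  move=> x xL; rewrite -addn2 exprD ler_wpM2r ?sqr_ge0//.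
  apply: (le_trans (ler_norm _)); rewrite normrX lerXn2r ?nnegrE//.
  exact: wS.
have SS : 0 <= S ^+ k * n 0 ^+ 2 by rewrite mulr_ge0 ?sqr_ge0// exprn_ge0.
apply: lerD => //.
set X := J 0 L (fun x => (1 + x) * _) in E *.
have k2 : 1 <= k.+2%:R :> R by rewrite ler1n.
have : k.+2%:R * (- X) <= S ^+ k * n 0 ^+ 2 by rewrite mulrN E opprK.
(* The factor k + 2 may be dropped only when [- X] is nonnegative; otherwise the bound is
   trivial. *)
case: (leP 0 (- X)) => X0 h; last by apply: le_trans SS; exact: ltW.
by apply: le_trans h; rewrite ler_peMl.
Qed.

(** One integration by parts, whose boundary terms vanish with [w i], then Cauchy-Schwarz. *)
Lemma log_convex i : (i < l)%N -> n i.+1 ^+ 2 <= n i * n i.+2.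
Proof.
move=> il; have [cw [bw _] _] := ww.
have si j : (j <= 2 * l + 1)%N -> sqint 0 L (w j) by exact: chain_sq.
have A1 : AC 0 L (w i) (w i.+1) by apply: (bvp_AC ww); nlia.
have A2 : AC 0 L (w i.+1) (w i.+2) by apply: (bvp_AC ww); nlia.
have := AC_total (ltW L0) (ACM (ltW L0) A1 A2).
have [-> ->] := bw i il; rewrite !mul0r subrr JD.
- move=> /eqP; rewrite addr_eq0 => /eqP E.
  rewrite nrm_sq (Jeq (g := fun x => w i.+1 x * w i.+1 x)); last by move=> x _; ring.
  rewrite E; apply: (le_trans (ler_norm _)); rewrite normrN.
  by apply: Cauchy_Schwarz; apply: si; nlia.
- by apply: sqM_L1; apply: si; nlia.
- by apply: sqM_L1; apply: si; nlia.
Qed.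

(** By log-convexity the ratios of consecutive norms increase; the product form allows for vanishing
    norms. *)
Lemma log_convex_chain i : (i < l)%N -> n 1 * n i <= n 0 * n i.+1.
Proof.
have n0 j : 0 <= n j by exact: nrm_ge0.
elim: i => [|i IH] il; first by rewrite mulrC.
have h1 := IH (ltnW il); have h2 := log_convex (ltnW il).
have := n0 i.+1; rewrite le_eqVlt => /orP[/eqP <-|np].
  by rewrite mulr0 mulr_ge0.
rewrite -(ler_pM2r np).
have -> : n 1 * n i.+1 * n i.+1 = n 1 * n i.+1 ^+ 2 by ring.
apply: (@le_trans _ _ (n 1 * (n i * n i.+2))); first by rewrite ler_wpM2l.
have -> : n 1 * (n i * n i.+2) = n 1 * n i * n i.+2 by ring.
have -> : n 0 * n i.+2 * n i.+1 = n 0 * n i.+1 * n i.+2 by ring.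
by rewrite ler_wpM2r.
Qed.

(** For j = l - 1 this interpolates the norm of Du between those of u and D^l u, with constant 1. *)
Lemma interpolated_power j : (j < l)%N -> n 1 ^+ j.+1 <= n 0 ^+ j * n j.+1.
Proof.
have n0 i : 0 <= n i by exact: nrm_ge0.
elim: j => [|j IH] jl; first by rewrite expr1 expr0 mul1r.
rewrite exprS; apply: (@le_trans _ _ (n 1 * (n 0 ^+ j * n j.+1))).
  by rewrite ler_wpM2l// IH// ltnW.
have -> : n 1 * (n 0 ^+ j * n j.+1) = n 0 ^+ j * (n 1 * n j.+1) by ring.
have -> : n 0 ^+ j.+1 * n j.+2 = n 0 ^+ j * (n 0 * n j.+2) by rewrite exprSr; ring.
by rewrite ler_wpM2l ?exprn_ge0// log_convex_chain.
Qed.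

Lemma sup_sq_bound x : 0 <= x <= L -> w 0 x ^+ 2 <= 2 * (n 0 * n 1).
Proof.
move=> /andP[x0 xL].
have A := AC_pow 1 L0 a01.
have := AC_le A (lexx 0) x0 xL; rewrite w00 expr0n /= subr0.
rewrite ger0_norm ?sqr_ge0// => /le_trans; apply.
have cA : C0 0 L (fun t => w 0 t * w 1%N t) by exact: C0M.
pose q t := `|w 0 t * w 1%N t|.
have cq : C0 0 L q by exact: C0_abs.
have cabs i : (i <= 2 * l)%N -> C0 0 L (fun t => `|w i t|).
  by move=> il; apply: C0_abs; exact: (bvp_C0 L0 ww).
apply: (@le_trans _ _ (J 0 L (fun t => 2 * q t))).
  rewrite (Jeq (g := fun t => 2 * q t)); last first.
    by move=> t _; rewrite expr1 normrM ger0_norm.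
  apply: Jmono => //; first exact/L1Z/C0_L1.
  by move=> t _; apply: mulr_ge0 => //; exact: normr_ge0.
rewrite JZ; last exact: C0_L1.
rewrite ler_pM2l//.
have s0 := C0_sq (cabs 0%N (leq0n _)).
have s1 := C0_sq (cabs 1%N ltac:(nlia)).
have := le_trans (ler_norm _) (Cauchy_Schwarz s0 s1).
rewrite (Jeq (g := q)); last by move=> t _; rewrite /q normrM.
move=> /le_trans; apply; rewrite le_eqVlt; apply/orP; left; apply/eqP.
by congr (_ * _); apply: nrm_eq => t _; rewrite real_normK ?num_real.
Qed.

(* With S = sup |w_0|, the hypothesis k <= 4 l gives S^k <= 1 + S^(4 l), and
   the Gagliardo-Nirenberg type bound S^(4 l) <= 4^l n_0^(4 l - 2) n_l^2 makes
   the nonlinear term of [smoothing_bound] absorbable when n_0 <= 1 / 2. *)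
Lemma small_solution : F / a <= 1 / 2 ->
  bounded_by L (w 0)
   (Num.sqrt (2 * L * ((1 + L) / a + (a^-1) ^+ 2)) * F).
Proof.
move=> Fa.
have n0' i : 0 <= n i by exact: nrm_ge0.
have F0 : 0 <= F by exact: nrm_ge0.
have nF : n 0 <= F / a := mass_bound.
have [x0 x0L wS] := C0_sup (ltW L0) c0.
set S := `|w 0 x0| in wS.
have S0 : 0 <= S by exact: normr_ge0.
have S2 : S ^+ 2 <= 2 * (n 0 * n 1).
  by rewrite real_normK ?num_real//; exact: sup_sq_bound.
(* After interpolation the coefficient is the square of 2^l n_0^(2 l), at most 1 / 2 because n_0 <=
   1 / 2. *)
have S4 : S ^+ (4 * l) * n 0 ^+ 2 <= 1 / 4 * n l ^+ 2.
  have e1 : S ^+ (4 * l) <= (2 * (n 0 * n 1)) ^+ (2 * l).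
    have -> : (4 * l = 2 * (2 * l))%N by nlia.
    by rewrite exprM lerXn2r// ?nnegrE ?sqr_ge0 ?mulr_ge0.
  have l1 : l = l.-1.+1 by rewrite prednK.
  have e2 : n 1 ^+ l <= n 0 ^+ l.-1 * n l.
    by have := @interpolated_power l.-1 ltac:(by rewrite prednK); rewrite prednK.
  have e3 : (n 1 ^+ l) ^+ 2 <= (n 0 ^+ l.-1 * n l) ^+ 2.
    by rewrite lerXn2r// ?nnegrE ?exprn_ge0// mulr_ge0// exprn_ge0.
  apply: (@le_trans _ _ ((2 ^+ l * n 0 ^+ l) ^+ 2 * (n 0 ^+ l.-1 * n l) ^+ 2 * n 0 ^+ 2)).
    rewrite ler_wpM2r ?sqr_ge0// (le_trans e1)//.
    rewrite [(2 * l)%N]mulnC exprM.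
    have -> : (2 * (n 0 * n 1)) ^+ l = 2 ^+ l * n 0 ^+ l * n 1 ^+ l.
      by rewrite !exprMn mulrA.
    by rewrite exprMn ler_wpM2l// sqr_ge0.
  have -> : (2 ^+ l * n 0 ^+ l) ^+ 2 * (n 0 ^+ l.-1 * n l) ^+ 2 * n 0 ^+ 2 =
     ((2 ^+ l * n 0 ^+ l) * (n 0 * n 0 ^+ l.-1)) ^+ 2 * n l ^+ 2 by ring.
  rewrite -exprS prednK// ler_wpM2r ?sqr_ge0//.
  have h : n 0 <= 1 / 2 := le_trans nF Fa.
  have e4 : 2 ^+ l * n 0 ^+ l <= 1.
    rewrite -exprMn exprn_ile1// ?mulr_ge0//; lra.
  have e5 : n 0 ^+ l <= 1 / 2.
    rewrite l1 exprS; apply: (@le_trans _ _ (1 / 2 * 1)); last by rewrite mulr1.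
    apply: ler_pM => //; first exact: exprn_ge0.
    by apply: exprn_ile1 => //; lra.
  have e6 : 2 ^+ l * n 0 ^+ l * n 0 ^+ l <= 1 / 2.
    rewrite -[leRHS]mul1r; apply: ler_pM => //.
      by rewrite mulr_ge0// exprn_ge0.
    exact: exprn_ge0.
  have e7 : 0 <= 2 ^+ l * n 0 ^+ l * n 0 ^+ l by rewrite !mulr_ge0// exprn_ge0.
  by nra.
have Sk : S ^+ k * n 0 ^+ 2 <= n 0 ^+ 2 + 1 / 4 * n l ^+ 2.
  apply: (@le_trans _ _ ((1 + S ^+ (4 * l)) * n 0 ^+ 2)).
    rewrite ler_wpM2r ?sqr_ge0//; case: (leP S 1) => S1.
      by apply: (@le_trans _ _ 1); [exact: exprn_ile1|rewrite lerDl exprn_ge0].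
    by apply: (@le_trans _ _ (S ^+ (4 * l))); [apply: ler_weXn2l => //; exact: ltW|rewrite lerDr].
  by rewrite mulrDl mul1r lerD2l.
(* Two orders are used: order l to absorb the norm of D^l u, order 1 to bound that of Du, which
   gives the supremum. *)
have h1 := @smoothing_bound S 1 ltac:(nlia) wS S0.
have hl := @smoothing_bound S l ltac:(nlia) wS S0.
set Q := (1 + L) * n 0 * F in h1 hl.
have an0 : 0 <= a * n 0 ^+ 2 by rewrite mulr_ge0 ?sqr_ge0// ltW.
have n1b : n 1 ^+ 2 <= 2 * (Q + n 0 ^+ 2).
  have := sqr_ge0 (n 0); have := sqr_ge0 (n l); have := sqr_ge0 (n 1).
  have Q0 : 0 <= Q by rewrite !mulr_ge0// addr_ge0// ltW.
  lra.
have Qb : Q + n 0 ^+ 2 <= ((1 + L) / a + (a^-1) ^+ 2) * F ^+ 2.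
  have g1 : n 0 ^+ 2 <= (F / a) ^+ 2 by rewrite lerXn2r ?nnegrE ?divr_ge0// ltW.
  have g2 : Q <= (1 + L) * (F / a) * F.
    by rewrite ler_wpM2r// ler_wpM2l// addr_ge0// ltW.
  have -> : ((1 + L) / a + (a^-1) ^+ 2) * F ^+ 2 = (1 + L) * (F / a) * F + (F / a) ^+ 2 by ring.
  exact: lerD.
have s1 : sqint 0 L (w 1%N) by exact: C0_sq.
move=> x xL; apply: (le_trans (sup_by_derivative L0 a01 s1 w00 xL)).
rewrite -/(n 1) -[n 1]ger0_norm// -sqrtr_sqr -[F]ger0_norm// -sqrtr_sqr.
have K0 : 0 <= 2 * L * ((1 + L) / a + (a^-1) ^+ 2).
  apply: mulr_ge0; first by rewrite mulr_ge0// ltW.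
  by rewrite addr_ge0 ?sqr_ge0// divr_ge0 ?addr_ge0// ltW.
rewrite -(sqrtrM _ (ltW L0)) -(sqrtrM _ K0).
apply: ler_wsqrtr.
have : L * n 1 ^+ 2 <= L * (2 * (((1 + L) / a + (a^-1) ^+ 2) * F ^+ 2)).
  by rewrite ler_pM2l// (le_trans n1b)// ler_pM2l.
by move=> /le_trans; apply; rewrite le_eqVlt; apply/orP; left; apply/eqP; ring.
Qed.

End OneSolution.

End NonlinearEstimates.

(** * Existence and stability for small data *)

Section SmallData.
Context {R : realType}.
Notation mu := (@lebesgue_measure R).
Implicit Types (a L x t r H S eps : R) (l k n i j : nat) (f g h u : R -> R)
  (w v : nat -> R -> R).

(** For a radius [r] so small, u^k Du composed with a linear solution operator of norm [C] has
    Lipschitz constant at most 1 / 2 on the ball of radius [r] in C^1. *)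
Lemma small_power L k (C : R) : 0 < C -> 0 < L -> (0 < k)%N ->
  exists r : R, [/\ 0 < r, r <= 1 &
    C * (Num.sqrt L * (k.+1%:R * r ^+ k)) <= 1 / 2].
Proof.
move=> C0' L0 k0; pose q := Num.sqrt L.
have q0 : 0 <= q by exact: sqrtr_ge0.
have k1 : 0 < k.+1%:R :> R by rewrite ltr0n.
pose D := 2 * C * (q + 1) * k.+1%:R.
have D0 : 0 < D by rewrite !mulr_gt0// ltr_wpDl.
pose r := Num.min 1 D^-1.
have r0 : 0 < r by rewrite lt_min ltr01 invr_gt0.
have r1 : r <= 1 by rewrite ge_min lexx.
have rD : D * r <= 1.
  rewrite -(mulfV (lt0r_neq0 D0)) ler_pM2l//.
  by rewrite ge_min lexx orbT.
exists r; split=> //; rewrite -/q.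
have rp := ltW r0.
have rk : r ^+ k <= r by rewrite -(prednK k0) exprS ler_piMr// exprn_ile1.
apply: (@le_trans _ _ (C * ((q + 1) * (k.+1%:R * r)))).
  rewrite ler_pM2l//; apply: ler_pM => //.
  - by rewrite mulr_ge0// exprn_ge0// ltW.
  - by rewrite lerDl.
  - by rewrite ler_pM2l.
rewrite /D in rD; lra.
Qed.

(** The unknown is a pair of continuous functions standing for u and Du, with no relation imposed
    between them: at the fixed point they are the first two terms of one chain. *)
Lemma nonlinear_existence a L l k : 0 < a -> 0 < L -> (0 < l)%N -> (0 < k)%N ->
  exists2 d : R, 0 < d & forall f, sqint 0 L f -> nrm 0 L f < d ->
    exists w, lin_bvp a L l w (fun x => f x - w 0 x ^+ k * w 1%N x).
Proof.
move=> a0 L0 l0 k0.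
have [C C0' HC] := lin_estimate a0 L0 l0.
have [r [r0 r1 Cr]] := small_power C0' L0 k0.
have rp := ltW r0.
(* Data this small send 0 into the ball of radius r / 2; the contraction adds at most r / 2, so the
   ball of radius [r] is preserved. *)
exists (r / (2 * C)); first by rewrite divr_gt0// mulr_gt0.
move=> f sf fd.
(* [choice] needs a value for every [h], so the solution operator is 0 where [h] is not square
   integrable. *)
have H h : exists w, sqint 0 L h -> lin_bvp a L l w h.
  case: (pselect (sqint 0 L h)) => [sh|nh]; last by exists (fun _ _ => 0).
  by have [w ww] := lin_existence a0 L0 l0 sh; exists w.
have [S HS] := choice H.
pose X := (nat * R)%type.
pose D (p : X) := (p.1 <= 1)%N /\ 0 <= p.2 <= L.
pose K (y : X -> R) := [/\ C0 0 L (fun x => y (0%N, x)),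
  C0 0 L (fun x => y (1%N, x)) & forall p, D p -> `|y p| <= r].
pose N (y : X -> R) x := y (0%N, x) ^+ k * y (1%N, x).
pose T (y : X -> R) (p : X) := S (fun x => f x - N y x) p.1 p.2.
have cN y : K y -> C0 0 L (N y).
  by move=> [c0 c1 _]; apply: C0M => //; exact: C0X.
have sN y : K y -> sqint 0 L (fun x => f x - N y x).
  by move=> Ky; apply: sqB => //; exact/C0_sq/cN.
have N_lip y z d : K y -> K z -> 0 <= d -> (forall p, D p -> `|y p - z p| <= d) ->
    C * nrm 0 L (fun x => N y x - N z x) <= d / 2.
  move=> Ky Kz d0 yz.
  have b : nrm 0 L (fun x => N y x - N z x) <= Num.sqrt L * (k.+1%:R * r ^+ k * d).
    rewrite -[L in Num.sqrt L]subr0; apply: nrm_bnd; first exact: ltW.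
    - by rewrite !mulr_ge0// exprn_ge0.
    - by apply: C0_sq; apply: C0B; exact: cN.
    have [_ _ yr] := Ky; have [_ _ zr] := Kz.
    by move=> x xL; apply: monomial_lipschitz => //; (apply: yr||apply: zr||apply: yz).
  apply: (@le_trans _ _ (C * (Num.sqrt L * (k.+1%:R * r ^+ k)) * d)).
    rewrite -mulrA ler_pM2l// (le_trans b)// le_eqVlt; apply/orP; left; apply/eqP; ring.
  by apply: (@le_trans _ _ (1 / 2 * d)); [exact: ler_wpM2r|rewrite mul1r mulrC].
have TL y p : K y -> D p -> lin_bvp a L l (S (fun x => f x - N y x)) (fun x => f x - N y x).
  by move=> Ky _; apply: HS; exact: sN.
have p2 p : D p -> (p.1 <= 2 * l)%N by move=> [h _]; nlia.
have K0 : K (fun=> 0).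
  by split; [exact: C0_cst|exact: C0_cst|move=> p _; rewrite normr0].
have N0 x : N (fun=> 0) x = 0 by rewrite /N mulr0.
have TC y z d : K y -> K z -> 0 <= d -> (forall p, D p -> `|y p - z p| <= d * 1) ->
    forall p, D p -> `|T y p - T z p| <= d / 2 * 1.
  move=> Ky Kz d0 yz p Dp; rewrite mulr1.
  have yz' q : D q -> `|y q - z q| <= d by move=> Dq; rewrite -[d]mulr1; exact: yz.
  have [b _] := HC _ _ (sqB (sN y Ky) (sN z Kz)) (lin_bvp_diff (TL y p Ky Dp) (TL z p Kz Dp)).
  have [_ pL] := Dp.
  apply: (le_trans (b p.1 (p2 p Dp) p.2 pL)).
  have := N_lip z y d Kz Ky d0 ltac:(by move=> q Dq; rewrite distrC; exact: yz').
  by congr (_ * _ <= _); apply: nrm_eq => x _; ring.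
have T0 p : D p -> `|T (fun=> 0) p| <= r / 2.
  move=> Dp; have [b _] := HC _ _ (sN _ K0) (TL _ p K0 Dp).
  have [_ pL] := Dp.
  apply: (le_trans (b p.1 (p2 p Dp) p.2 pL)).
  rewrite (nrm_eq (g := f)); last by move=> x _; rewrite N0 subr0.
  by move: fd; rewrite ltr_pdivlMr ?mulr_gt0// => fd; lra.
have KT y : K y -> K (T y).
  move=> Ky.
  have Dx x : 0 <= x <= L -> D (0%N, x) by [].
  have cT i : (i <= 1)%N -> C0 0 L (fun x => T y (i, x)).
    move=> i1; have [cw _ _] := HS _ (sN y Ky).
    by apply: (chain_C0 L0 cw); nlia.
  split; [exact: cT|exact: cT|move=> p Dp].
  have [_ _ yr] := Ky.
  have := TC y (fun=> 0) r Ky K0 rp ltac:(by move=> q Dq; rewrite subr0 mulr1; exact: yr) p Dp.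
  have := T0 p Dp; rewrite mulr1 => h1 h2.
  have -> : T y p = (T y p - T (fun=> 0) p) + T (fun=> 0) p by ring.
  rewrite (le_trans (ler_normD _ _))//; lra.
have [|||y [cy0 cy1 yr] fy] := @contraction_fixpoint R X D (fun=> 1) K T (fun=> 0) r _ K0 rp KT _ TC.
- by [].
- by move=> p Dp; rewrite subr0 mulr1; have := T0 p Dp; lra.
- move=> y Hy; split.
  + apply: C0_uniform_limit => e e0; have [z [c0 _ _] zy] := Hy e e0.
    exists (fun x => z (0%N, x)) => // x xL.
    by rewrite -[e]mulr1; apply: zy.
  + apply: C0_uniform_limit => e e0; have [z [_ c1 _] zy] := Hy e e0.
    exists (fun x => z (1%N, x)) => // x xL.
    by rewrite -[e]mulr1; apply: zy.
  + move=> p Dp; apply/ler_addgt0Pr => e e0; have [z [_ _ zr] zy] := Hy e e0.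
    have := zy p Dp; rewrite mulr1 => h1; have h2 := zr p Dp.
    have -> : y p = z p - (z p - y p) by ring.
    by rewrite (le_trans (ler_normB _ _))// lerD.
have Ky : K y by [].
exists (S (fun x => f x - N y x)).
have [cw bw ew] := HS _ (sN y Ky).
split=> //; apply: (aeq_trans ew); apply: aeq_eq => x xL.
have E0 := fy (0%N, x) (conj isT xL); have E1 := fy (1%N, x) (conj isT xL).
by rewrite /N -E0 -E1.
Qed.

(** * Stability of solutions with small suprema *)

Section Difference.
Context (a L s : R) (l k : nat) (f g : R -> R) (w v : nat -> R -> R).
Hypotheses (a0 : 0 < a) (L0 : 0 < L) (l0 : (0 < l)%N) (k0 : (0 < k)%N).
Hypotheses (s0 : 0 <= s) (s1 : s <= 1)
  (sa : (2 + L) * s ^+ k <= a / 2) (sb : (2 + L) * s ^+ k <= 1).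
Hypotheses (sf : sqint 0 L f) (sg : sqint 0 L g).
Hypotheses (ww : lin_bvp a L l w (fun x => f x - w 0 x ^+ k * w 1%N x))
  (vv : lin_bvp a L l v (fun x => g x - v 0 x ^+ k * v 1%N x)).
Hypotheses (ws : bounded_by L (w 0) s) (vs : bounded_by L (v 0) s).
Let z i x := w i x - v i x.
Let H := nrm 0 L (fun x => f x - g x).
Let K1 := (1 + L) * (1 + a^-1).

Let q x := (f x - w 0 x ^+ k * w 1%N x) - (g x - v 0 x ^+ k * v 1%N x).
Let zz : lin_bvp a L l z q.
Proof. exact: lin_bvp_diff. Qed.

Let wC i : (i <= 2 * l)%N -> C0 0 L (w i).
Proof. exact: (bvp_C0 L0 ww). Qed.
Let vC i : (i <= 2 * l)%N -> C0 0 L (v i).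
Proof. exact: (bvp_C0 L0 vv). Qed.
Let l1 : (1 <= 2 * l)%N. Proof. by rewrite muln_gt0. Qed.
Let zC i : (i <= 2 * l)%N -> C0 0 L (z i).
Proof. by move=> il; apply: C0B; [exact: wC|exact: vC]. Qed.
Let sq_q : sqint 0 L q.
Proof.
apply: sqB; apply: sqB => //; apply: C0_sq; apply: C0M; first exact/C0X/wC.
- exact: wC.
- exact/C0X/vC.
- exact: vC.
Qed.

(** The nonlinear part is at most (2 + L) s^k (n0^2 + n1^2). By [sa] and [sb] it uses up half of a
    n0^2 and n1^2 out of 3 / 2 n1^2; the other half of a n0^2 absorbs the data term, and n1^2 / 2
    remains. *)
Lemma difference_bound : nrm 0 L (z 1%N) <= K1 * H.
Proof.
have L0' := ltW L0.
have En := @energy_weighted _ a L l z q 1 L0 a0 zz (sq_meas sq_q) l0.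
set n0 := nrm 0 L (z 0) in En; set n1 := nrm 0 L (z 1%N) in En *.
have n00 : 0 <= n0 by exact: nrm_ge0.
have n10 : 0 <= n1 by exact: nrm_ge0.
have H0 : 0 <= H by exact: nrm_ge0.
have c1x : C0 0 L (fun x => 1 + x) by apply: C0D; [exact: C0_cst|exact: C0_id].
have [sz nz] := @nrm_mul_bnd _ 0 L (z 0) (fun x => 1 + x) (1 + L)
  (addr_ge0 ler01 L0') (C0_meas c1x) (C0_sq (zC (leq0n _)))
  ltac:(by move=> x xL; rewrite ger0_norm; lra).
have sfg := sqB sf sg.
have CS := le_trans (ler_norm _) (Cauchy_Schwarz sz sfg).
pose kk : R := k.+1%:R.
have kp : 0 < kk by rewrite ltr0n.
pose Q x := w 0 x ^+ k.+1 - v 0 x ^+ k.+1.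
pose P x := w 0 x ^+ k * w 1%N x - v 0 x ^+ k * v 1%N x.
have aw := bvp_AC ww (leq0n _); have av := bvp_AC vv (leq0n _).
have aQ := ACB (AC_pow k L0 aw) (AC_pow k L0 av).
have az : AC 0 L (z 0) (z 1%N) by exact: ACB.
have [_ [bz _] _] := zz; have [z00 z0L] := bz 0%N l0.
have A := ACM L0' (ACM L0' (ACD (AC_cst 0 L 1) (AC_id 0 L)) az) aQ.
have cP : C0 0 L P.
  apply: C0B; apply: C0M; [exact/C0X/wC|exact: wC|exact/C0X/vC|exact: vC].
have cQ : C0 0 L Q by apply: C0B; [exact/C0X/wC|exact/C0X/vC].
have cA1 : C0 0 L (fun x => (z 0 x + (1 + x) * z 1%N x) * Q x).
  apply: C0M => //; apply: C0D; first exact: zC.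
  by apply: C0M => //; exact: zC.
have cA2 : C0 0 L (fun x => (1 + x) * (z 0 x * P x)).
  by apply: C0M => //; apply: C0M => //; exact: zC.
have E : kk * J 0 L (fun x => (1 + x) * (z 0 x * P x)) =
    - J 0 L (fun x => (z 0 x + (1 + x) * z 1%N x) * Q x).
  have := AC_total L0' A; rewrite z00 z0L !mulr0 !mul0r subrr.
  rewrite (Jeq (g := fun x => (z 0 x + (1 + x) * z 1%N x) * Q x +
     kk * ((1 + x) * (z 0 x * P x)))); last by move=> x _; rewrite /Q /P /kk; ring.
  rewrite JD; [|exact: C0_L1|exact/L1Z/C0_L1].
  by rewrite JZ ?C0_L1// => /eqP; rewrite addrC addr_eq0 => /eqP.
have [_ Lz0] := C0_sq (zC (leq0n _)); have [_ Lz1] := C0_sq (zC l1).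
(* The factor k + 1 of the Lipschitz bound for powers cancels against the one in [E]. *)
have B : J 0 L (fun x => (z 0 x + (1 + x) * z 1%N x) * Q x) <=
    kk * ((2 + L) * s ^+ k * (n0 ^+ 2 + n1 ^+ 2)).
  rewrite !nrm_sq -JD// -!JZ; last 2 first.
  - by apply: L1Z; exact: L1D.
  - exact: L1D.
  apply: Jle; [exact: C0_L1|by do 2 apply: L1Z; exact: L1D|].
  move=> x xL; apply: (le_trans (ler_norm _)).
  have hQ : `|Q x| <= kk * s ^+ k * `|z 0 x|.
    by apply: pow_lipschitz => //; [exact: ws|exact: vs].
  have hz : `|z 0 x + (1 + x) * z 1%N x| <= `|z 0 x| + (1 + L) * `|z 1%N x|.
    rewrite (le_trans (ler_normD _ _))// lerD2l normrM ler_wpM2r//.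
    by rewrite ger0_norm; lra.
  rewrite normrM; apply: (le_trans (ler_pM (normr_ge0 _) (normr_ge0 _) hz hQ)).
  have sk : 0 <= kk * s ^+ k by rewrite mulr_ge0 ?exprn_ge0// ltW.
  have -> : kk * ((2 + L) * s ^+ k * (z 0 x ^+ 2 + z 1%N x ^+ 2)) =
     (2 + L) * (z 0 x ^+ 2 + z 1%N x ^+ 2) * (kk * s ^+ k) by ring.
  have -> : (`|z 0 x| + (1 + L) * `|z 1%N x|) * (kk * s ^+ k * `|z 0 x|) =
     (`|z 0 x| + (1 + L) * `|z 1%N x|) * `|z 0 x| * (kk * s ^+ k) by ring.
  apply: ler_wpM2r => //.
  rewrite -[z 0 x ^+ 2]real_normK ?num_real// -[z 1%N x ^+ 2]real_normK ?num_real//.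
  have y0 := normr_ge0 (z 0 x); have y1 := normr_ge0 (z 1%N x).
  move: `|z 0 x| `|z 1%N x| y0 y1 => X Y X0 Y0.
  rewrite -subr_ge0.
  have -> : (2 + L) * (X ^+ 2 + Y ^+ 2) - (X + (1 + L) * Y) * X =
     (1 + L) / 2 * (X - Y) ^+ 2 + (1 + L) / 2 * (X ^+ 2 + Y ^+ 2) + Y ^+ 2 by field.
  have L1' : 0 <= (1 + L) / 2 by rewrite divr_ge0// addr_ge0.
  by rewrite !addr_ge0 ?sqr_ge0// mulr_ge0 ?addr_ge0 ?sqr_ge0.
have E2 : J 0 L (fun x => (1 + x) * (z 0 x * q x)) <=
    (1 + L) * n0 * H + (2 + L) * s ^+ k * (n0 ^+ 2 + n1 ^+ 2).
  have -> : J 0 L (fun x => (1 + x) * (z 0 x * q x)) =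
    J 0 L (fun x => (1 + x) * z 0 x * (f x - g x)) - J 0 L (fun x => (1 + x) * (z 0 x * P x)).
    rewrite -JB; [|exact: sqM_L1|exact: C0_L1].
    by apply: Jeq => x _; rewrite /q /P; ring.
  apply: lerD; first by apply: (le_trans CS); rewrite ler_wpM2r.
  by rewrite -(ler_pM2l kp) mulrN E opprK.
have S1 : (2 + L) * s ^+ k * (n0 ^+ 2 + n1 ^+ 2) <= a / 2 * n0 ^+ 2 + n1 ^+ 2.
  rewrite mulrDr; apply: lerD; first by rewrite ler_wpM2r ?sqr_ge0.
  by rewrite -[leRHS]mul1r ler_wpM2r ?sqr_ge0.
have S2 : (1 + L) * n0 * H <= a / 2 * n0 ^+ 2 + ((1 + L) * H) ^+ 2 * a^-1 / 2.
  rewrite -subr_ge0.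
  have -> : a / 2 * n0 ^+ 2 + ((1 + L) * H) ^+ 2 * a^-1 / 2 - (1 + L) * n0 * H =
    a^-1 / 2 * (a * n0 - (1 + L) * H) ^+ 2 by field; rewrite gt_eqF.
  by rewrite mulr_ge0 ?sqr_ge0// divr_ge0// invr_ge0 ltW.
have ai0 : 0 < a^-1 by rewrite invr_gt0.
have S3 : ((1 + L) * H) ^+ 2 * a^-1 <= (K1 * H) ^+ 2.
  have -> : (K1 * H) ^+ 2 = ((1 + L) * H) ^+ 2 * (1 + a^-1) ^+ 2 by rewrite /K1; ring.
  by rewrite ler_wpM2l ?sqr_ge0//; exact/le_sqr1D/ltW.
have K10 : 0 <= K1 by rewrite /K1 mulr_ge0 ?addr_ge0// ltW.
rewrite -(@ler_pXn2r _ 2)// ?nnegrE//; last by apply: mulr_ge0.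
lra.
Qed.

Lemma difference_sup : bounded_by L (z 0) (Num.sqrt L * (K1 * H)).
Proof.
move=> x xL.
have [_ [bz _] _] := zz; have [z00 _] := bz 0%N l0.
apply: (le_trans (sup_by_derivative L0 (bvp_AC zz (leq0n _)) (C0_sq (zC l1)) z00 xL)).
by rewrite ler_wpM2l ?sqrtr_ge0//; exact: difference_bound.
Qed.

(** Writing the nonlinear difference as w^k Dz + (w^k - v^k) Dv leaves the derivative of [v] alone
    in the constant; [v] will be the fixed solution, so the constant does not depend on the
    perturbed one. *)
Lemma difference_rhs : nrm 0 L q <=
  (1 + (1 + k%:R * Num.sqrt L * nrm 0 L (v 1%N)) * K1) * H.
Proof.
have L0' := ltW L0.
have q0 : 0 <= Num.sqrt L by exact: sqrtr_ge0.
have n1 := difference_bound.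
set N1 := nrm 0 L (z 1%N) in n1.
have N10 : 0 <= N1 by exact: nrm_ge0.
have V0 : 0 <= nrm 0 L (v 1%N) by exact: nrm_ge0.
have z0 x : 0 <= x <= L -> `|z 0 x| <= Num.sqrt L * N1.
  have [_ [bz _] _] := zz; have [z00 _] := bz 0%N l0.
  exact: (sup_by_derivative L0 (bvp_AC zz (leq0n _)) (C0_sq (zC l1)) z00).
have cwk : C0 0 L (fun x => w 0 x ^+ k) by exact/C0X/wC.
have cvk : C0 0 L (fun x => v 0 x ^+ k) by exact/C0X/vC.
have [sA nA] := @nrm_mul_bnd _ 0 L (z 1%N) (fun x => w 0 x ^+ k) 1 ler01
  (C0_meas cwk) (C0_sq (zC l1))
  ltac:(by move=> x xL; rewrite normrX exprn_ile1//; exact: le_trans (ws xL) s1).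
have [sB nB] := @nrm_mul_bnd _ 0 L (v 1%N) (fun x => w 0 x ^+ k - v 0 x ^+ k)
  (k%:R * (Num.sqrt L * N1))
  ltac:(by rewrite mulr_ge0// mulr_ge0) (C0_meas (C0B cwk cvk)) (C0_sq (vC l1))
  ltac:(move=> x xL; have := pow_lipschitz k.-1 s0 (ws xL) (vs xL);
    rewrite prednK// => /le_trans; apply;
    rewrite -mulrA ler_wpM2l// -[leRHS]mul1r;
    apply: ler_pM => //; [exact: exprn_ge0|exact: exprn_ile1|exact: z0]).
pose E x := w 0 x ^+ k * z 1%N x + (w 0 x ^+ k - v 0 x ^+ k) * v 1%N x.
have sE : sqint 0 L E by exact: sqD.
rewrite (nrm_eq (g := fun x => (f x - g x) + (-1) * E x)); last first.
  by move=> x _; rewrite /q /E /z; congr (_ ^+ 2); ring.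
apply: (le_trans (nrmD (sqB sf sg) (sqZ (-1) sE))).
rewrite (nrm_eq (f := fun x => -1 * E x) (g := E)); last by move=> x _; ring.
rewrite mulrDl mul1r lerD2l.
apply: (le_trans (nrmD sA sB)); apply: (le_trans (lerD nA nB)).
have -> : 1 * nrm 0 L (z 1%N) + k%:R * (Num.sqrt L * N1) * nrm 0 L (v 1%N) =
  (1 + k%:R * Num.sqrt L * nrm 0 L (v 1%N)) * N1 by rewrite -/N1; ring.
rewrite -[leRHS]mulrA; apply: ler_wpM2l => //.
by apply: addr_ge0 => //; apply: mulr_ge0 => //; exact: mulr_ge0.
Qed.

Lemma difference_bvp : lin_bvp a L l z q /\ sqint 0 L q.
Proof. by []. Qed.

End Difference.

Lemma Hnorm_le L n w u B : 0 < L -> chain L n w -> sqint 0 L u ->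
  aeq 0 L u (w 0) -> 0 <= B ->
  (forall i, (i <= n)%N -> nrm 0 L (w i) <= B) ->
  Hnorm L n u <= n.+1%:R * B.
Proof.
move=> L0 cw su uw B0 wB.
have nB : 0 <= n.+1%:R * B by rewrite mulr_ge0.
rewrite -(@ler_pXn2r _ 2)// ?nnegrE//; last exact: sqrtr_ge0.
rewrite (Hnorm_sq L0 cw su uw).
apply: (@le_trans _ _ (\sum_(i < n.+1) B ^+ 2)).
  apply: ler_sum => i _; rewrite -nrm_sq lerXn2r ?nnegrE ?nrm_ge0//.
  by apply: wB; rewrite -ltnS ltn_ord.
rewrite sumr_const card_ord -[_ *+ n.+1]mulr_natl exprMn ler_wpM2r ?sqr_ge0//.
by rewrite expr2 ler_peMl// ler1n.
Qed.

End SmallData.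

(** * Uniqueness and continuous dependence *)

Theorem theorem2p3 (R : realType) (a L : R) (l k : nat)
    (ha : 0 < a) (hL : 0 < L) (hk1 : (1 <= k)%N) (hk2 : (k <= 4 * l)%N) :
  exists delta : R, 0 < delta /\
    forall f : R -> R, inL2 L f -> weighted_sq L f < delta ->
      exists u : R -> R,
        [/\ regular_solution a L l k f u,
            forall v : R -> R, regular_solution a L l k f v -> ae_eq_on L v u &
            forall eps : R, 0 < eps ->
              exists eta : R, 0 < eta /\
                forall g v : R -> R, inL2 L g ->
                  L2norm L (fun x => g x - f x) < eta ->
                  regular_solution a L l k g v ->
                  Hnorm L (2 * l + 1) (fun x => v x - u x) < eps].
Proof.
have l0 : (0 < l)%N by nlia.
have L0' := ltW hL.
have [d1 d10 Hex] := nonlinear_existence ha hL l0 hk1.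
have [C C0' HC] := lin_estimate ha hL l0.
pose m := Num.min (a / 2) 1.
have m0 : 0 < m by rewrite lt_min ltr01 divr_gt0.
have L20 : 0 < 2 + L by rewrite addr_gt0.
(* As s <= 1, s^k <= s, so (2 + L) s^k is at most [m], the smaller of the two thresholds of the
   stability estimate. *)
pose s := Num.min 1 (m / (2 + L)).
have s0 : 0 < s by rewrite lt_min ltr01 divr_gt0.
have s1 : s <= 1 by rewrite ge_min lexx.
have sm : (2 + L) * s ^+ k <= m.
  have sk : s ^+ k <= s by rewrite -(prednK hk1) exprS ler_piMr ?exprn_ile1 ?(ltW s0).
  apply: (@le_trans _ _ ((2 + L) * s)); first by rewrite ler_pM2l.
  by rewrite mulrC -ler_pdivlMr// ge_min lexx orbT.
have sa : (2 + L) * s ^+ k <= a / 2 by apply: (le_trans sm); rewrite ge_min lexx.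
have sb : (2 + L) * s ^+ k <= 1 by apply: (le_trans sm); rewrite ge_min lexx orbT.
pose M := Num.sqrt (2 * L * ((1 + L) / a + (a^-1) ^+ 2)).
have M0 : 0 <= M by exact: sqrtr_ge0.
have M1 : 0 < M + 1 by rewrite ltr_wpDl.
(* The first entry meets the hypothesis of [small_solution], the second turns its bound into at most
   [s]; [M + 1] is certainly positive. *)
pose d2 := Num.min (a / 2) (s / (M + 1)).
have d20 : 0 < d2 by rewrite lt_min !divr_gt0.
have small f w : sqint 0 L f ->
    lin_bvp a L l w (fun x => f x - w 0 x ^+ k * w 1%N x) ->
    nrm 0 L f < d2 -> bounded_by L (w 0) s.
  move=> sf ww; rewrite lt_min => /andP[h1 h2] x xL.
  have h1' : nrm 0 L f / a <= 1 / 2 by rewrite ler_pdivrMr// mulrC mulrA mulr1 ltW.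
  apply: (le_trans (small_solution ha hL l0 hk2 sf ww h1' xL)).
  rewrite -/M; move: h2; rewrite ltr_pdivlMr// => h2.
  apply: le_trans (ltW h2); rewrite mulrC ler_wpM2l ?nrm_ge0//.
  by rewrite lerDl.
pose d := Num.min d1 d2.
have d0 : 0 < d by rewrite lt_min d10.
(* Since 1 + x >= 1, the weighted integral dominates the squared norm of [f]. *)
exists (d ^+ 2); split; first exact: exprn_gt0.
move=> f /inL2P sf; rewrite weighted_sqE// => fd.
have nf : nrm 0 L f < d.
  rewrite -(@ltr_pXn2r _ 2)// ?nnegrE ?nrm_ge0 ?(ltW d0)//.
  apply: le_lt_trans fd; rewrite nrm_sq; apply: Jle.
  - by case: sf.
  - exact: weighted_L1.
  - move=> x /andP[x0 _]; rewrite -[leLHS]mul1r ler_wpM2r ?sqr_ge0//.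
    by rewrite lerDl.
have nf1 : nrm 0 L f < d1 by apply: (lt_le_trans nf); rewrite ge_min lexx.
have nf2 : nrm 0 L f < d2 by apply: (lt_le_trans nf); rewrite ge_min lexx orbT.
have [w ww] := Hex f sf nf1.
have ws := small f w sf ww nf2.
have c0 : C0 0 L (w 0) := bvp_C0 hL ww (leq0n _).
exists (w 0); split.
- exact: lin_bvp_regular.
- move=> v /(regular_lin_bvp hL l0)[v' vv ve].
  have vs := small f v' sf vv nf2.
  apply/aeqP; apply: (aeq_trans ve); apply: aeq_eq => x xL.
  have := difference_sup ha hL l0 (ltW s0) sa sb sf sf vv ww vs ws xL.
  rewrite (_ : nrm 0 L (fun x => f x - f x) = 0).
    by rewrite !mulr0 normr_le0 subr_eq0 => /eqP.
  rewrite (nrm_eq (g := fun=> 0)); last by move=> t _; rewrite subrr.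
  by rewrite /nrm (Jeq (g := fun=> 0)) ?Jcst ?mul0r ?sqrtr0// => t _; rewrite expr0n.
move=> eps e0.
pose q := Num.sqrt L.
have q0 : 0 <= q by exact: sqrtr_ge0.
pose Q := 1 + (1 + k%:R * q * nrm 0 L (w 1%N)) * ((1 + L) * (1 + a^-1)).
have Q0 : 0 <= Q.
  have ai : 0 <= a^-1 by rewrite invr_ge0 ltW.
  have n0 := nrm_ge0 0 L (w 1%N).
  apply: addr_ge0 => //; apply: mulr_ge0; last by rewrite mulr_ge0 ?addr_ge0.
  by apply: addr_ge0 => //; apply: mulr_ge0 => //; exact: mulr_ge0.
(* Orders up to 2 l are bounded in supremum and cost a factor [q] in L^2; the top order is bounded
   in L^2 directly. *)
pose B := (q + 1) * (C * Q).
have B0 : 0 <= B by rewrite mulr_ge0 ?addr_ge0// mulr_ge0// ltW.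
pose big := (2 * l + 1).+1%:R * B.
have big0 : 0 <= big by rewrite mulr_ge0.
have big1 : 0 < big + 1 by rewrite ltr_wpDl.
(* The first entry keeps [g] below the threshold [d2], so that every solution for [g] has a small
   supremum; the second yields [eps]. *)
exists (Num.min (d2 - nrm 0 L f) (eps / (big + 1))); split.
  by rewrite lt_min subr_gt0 nf2 divr_gt0.
move=> g v /inL2P sg + rv.
have sgf := sqB sg sf.
have -> : L2norm L (fun x => g x - f x) = nrm 0 L (fun x => g x - f x).
  by rewrite /L2norm Joo//; case: sgf.
set H := nrm 0 L _; rewrite lt_min => /andP[h1 h2].
have H0 : 0 <= H by exact: nrm_ge0.
have ng : nrm 0 L g < d2.
  apply: (@le_lt_trans _ _ (H + nrm 0 L f)); last by rewrite -ltrBrDr.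
  rewrite (nrm_eq (f := g) (g := fun x => (g x - f x) + f x)); last first.
    by move=> x _; rewrite subrK.
  exact: nrmD.
have [v' vv ve] := regular_lin_bvp hL l0 rv.
have vs := small g v' sg vv ng.
have [zz sz] := difference_bvp hL l0 sg sf vv ww.
have nz := difference_rhs ha hL l0 hk1 (ltW s0) s1 sa sb sg sf vv ww vs ws.
set rhs := (X in nrm 0 L X) in nz.
rewrite -/H -/q -/Q in nz.
have [Z1 Z2] := HC _ _ sz zz.
have cz : C * nrm 0 L rhs <= C * Q * H by rewrite -mulrA ler_pM2l.
have CQH : 0 <= C * Q * H by rewrite !mulr_ge0// ltW.
have [cw _ _] := zz.
have sv : sqint 0 L v by case: rv => /inH_L2.
have := @Hnorm_le R L (2 * l + 1) _ (fun x => v x - w 0 x) (B * H) hL cw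
  (sqB sv (C0_sq c0)).
move=> /(_ _ _ _)/wrap[|||Hle].
- exact: (aeq_map (fun x y => y - w 0 x) ve).
- exact: mulr_ge0.
- have BH : B * H = q * (C * Q * H) + C * Q * H by rewrite /B; ring.
  move=> i; rewrite leq_eqVlt => /orP[/eqP->|il].
    rewrite BH; apply: (le_trans (le_trans Z2 cz)).
    by rewrite lerDr mulr_ge0.
  have i2 : (i <= 2 * l)%N by nlia.
  have ci := bvp_C0 hL zz i2.
  have bi x : 0 <= x <= L -> `|v' i x - w i x| <= C * Q * H.
    by move=> xL; apply: le_trans cz; exact: Z1.
  have := @nrm_bnd R 0 L _ _ L0' CQH (C0_sq ci) bi.
  rewrite subr0 => /le_trans; apply.
  by rewrite BH lerDl.
apply: (le_lt_trans Hle).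
rewrite mulrA -/big.
move: h2; rewrite ltr_pdivlMr// => h2; apply: le_lt_trans h2.
by rewrite mulrC ler_wpM2l// lerDl.
Qed.
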